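(* Let $Z:\mathbb R\to\mathbb R$ be a Gaussian zero-mean square-integrable process indexed by $\mathbb R$ such that $Z(x_1)=Z(x_2)$ almost surely implies $x_1=x_2$. Let $\psi:[0,+\infty)\to\mathbb R$ be a completely monotonic non-constant function and let $Y:=\mathcal{S}ch_\psi(Z)$. Let $m\ge0$ be an integer. Then the following are equivalent: 1. $Y\in C^m(\mathbb R)$; 2. $Z\in C^m(\mathbb R)$ and all derivatives of $\psi$ up to order $m$ are finite at $0^+$.
   Context: A process on $\mathbb R$ belongs to $C^m(\mathbb R)$ if it has continuous $m$-order derivative in the mean-square sense ($m=0$: mean-square continuity). For a square-integrable process $Z$ with variogram $\gamma_Z(x_1,x_2):=\mathrm{Var}(Z(x_1)-Z(x_2))$ and $\psi$ completely monotonic, $\mathcal{S}ch_\psi(Z)$ denotes the (unique in law) centred Gaussian process with covariance function $C_Y(x_1,x_2):=\psi(\gamma_Z(x_1,x_2))$ (positive definite by Schoenberg's theorem). A completely monotonic function $\psi:[0,+\infty)\to\mathbb R$ is continuous on $[0,\infty)$ (so $\psi(0)<\infty$), infinitely differentiable on $(0,\infty)$, with $(-1)^k\psi^{(k)}\ge0$ on $(0,\infty)$ for all $k\ge0$. *)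

(* Defs.v *)
From mathcomp Require Export all_boot all_order all_algebra.
From mathcomp Require Export all_classical all_reals all_analysis.

Set Implicit Arguments.
Unset Strict Implicit.
Unset Printing Implicit Defensive.

Export Order.TTheory GRing.Theory Num.Theory.
Export numFieldNormedType.Exports.

Global Open Scope ring_scope.
Global Open Scope classical_set_scope.

(* A function on [0, +oo[ is represented by a total function on R; only its
   values on [0, +oo[ are constrained, and for k >= 1 its derivatives are only
   ever taken at points of ]0, +oo[. *)
Definition completely_monotonic (R : realType) (psi : R -> R) : Prop :=
  [/\ {within `[0, +oo[%classic, continuous psi},
      forall (k : nat) (t : R), 0 < t -> derivable (derive1n k psi) t 1 &
      forall (k : nat) (t : R), 0 < t -> 0 <= (-1) ^+ k * derive1n k psi t].

Definition nonconstant_on_nonneg (R : realType) (psi : R -> R) : Prop :=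
  exists s t : R, [/\ 0 <= s, 0 <= t & psi s != psi t].

Definition derivatives_finite_at_0 (R : realType) (psi : R -> R) (m : nat) :
    Prop :=
  forall k : nat, (k <= m)%N ->
    exists l : R, derive1n k psi t @[t --> 0^'+] --> l.

Section processes.
Context {d : measure_display} {T : measurableType d} {R : realType}.
Variable P : probability T R.

Definition process : Type := R -> {RV P >-> R}.

(* Degenerate Gaussian laws are allowed. They need a separate case, because
   [normal_prob m 0] is the uniform law on [0, 1], not the Dirac mass at m. *)
Definition gaussian_rv (X : T -> R) : Prop :=
  exists m s : R, forall A : set R, measurable A ->
    P (X @^-1` A) = if s == 0 then \d_m A else normal_prob m s A.

Definition gaussian_process (X : process) : Prop :=
  forall (n : nat) (a x : 'I_n -> R),
    gaussian_rv (fun w => \sum_(i < n) a i * X (x i) w).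

Definition zero_mean (X : process) : Prop :=
  forall x : R, ('E_P[X x] = 0)%E.

Definition square_integrable (X : process) : Prop :=
  forall x : R, (X x : T -> R) \in Lfun P 2%:E.

Definition variogram (X : process) (x1 x2 : R) : R :=
  fine 'V_P[(X x1 \- X x2)%R]%E.

Definition ms_continuous (X : process) : Prop :=
  forall x : R, 'E_P[(fun w => (X y w - X x w) ^+ 2)%R]%E @[y --> x] --> 0%E.

Definition ms_derivative (X X' : process) : Prop :=
  forall x : R,
    'E_P[(fun w => ((X (x + h) w - X x w) / h - X' x w) ^+ 2)%R]%E
      @[h --> 0^'] --> 0%E.

Fixpoint ms_C (m : nat) (X : process) : Prop :=
  square_integrable X /\
  match m with
  | 0 => ms_continuous X
  | m'.+1 => exists X' : process, ms_derivative X X' /\ ms_C m' X'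
  end.

End processes.

(* [Y] is a version of Sch_psi(Z). This only prescribes the law of [Y], which
   may therefore live on another probability space than [Z]. *)
Definition is_Schoenberg (R : realType)
    (d : measure_display) (T : measurableType d) (P : probability T R)
    (d' : measure_display) (T' : measurableType d') (P' : probability T' R)
    (psi : R -> R) (Z : process P) (Y : process P') : Prop :=
  [/\ gaussian_process Y, zero_mean Y &
      forall x1 x2 : R,
        covariance P' (Y x1) (Y x2) = (psi (variogram Z x1 x2))%:E].

(* Main.v *)
Require Import Defs.
From mathcomp Require Import measurable_realfun.
From mathcomp Require Import ring lra.
From mathcomp Require Import zify.

(* The argument is Hilbertian: a square-integrable process is a curve in the
   semi-inner product space L2, with squared increments given by the variogram,
   and psi turns the variogram of Z into that of Y, namely 2 (psi 0 - psi (gam)).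
   Gaussianity plays no role.

   Regularity passes from one curve to another whenever the second variogram is
   F applied to the first one, with F of class C^m at 0 and t^(n-m) F^(n)(t) -> 0
   for n > m. Indeed the formula of Faa di Bruno writes the mixed derivatives of
   F (gam) off the diagonal as sums of F^(n)(gam) times n derivatives of gam; the
   first order ones are O(sqrt gam), which compensates the blow-up of F^(n), so
   that everything extends continuously to the diagonal. A completely monotonic psi
   with finite derivatives up to order m gives such an F, and so does the inverse
   function of 2 (psi 0 - psi).

   It remains to see that Y in C^m forces the m-th derivative of psi to be finite
   at 0. For m = 1, otherwise Z' = 0, so that Z is constant. This gives Z in C^1
   and a point x0 with Z' x0 <> 0. The k-th difference of Y at x0 has squared norm
   O(h^2k). Approximating psi by nonnegative combinations of exponentials
   exp (- xi t), each of which contributes at least c xi^k h^2k (the k-th chaos in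
   the direction Z' x0), bounds the k-th moment of the mixture, hence psi^(k). *)

Set Implicit Arguments.
Unset Strict Implicit.
Unset Printing Implicit Defensive.

(** * Derivatives and limits of real functions *)

(** The obstacle is the diagonal x = y: gam vanishes there, F may blow up beyond order m at 0, and m
    derivatives of a curve cost m derivations of F (gam) in each variable. In a term with F^(n), n >
    m, the n derivatives of gam have total order at most 2m, so at least 2 (n - m) of them have
    order one; their product is O(gam^(n-m)), exactly what t^(n-m) F^(n)(t) -> 0 absorbs. For psi
    this limit comes from monotonicity of the derivatives on [t/2, t]; for the inverse function,
    from a count of weights, valid once psi' has a finite nonzero limit at 0. This is why order one
    is settled first.

    The exponentials come from the Taylor expansion of psi at a distant point a: it is a sum of c_n
    (1 - t/a)^n with c_n >= 0, and (1 - t/a)^n is within 2t/a of exp (- (n/a) t), uniformly in n.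
    The lower bound in h holds only for n/a <= A, so the tail of the mixture is bounded apart, with
    A fixed before h. *)

Notation dv f x d := (is_derive (x : _) (1%R : _) f d).

Section derivatives.
Context {R : realType}.
Implicit Types (f g : R -> R) (x a b : R).

Lemma dvE f x d d' : dv f x d -> d = d' -> dv f x d'.
Proof. by move=> h <-. Qed.
Lemma dvD f g x a b : dv f x a -> dv g x b -> dv (fun t => f t + g t) x (a + b).
Proof. by move=> hf hg; exact: is_deriveD. Qed.
Lemma dvN f x a : dv f x a -> dv (fun t => - f t) x (- a).
Proof. by move=> hf; exact: is_deriveN. Qed.
Lemma dvB f g x a b : dv f x a -> dv g x b -> dv (fun t => f t - g t) x (a - b).
Proof. by move=> hf hg; exact: is_deriveB. Qed.
Lemma dvM f g x a b : dv f x a -> dv g x b ->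
  dv (fun t => f t * g t) x (a * g x + f x * b).
Proof.
move=> hf hg; apply: (dvE (is_deriveM hf hg)).
by rewrite /GRing.scale /= addrC mulrC.
Qed.
Lemma dvC c x : dv (fun=> c : R) x 0.
Proof. exact: is_derive_cst. Qed.
Lemma dvI x : dv (fun t => t) x 1.
Proof. exact: is_derive_id. Qed.
Lemma dvZ c f x a : dv f x a -> dv (fun t => c * f t) x (c * a).
Proof. by move=> hf; apply: (dvE (dvM (dvC c x) hf)); ring. Qed.
Lemma dvX n f x a : dv f x a -> dv (fun t => f t ^+ n) x (n%:R * f x ^+ n.-1 * a).
Proof.
move=> hf; elim: n => [|n IH]; first by apply: (dvE (dvC 1 x)); ring.
rewrite (_ : (fun t => f t ^+ n.+1) = (fun t => f t * f t ^+ n)); last first.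
  by apply/funext => t; rewrite exprS.
apply: (dvE (dvM hf IH)); case: n {IH} => [|n]; first by rewrite /=; ring.
by rewrite /= !exprS -[n.+2%:R]natr1; ring.
Qed.
Lemma dv_comp f g x a b : dv f (g x) a -> dv g x b -> dv (fun t => f (g t)) x (a * b).
Proof. by move=> hf hg; exact: is_derive1_comp. Qed.
Lemma dv_unique f x a b : dv f x a -> dv f x b -> a = b.
Proof. by move=> ha hb; rewrite -(derive_val (is_derive:=ha)) (derive_val (is_derive:=hb)). Qed.
Lemma dv_cont f x a : dv f x a -> {for x, continuous f}.
Proof. by move=> h; apply: differentiable_continuous; apply/derivable1_diffP. Qed.
Lemma dv_near f g x a : (\near x, f x = g x) -> dv f x a -> dv g x a.
Proof. exact: near_eq_is_derive. Qed.

Lemma dvMVT (f f' : R -> R) a b : a < b ->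
  (forall x, a <= x <= b -> dv f x (f' x)) ->
  exists c, a < c < b /\ f b - f a = f' c * (b - a).
Proof.
move=> ab h.
have [||c] := @MVT R f f' a b ab.
- by move=> x; rewrite in_itv/= => /andP[/ltW ? /ltW ?]; apply: h; apply/andP.
- apply: derivable_within_continuous => x; rewrite in_itv/= => xab.
  by have := h x xab => ?; exact: ex_derive.
- by rewrite in_itv/= => cab e; exists c.
Qed.

Lemma dv_nincr (f f' : R -> R) a b : a <= b ->
  (forall x, a <= x <= b -> dv f x (f' x)) ->
  (forall x, a <= x <= b -> f' x <= 0) -> f b <= f a.
Proof.
rewrite le_eqVlt => /predU1P[->//|ab] h h'.
have [c [/andP[ac cb] e]] := dvMVT ab h.
have : f' c * (b - a) <= 0.
  by rewrite mulr_le0_ge0 ?subr_ge0 ?(ltW ab)// h'// (ltW ac) (ltW cb).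
by rewrite -e subr_le0.
Qed.
Lemma dv_ndecr (f f' : R -> R) a b : a <= b ->
  (forall x, a <= x <= b -> dv f x (f' x)) ->
  (forall x, a <= x <= b -> 0 <= f' x) -> f a <= f b.
Proof.
move=> ab h h'; rewrite -lerN2.
apply: (@dv_nincr (fun x => - f x) (fun x => - f' x)) => // x xab.
  by apply: dvN; exact: h.
by rewrite oppr_le0 h'.
Qed.

End derivatives.

Section derivatives_and_limits.
Context {R : realType}.
Implicit Types (f g : R -> R) (x a b : R).

Lemma dvV f x a : dv f x a -> f x != 0 -> dv (fun t => (f t)^-1) x (- a / f x ^+ 2).
Proof.
move=> hf fx; apply: (dvE (is_deriveV fx hf)).
by rewrite /GRing.scale /= !mulNr mulrC.
Qed.

Lemma cvg_at_rightP f (l : R) : f t @[t --> 0^'+] --> l <->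
  forall e : R, 0 < e -> exists2 d : R, 0 < d & forall t : R, 0 < t < d -> `|f t - l| < e.
Proof.
split=> [/cvgrPdist_lt h e e0|h].
  have [d /= d0 hd] := h e e0.
  exists d => // t /andP[t0 td]; rewrite distrC; apply: hd => //.
  by rewrite /ball_ /= sub0r normrN gtr0_norm.
apply/cvgrPdist_lt => e e0; have [d d0 hd] := h e e0.
exists d => //= t; rewrite /ball_ /= sub0r normrN => td t0.
by rewrite distrC hd// t0 /=; rewrite gtr0_norm in td.
Qed.

Lemma cvg_within_at_rightP (D : set R) f (l : R) : f t @[t --> within D (0^'+)] --> l <->
  forall e : R, 0 < e -> exists2 d : R, 0 < d & forall t : R, D t -> 0 < t < d -> `|f t - l| < e.
Proof.
split=> [/cvgrPdist_lt h e e0|h].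
  have [d /= d0 hd] := h e e0.
  exists d => // t Dt /andP[t0 td]; rewrite distrC; apply: hd => //.
  by rewrite /ball_ /= sub0r normrN gtr0_norm.
apply/cvgrPdist_lt => e e0; have [d d0 hd] := h e e0.
exists d => //= t; rewrite /ball_ /= sub0r normrN => td t0 Dt.
by rewrite distrC hd// t0 /=; rewrite gtr0_norm in td.
Qed.

Lemma continuous2P (G : R -> R -> R) : continuous (fun p : R * R => G p.1 p.2) <->
  forall x y e : R, 0 < e -> exists2 d : R, 0 < d & forall x' y' : R,
    `|x' - x| < d -> `|y' - y| < d -> `|G x' y' - G x y| < e.
Proof.
split=> [h x y e e0|h [x y]].
  have /cvgrPdist_lt /(_ e e0) := h (x, y).
  move=> [[A B] /= [[d1 /= d10 h1] [d2 /= d20 h2]] hAB].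
  exists (Num.min d1 d2); first by rewrite lt_min d10.
  move=> x' y'; rewrite !lt_min => /andP[xd _] /andP[_ yd].
  rewrite distrC; apply: (hAB (x', y')); split => /=.
    by apply: h1; rewrite /= distrC.
  by apply: h2; rewrite /= distrC.
apply/cvgrPdist_lt => e e0 /=.
have [d d0 hd] := h x y e e0.
exists (ball x d, ball y d) => /=; first by split; exact: nbhsx_ballx.
move=> [x' y'] /= [h1 h2]; rewrite distrC; apply: hd; rewrite distrC //.
Qed.

End derivatives_and_limits.

(** * Taylor expansions of completely monotonic functions *)

Section cm.
Context {R : realType}.
Implicit Types (q : nat -> R -> R) (a t s : R) (N k m : nat).

(** [q k] is the k-th derivative with its sign (-1)^k absorbed: every [q k] is nonnegative and
    nonincreasing, and the class is stable under [shift], which carries the inductions on the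
    order. *)
Definition cmseq q := forall k t, 0 < t -> dv (q k) t (- q k.+1 t) /\ 0 <= q k t.

Definition shift q : nat -> R -> R := fun k => q k.+1.

Lemma cmseq_shift q : cmseq q -> cmseq (shift q).
Proof. by move=> h k t t0; exact: h. Qed.

Lemma cmseq_shiftn q m : cmseq q -> cmseq (fun k => q (m + k)%N).
Proof. by move=> h k t t0; rewrite addnS; exact: h. Qed.

Lemma cmseq_ge0 q k t : cmseq q -> 0 < t -> 0 <= q k t.
Proof. by move=> h t0; have [] := h k t t0. Qed.

Lemma cmseq_nincr q k s t : cmseq q -> 0 < s -> s <= t -> q k t <= q k s.
Proof.
move=> h s0 st; apply: (@dv_nincr _ (q k) (fun x => - q k.+1 x)) => // x /andP[sx xt].
  by have [] := h k x (lt_le_trans s0 sx).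
by rewrite oppr_le0 cmseq_ge0// (lt_le_trans s0).
Qed.

Definition taylor q a N t : R := \sum_(k < N) q k a * (a - t) ^+ k / k`!%:R.
Definition taylor_rem q a N t : R := q 0%N t - taylor q a N t.

Lemma taylor_recr q a N t :
  taylor q a N.+1 t = taylor q a N t + q N a * (a - t) ^+ N / N`!%:R.
Proof. by rewrite /taylor big_ord_recr. Qed.

Lemma dv_taylor q a N t : dv (taylor q a N.+1) t (- taylor (shift q) a N t).
Proof.
elim: N => [|N IH].
  rewrite (_ : taylor q a 1 = fun=> q 0%N a); last first.
    by apply/funext => s; rewrite /taylor big_ord1 expr0 fact0 divr1 mulr1.
  by apply: (dvE (dvC _ t)); rewrite /taylor big_ord0 oppr0.
rewrite (_ : taylor q a N.+2 = fun s => taylor q a N.+1 s +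
   (q N.+1 a / N.+1`!%:R) * (a - s) ^+ N.+1); last first.
  by apply/funext => s; rewrite taylor_recr; congr (_ + _); ring.
apply: (dvE (dvD IH (dvZ _ (dvX N.+1 (dvB (dvC a t) (dvI t)))))).
rewrite taylor_recr /shift opprD; congr (_ + _); rewrite /= factS natrM.
have ? : N`!%:R != 0 :> R by rewrite pnatr_eq0 -lt0n fact_gt0.
have ? : N.+1%:R != 0 :> R by rewrite pnatr_eq0.
by field; apply/andP.
Qed.

Lemma dv_taylor_rem q a N t : cmseq q -> 0 < t ->
  dv (taylor_rem q a N.+1) t (- taylor_rem (shift q) a N t).
Proof.
move=> h t0; have [h0 _] := h 0%N t t0.
by apply: (dvE (dvB h0 (dv_taylor q a N t))); rewrite /taylor_rem /shift; ring.
Qed.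

Lemma taylor_rem_id q a N : taylor_rem q a N.+1 a = 0.
Proof.
rewrite /taylor_rem /taylor big_ord_recl big1 /=.
  by rewrite expr0 fact0 divr1 mulr1 addr0 subrr.
by move=> i _; rewrite subrr expr0n /= mulr0 mul0r.
Qed.

(** The remainder vanishes at a, and its derivative is minus a remainder of lower order of the
    shifted sequence; by induction it decreases to 0 on the left of a. *)
Lemma taylor_rem_ge0 q a N t : cmseq q -> 0 < t <= a -> 0 <= taylor_rem q a N t.
Proof.
elim: N q t => [|N IH] q t h /andP[t0 ta].
  by rewrite /taylor_rem /taylor big_ord0 subr0 cmseq_ge0.
rewrite -(taylor_rem_id q a N).
apply: (@dv_nincr _ _ (fun x => - taylor_rem (shift q) a N x)) => // x /andP[tx xa].
  by apply: dv_taylor_rem => //; exact: lt_le_trans tx.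
by rewrite oppr_le0; apply: IH; [exact: cmseq_shift|rewrite xa (lt_le_trans t0)].
Qed.

(** This is the sign of the derivative of the remainder divided by (a - t)^(N+1). The difference of
    the two sides vanishes at a, and its derivative is given by the same inequality for the shifted
    sequence, one order lower. *)
Lemma taylor_rem_le_deriv q a N t : cmseq q -> 0 < t <= a ->
  N.+1%:R * taylor_rem q a N.+1 t <= (a - t) * taylor_rem (shift q) a N t.
Proof.
elim: N q t => [|N IH] q t h /andP[t0 ta]; rewrite -subr_le0.
- pose D x := 1%:R * taylor_rem q a 1 x - (a - x) * q 1%N x.
  rewrite (_ : _ - _ = D t); last first.
    by rewrite /D {2}/taylor_rem /taylor big_ord0 subr0.
  rewrite (_ : 0 = D a); last by rewrite /D taylor_rem_id; ring.
  apply: (@dv_ndecr _ D (fun x => (a - x) * q 2%N x)) => // x /andP[tx xa].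
    have x0 := lt_le_trans t0 tx; have [h1 _] := h 1%N x x0.
    apply: (dvE (dvB (dvZ 1%:R (dv_taylor_rem a 0 h x0))
                     (dvM (dvB (dvC a x) (dvI x)) h1))).
    by rewrite /taylor_rem /taylor big_ord0 /shift; ring.
  by rewrite mulr_ge0 ?subr_ge0// cmseq_ge0 // (lt_le_trans t0).
- pose D x := N.+2%:R * taylor_rem q a N.+2 x - (a - x) * taylor_rem (shift q) a N.+1 x.
  rewrite -/(D t) (_ : 0 = D a); last by rewrite /D taylor_rem_id; ring.
  apply: (@dv_ndecr _ D (fun x => (a - x) * taylor_rem (shift (shift q)) a N x
     - N.+1%:R * taylor_rem (shift q) a N.+1 x)) => // x /andP[tx xa];
    have x0 := lt_le_trans t0 tx.
    apply: (dvE (dvB (dvZ N.+2%:R (dv_taylor_rem a N.+1 h x0))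
       (dvM (dvB (dvC a x) (dvI x)) (dv_taylor_rem a N (cmseq_shift h) x0)))).
    by rewrite -[N.+2%:R]natr1; ring.
  by rewrite subr_ge0; apply: IH; [exact: cmseq_shift|rewrite x0].
Qed.

Lemma taylor_rem_ratio q a N s t : cmseq q -> 0 < s -> s <= t -> t < a ->
  taylor_rem q a N t / (a - t) ^+ N <= taylor_rem q a N s / (a - s) ^+ N.
Proof.
move=> h s0 st ta; case: N => [|N].
  by rewrite !expr0 !divr1 /taylor_rem /taylor !big_ord0 !subr0 cmseq_nincr.
apply: (@dv_nincr _ (fun x => taylor_rem q a N.+1 x * ((a - x) ^+ N.+1)^-1)
  (fun x => (N.+1%:R * taylor_rem q a N.+1 x - (a - x) * taylor_rem (shift q) a N x)
            / (a - x) ^+ N.+2)) => // x /andP[sx xt];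
  have x0 := lt_le_trans s0 sx; have xa : 0 < a - x by rewrite subr_gt0 (le_lt_trans xt).
  have xa0 : a - x != 0 by rewrite gt_eqF.
  have xN0 : (a - x) ^+ N.+1 != 0 by rewrite expf_neq0.
  apply: (dvE (dvM (dv_taylor_rem a N h x0) (dvV (dvX N.+1 (dvB (dvC a x) (dvI x))) xN0))).
  by rewrite /= !exprS; field; rewrite xa0 expf_neq0.
rewrite pmulr_lle0 ?invr_gt0 ?exprn_gt0// subr_le0; apply: taylor_rem_le_deriv => //.
by rewrite x0 -subr_ge0 ltW.
Qed.

Lemma taylor_ge0 q a N t : cmseq q -> 0 < t <= a -> 0 <= taylor q a N t.
Proof.
move=> h /andP[t0 ta]; apply: sumr_ge0 => k _.
rewrite !mulr_ge0 ?exprn_ge0 ?subr_ge0 ?invr_ge0 ?ler0n// cmseq_ge0//.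
exact: lt_le_trans ta.
Qed.

(** Geometric decay in N: the remainder at s is at most q 0 s because the Taylor terms are
    nonnegative, and the monotone ratio carries this bound from s to t. *)
Lemma taylor_rem_le q a N s t : cmseq q -> 0 < s -> s <= t -> t < a ->
  taylor_rem q a N t <= ((a - t) / (a - s)) ^+ N * q 0%N s.
Proof.
move=> h s0 st ta; have sa := le_lt_trans st ta.
have := taylor_rem_ratio N h s0 st ta.
rewrite ler_pdivrMr ?exprn_gt0 ?subr_gt0// => /le_trans; apply.
rewrite expr_div_n -mulrA mulrC [_^-1 * _]mulrC ler_pM2l; last first.
  by rewrite divr_gt0 // exprn_gt0 ?subr_gt0.
by rewrite /taylor_rem lerBlDr lerDl taylor_ge0// s0 ltW.
Qed.

Lemma taylor_cvg q a t : cmseq q -> 0 < t -> t < a ->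
  taylor q a N t @[N --> \oo] --> q 0%N t.
Proof.
(* Any point strictly between 0 and t would do: the geometric ratio (a - t) / (a - s) is then below
   1. *)
move=> h t0 ta; pose s := t / 2.
have s0 : 0 < s by rewrite divr_gt0.
have st : s < t by rewrite /s; lra.
have z0 : ((a - t) / (a - s)) ^+ N * q 0%N s @[N --> \oo] --> (0 : R).
  rewrite -[0](mul0r (q 0%N s)); apply: cvgMl.
  apply: cvg_expr; rewrite ger0_norm ?divr_ge0 ?subr_ge0 ?(ltW ta)//; last by rewrite ltW// (lt_trans st).
  by rewrite ltr_pdivrMr ?subr_gt0 ?(lt_trans st)// mul1r ltrD2l ltrN2.
have : taylor_rem q a N t @[N --> \oo] --> (0 : R).
  apply: (@squeeze_cvgr _ _ _ _ (fun=> 0) (fun N => ((a - t) / (a - s)) ^+ N * q 0%N s)) => //; last exact: cvg_cst.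
  near=> N; rewrite taylor_rem_ge0 ?t0 ?(ltW ta)//=.
  by apply: taylor_rem_le => //; exact: ltW.
move=> h0; rewrite (_ : taylor q a ^~ t = fun N => q 0%N t - taylor_rem q a N t); last first.
  by apply/funext => N; rewrite /taylor_rem; ring.
by rewrite -[X in _ --> X]subr0; apply: cvgB => //; exact: cvg_cst.
Unshelve. all: by end_near. Qed.

(** By monotonicity [q 1] vanishes to the right of t0, hence so do all higher derivatives; the
    Taylor series at a point a > t0 then reduces to its constant term, and it also converges to the
    left of t0. *)
Lemma cmseq_eq_cst q t0 : cmseq q -> 0 < t0 -> q 1%N t0 = 0 ->
  forall s t, 0 < s -> 0 < t -> q 0%N s = q 0%N t.
Proof.
move=> h t00 h0.
have hk k t : t0 < t -> q k.+1 t = 0.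
  elim: k t => [|k IH] t tt.
    apply/eqP; rewrite eq_le cmseq_ge0// ?(lt_trans t00)// andbT -h0.
    by rewrite cmseq_nincr// ltW.
  have [hd _] := h k.+1 t (lt_trans t00 tt).
  have : dv (q k.+1) t 0.
    apply: dv_near (dvC 0 t).
    by near=> x; rewrite IH//; near: x; exact: lt_nbhsr.
  by move=> hd0; apply/eqP; rewrite -oppr_eq0; apply/eqP; exact: dv_unique hd hd0.
have H t a : 0 < t -> t < a -> t0 < a -> q 0%N t = q 0%N a.
  move=> t_0 ta t0a; have := taylor_cvg h t_0 ta; rewrite -cvg_shiftS.
  rewrite (_ : (fun N => _) = fun=> q 0%N a); last first.
    apply/funext => N; rewrite /taylor big_ord_recl big1.
      by rewrite expr0 fact0 divr1 mulr1 addr0.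
    by move=> i _; rewrite /= hk// !mul0r.
  by move/(cvg_lim (@Rhausdorff R)) => <-; rewrite lim_cst.
move=> s t s0 t_0; pose a := Num.max t0 (Num.max s t) + 1.
have [? ? ?] : [/\ t0 < a, s < a & t < a].
  by split; rewrite /a ltr_pwDr// !le_max lexx ?orbT.
by rewrite (H s a)// (H t a).
Unshelve. all: by end_near. Qed.

End cm.

(** * Behaviour at zero and inverse functions *)

Section cm_at_zero.
Context {R : realType}.
Implicit Types (q : nat -> R -> R) (t s l : R) (j k m : nat).

Lemma cmseq_lim q k (C : R) : cmseq q -> (forall t, 0 < t -> q k t <= C) ->
  exists l, q k t @[t --> 0^'+] --> l.
Proof.
move=> h hC; eexists; apply: (@nonincreasing_at_right_cvgr _ _ _ +oo%O) => //.
  move=> s t; rewrite !in_itv/= !andbT => s0 t0 st.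
  by apply: cmseq_nincr.
by exists C => y /= [t]; rewrite in_itv/= andbT => t0 <-; exact: hC.
Qed.

Lemma cmseq_le_lim q k l t : cmseq q -> q k t @[t --> 0^'+] --> l -> 0 < t ->
  q k t <= l.
Proof.
move=> h /cvg_at_rightP hl t0; apply/ler_addgt0Pr => e e0.
have [d d0 hd] := hl e e0.
pose s := Num.min t (d / 2).
have s0 : 0 < s by rewrite lt_min t0 divr_gt0.
have sd : s < d by rewrite gt_min [d / 2 < d]ltr_pdivrMr// ltr_pMr// ltr1n orbT.
have := hd s; rewrite s0 sd => /(_ isT); rewrite ltr_norml ltrBlDl => /andP[_ /ltW].
rewrite addrC; apply: le_trans; apply: cmseq_nincr => //.
by rewrite ge_min lexx.
Qed.

Lemma cmseq_half q k t : cmseq q -> 0 < t -> t / 2 * q k.+1 t <= q k (t / 2) - q k t.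
Proof.
move=> h t0; have t20 : 0 < t / 2 by rewrite divr_gt0.
have t2t : t / 2 < t by lra.
have [|c [/andP[tc ct]]] := @dvMVT _ (q k) (fun x => - q k.+1 x) _ _ t2t.
  by move=> x /andP[tx _]; have [] := h k x (lt_le_trans t20 tx).
have -> : t - t / 2 = t / 2 by lra.
move=> e; rewrite -opprB e mulNr opprK mulrC ler_pM2r//.
by apply: cmseq_nincr => //; [exact: lt_trans tc|exact: ltW].
Qed.

(** By [cmseq_half], t/2 * q (k+1) t is at most q k (t/2) - q k t, which tends to 0 as q k
    converges. Each further order costs one factor t and a passage from t to t/2. *)
Lemma cmseq_vanish q k l j : cmseq q -> q k t @[t --> 0^'+] --> l ->
  t ^+ j.+1 * q (k + j.+1)%N t @[t --> 0^'+] --> 0.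
Proof.
move=> h hl; elim: j => [|j IH]; apply/cvg_at_rightP => e e0.
- have /cvg_at_rightP/(_ (e / 4)) := hl.
  rewrite divr_gt0// => /(_ isT)[d d0 hd]; exists d => // t /andP[t0 td].
  have t20 : 0 < t / 2 by rewrite divr_gt0.
  have := hd t; rewrite t0 td => /(_ isT); rewrite ltr_norml => /andP[h1 h2].
  have := hd (t / 2); rewrite t20 (lt_trans _ td); last by lra.
  move=> /(_ isT); rewrite ltr_norml => /andP[h3 h4].
  rewrite addn1 subr0 expr1 ger0_norm ?mulr_ge0 ?cmseq_ge0 ?(ltW t0)//.
  by have := cmseq_half k h t0; lra.
(* At t/2 the induction hypothesis involves (t/2)^(j+1); returning to t^(j+2), with the 2 of
   [cmseq_half], costs 2^(j+2). *)
- have /cvg_at_rightP/(_ (e / 2 ^+ j.+2)) := IH.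
  rewrite divr_gt0 ?exprn_gt0// => /(_ isT)[d d0 hd]; exists d => // t /andP[t0 td].
  have t20 : 0 < t / 2 by rewrite divr_gt0.
  have := hd (t / 2); rewrite t20 (lt_trans _ td); last by lra.
  have ge0 n x : 0 < x -> 0 <= x ^+ n * q (k + n)%N x.
    by move=> x0; apply: mulr_ge0; [rewrite exprn_ge0// ltW|exact: cmseq_ge0].
  move=> /(_ isT); rewrite !subr0 !ger0_norm ?ge0//.
  rewrite ltr_pdivlMr ?exprn_gt0//; apply: le_lt_trans.
  rewrite addnS [in leLHS]exprS expr_div_n [2 ^+ j.+2]exprS.
  have h2 : t / 2 * q (k + j.+1).+1 t <= q (k + j.+1)%N (t / 2).
    by apply: (le_trans (cmseq_half _ h t0)); rewrite gerBl cmseq_ge0.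
  have tj : 0 < t ^+ j.+1 by rewrite exprn_gt0.
  rewrite [leRHS](_ : _ = 2 * t ^+ j.+1 * q (k + j.+1)%N (t / 2)); last first.
    by field; rewrite expf_neq0//.
  rewrite [leLHS](_ : _ = 2 * t ^+ j.+1 * (t / 2 * q (k + j.+1).+1 t)); last by field.
  by rewrite ler_pM2l// mulr_gt0.
Qed.

End cm_at_zero.

Section inverse.
Context {R : realType}.
Variable F : nat -> R -> R.
Hypothesis F_dv : forall n (t : R), 0 < t -> dv (F n) t (F n.+1 t).
Hypothesis F1_gt0 : forall t : R, 0 < t -> 0 < F 1%N t.

Lemma F_incr s t : 0 < s -> s < t -> F 0%N s < F 0%N t.
Proof.
move=> s0 st; have [|c [/andP[sc _] e]] := @dvMVT _ (F 0%N) (F 1%N) _ _ st.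
  by move=> x /andP[sx _]; apply: F_dv; exact: lt_le_trans sx.
by rewrite -subr_gt0 e mulr_gt0 ?subr_gt0// F1_gt0// (lt_trans s0).
Qed.

Lemma F_inj s t : 0 < s -> 0 < t -> F 0%N s = F 0%N t -> s = t.
Proof.
move=> s0 t0; case: (ltgtP s t) => // [/(F_incr s0)|/(F_incr t0)] st e;
  by move: st; rewrite e ltxx.
Qed.

Lemma F_ltV s t : 0 < s -> 0 < t -> F 0%N s < F 0%N t -> s < t.
Proof.
move=> s0 t0; case: (ltgtP s t) => // [/(F_incr t0) st|->]; last by rewrite ltxx.
by rewrite ltNge (ltW st).
Qed.

(** F need not map onto ]0, +oo[: outside its range the value is the default 0, and later limits are
    taken within [F_range]. *)
Definition Finv (s : R) : R := xget 0 [set t | 0 < t /\ F 0%N t = s].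

Lemma FK t : 0 < t -> Finv (F 0%N t) = t.
Proof.
move=> t0; rewrite /Finv; case: xgetP => [_ -> [x0 /F_inj]|]; first exact.
by move=> /(_ t) /=; case.
Qed.

Lemma dv_Finv t : 0 < t -> dv Finv (F 0%N t) (F 1%N t)^-1.
Proof.
move=> t0; apply: is_derive_inverse.
- by near=> z; apply: FK; near: z; exact: lt_nbhsr.
- near=> z; have z0 : 0 < z by near: z; exact: lt_nbhsr.
  exact: dv_cont (F_dv 0 z0).
- exact: F_dv.
- by rewrite gt_eqF// F1_gt0.
Unshelve. all: by end_near. Qed.

(* Functions on ]0, +oo[ built from F', F'', ... and 1/F', a derivative
   F^(k+1) having weight k: differentiation raises the weight by one. *)
Inductive weighted : nat -> (R -> R) -> Prop :=
| weighted_F k : weighted k (F k.+1)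
| weighted_inv : weighted 0 (fun t => (F 1%N t)^-1)
| weighted_add w f g : weighted w f -> weighted w g -> weighted w (fun t => f t + g t)
| weighted_opp w f : weighted w f -> weighted w (fun t => - f t)
| weighted_mul v w f g : weighted v f -> weighted w g ->
    weighted (v + w) (fun t => f t * g t)
| weighted_ext w f g : (forall t : R, 0 < t -> f t = g t) -> weighted w f -> weighted w g.

Lemma weighted_dv w f : weighted w f ->
  exists2 f', weighted w.+1 f' & forall t : R, 0 < t -> dv f t (f' t).
Proof.
elim=> {w f} [k||w f g _ [f' wf f'P] _ [g' wg g'P]|w f _ [f' wf f'P]|
  v w f g wf [f' wf' f'P] wg [g' wg' g'P]|w f g fg _ [f' wf f'P]].
- by exists (F k.+2); [exact: weighted_F|move=> t t0; exact: F_dv].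
- exists (fun t => - (F 2%N t * ((F 1%N t)^-1 * (F 1%N t)^-1))).
    apply: weighted_opp; rewrite (_ : 1%N = (1 + (0 + 0))%N)//.
    apply: weighted_mul; [exact: (weighted_F 1)|].
    by apply: weighted_mul; exact: weighted_inv.
  move=> t t0; have F10 : F 1%N t != 0 by rewrite gt_eqF// F1_gt0.
  apply: (dvE (dvV (F_dv 1 t0) F10)).
  by field.
- exists (fun t => f' t + g' t); first exact: weighted_add.
  by move=> t t0; apply: dvD; [exact: f'P|exact: g'P].
- exists (fun t => - f' t); first exact: weighted_opp.
  by move=> t t0; apply: dvN; exact: f'P.
- exists (fun t => f' t * g t + f t * g' t).
    apply: weighted_add; first by rewrite -addSn; exact: weighted_mul.
    by rewrite -addnS; exact: weighted_mul.
  by move=> t t0; apply: dvM; [exact: f'P|exact: g'P].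
- exists f' => // t t0; apply: dv_near (f'P t t0).
  by near=> x; apply: fg; near: x; exact: lt_nbhsr.
Unshelve. all: by end_near. Qed.

(* The n-th derivative of the inverse function of F, at the point F t. *)
Fixpoint inv_deriv_param n : R -> R :=
  if n is k.+1 then fun t => derive1 (inv_deriv_param k) t / F 1%N t else id.

(** The first derivative 1/F' has weight 0; each further step differentiates, which adds one to the
    weight, and divides by F', which keeps it. *)
Lemma weighted_inv_deriv_param n : weighted n (inv_deriv_param n.+1).
Proof.
elim: n => [|n IH].
  apply: weighted_ext weighted_inv => t t0 /=.
  by rewrite derive1E derive_id mul1r.
have [f' wf' f'P] := weighted_dv IH.
have : weighted (n.+1 + 0) (fun t => f' t * (F 1%N t)^-1).
  by apply: weighted_mul => //; exact: weighted_inv.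
rewrite addn0; apply: weighted_ext => t t0; rewrite /= derive1E; congr (_ / _).
by have fd := f'P t t0; rewrite derive_val.
Qed.

Lemma inv_deriv_param_dv n (t : R) : 0 < t -> dv (inv_deriv_param n) t (derive1 (inv_deriv_param n) t).
Proof.
move=> t0; case: n => [|n].
  by apply: (dvE (dvI t)); rewrite derive1E derive_id.
have [f' _ /(_ t t0) f'P] := weighted_dv (weighted_inv_deriv_param n).
by apply: (dvE f'P); rewrite derive1E derive_val.
Qed.

Definition inv_deriv n (s : R) : R := inv_deriv_param n (Finv s).

Lemma inv_deriv0 (t : R) : 0 < t -> inv_deriv 0 (F 0%N t) = t.
Proof. by move=> t0; rewrite /inv_deriv FK. Qed.

Lemma dv_inv_deriv n (t : R) : 0 < t ->
  dv (inv_deriv n) (F 0%N t) (inv_deriv n.+1 (F 0%N t)).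
Proof.
move=> t0; have h := dv_Finv t0.
have hp : dv (inv_deriv_param n) (Finv (F 0%N t)) (derive1 (inv_deriv_param n) t).
  by rewrite FK//; exact: inv_deriv_param_dv.
by apply: (dvE (dv_comp hp h)); rewrite /inv_deriv /= FK.
Qed.

Hypothesis F0_lim : F 0%N t @[t --> 0^'+] --> 0.

Definition F_range : set R := [set F 0%N t | t in [set t | 0 < t]].

Lemma F_gt0 (t : R) : 0 < t -> 0 < F 0%N t.
Proof.
move=> t0; have t20 : 0 < t / 2 by rewrite divr_gt0.
apply: (@le_lt_trans _ _ (F 0%N (t / 2))); last by apply: F_incr => //; lra.
apply/ler_addgt0Pr => e e0.
have /cvg_at_rightP/(_ e e0)[d d0 hd] := F0_lim.
pose s := Num.min (t / 2) (d / 2).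
have s0 : 0 < s by rewrite lt_min t20 divr_gt0.
have sd : s < d by rewrite gt_min [d / 2 < d]ltr_pdivrMr// ltr_pMr// ltr1n orbT.
have := hd s; rewrite s0 sd subr0 => /(_ isT); rewrite ltr_norml => /andP[].
have : F 0%N s <= F 0%N (t / 2).
  have : s <= t / 2 by rewrite ge_min lexx.
  by rewrite le_eqVlt => /predU1P[->//|/(F_incr s0)/ltW].
lra.
Qed.

Lemma cvg_F_range (g : R -> R) (l : R) : g (F 0%N t) @[t --> 0^'+] --> l ->
  g s @[s --> within F_range (0^'+)] --> l.
Proof.
move=> /cvg_at_rightP h; apply/cvg_within_at_rightP => e e0.
have [d d0 hd] := h e e0; exists (F 0%N d); first exact: F_gt0.
move=> _ [t /= t0 <-] /andP[_ Ftd]; apply: hd; rewrite t0/=.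
exact: F_ltV Ftd.
Qed.

Lemma inv_deriv0_lim : inv_deriv 0 s @[s --> within F_range (0^'+)] --> 0.
Proof.
apply: cvg_F_range; apply/cvg_at_rightP => e e0; exists e => // t /andP[t0 te].
by rewrite inv_deriv0// subr0 gtr0_norm.
Qed.

Variable m : nat.
Hypothesis m_gt0 : (0 < m)%N.
(** Truncated subtraction merges two cases: up to order m the derivatives converge, beyond it the
    power of t kills their blow-up. *)
Hypothesis F_lim : forall n, exists2 l, t ^+ (n.+1 - m) * F n.+1 t @[t --> 0^'+] --> l
  & ((m < n.+1)%N -> l = 0).
Variable l1 : R.
Hypothesis F1_lim : F 1%N t @[t --> 0^'+] --> l1.
Hypothesis l1_neq0 : l1 != 0.

(** A function of weight w behaves like F^(w+1), whence the exponent w + 1 - m. In a product the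
    exponents of the factors add up to at most the required one, because m > 0. *)
Lemma weighted_lim w f : weighted w f ->
  exists2 l, t ^+ (w.+1 - m) * f t @[t --> 0^'+] --> l & ((m < w.+1)%N -> l = 0).
Proof.
elim=> {w f} [k||w f g _ [a fa a0] _ [b gb b0]|w f _ [a fa a0]|
  v w f g _ [a fa a0] _ [b gb b0]|w f g fg _ [a fa a0]].
- exact: F_lim.
- exists l1^-1; last by rewrite ltnS leqNgt m_gt0.
  rewrite (_ : (1 - m = 0)%N); last by lia.
  under eq_fun do rewrite expr0 mul1r; exact: cvgV.
- exists (a + b); last by move=> mw; rewrite a0// b0// addr0.
  by under eq_fun do rewrite mulrDr; exact: cvgD.
- exists (- a); last by move=> mw; rewrite a0// oppr0.
  by under eq_fun do rewrite mulrN; exact: cvgN.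
(* r is the surplus of the exponent over those of the two factors. Above order m, either r > 0 and
   t^r tends to 0, or r = 0 and one factor is itself above order m, with limit 0. *)
- pose r := ((v + w).+1 - m - (v.+1 - m) - (w.+1 - m))%N.
  have -> : ((v + w).+1 - m = r + (v.+1 - m) + (w.+1 - m))%N by rewrite /r; lia.
  exists (0 ^+ r * (a * b)).
    rewrite (_ : (fun t => _) = fun t =>
        t ^+ r * ((t ^+ (v.+1 - m) * f t) * (t ^+ (w.+1 - m) * g t))); last first.
      by apply/funext => t; rewrite !exprD; ring.
    apply: cvgM; last exact: cvgM.
    apply: cvg_at_right_filter; exact: exprn_continuous.
  move=> mvw; have [r0|r0] := posnP r; last by rewrite expr0n gtn_eqF// mul0r.
  have [mv|mv] := ltnP m v.+1; first by rewrite a0// mul0r mulr0.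
  by rewrite b0 ?mulr0//; move: r0; rewrite /r; lia.
- exists a => //; apply: cvg_trans fa; apply: near_eq_cvg.
  by near=> t; rewrite fg//; near: t; exact: nbhs_right_gt.
Unshelve. all: by end_near. Qed.

(** Serves to trade powers of F t for powers of t. The mean value theorem is applied on [s, t] with
    s small, F being only known to tend to 0 at 0. *)
Lemma F0_le_linear : exists C : R, exists2 d : R, 0 < d &
  forall t, 0 < t < d -> F 0%N t <= C * t.
Proof.
have /cvg_at_rightP/(_ 1 ltr01)[d d0 hd] := F1_lim.
exists (l1 + 1), d => // t /andP[t0 td].
apply/ler_addgt0Pr => e e0.
have /cvg_at_rightP/(_ e e0)[d' d'0 hd'] := F0_lim.
pose s := Num.min (t / 2) (d' / 2).
have s0 : 0 < s by rewrite lt_min !divr_gt0.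
have sd' : s < d' by rewrite gt_min [d' / 2 < d']ltr_pdivrMr// ltr_pMr// ltr1n orbT.
have st : s < t by rewrite gt_min [t / 2 < t]ltr_pdivrMr// ltr_pMr// ltr1n.
have := hd' s; rewrite s0 sd' subr0 => /(_ isT); rewrite ltr_norml => /andP[_ h1].
have [|c [/andP[sc ct] e2]] := @dvMVT _ (F 0%N) (F 1%N) _ _ st.
  by move=> x /andP[sx _]; apply: F_dv; exact: lt_le_trans sx.
have c0 := lt_trans s0 sc.
have := hd c; rewrite c0 (lt_trans ct td) => /(_ isT); rewrite ltr_norml => /andP[_ h2].
have F1c := F1_gt0 c0.
have h3 : F 1%N c * (t - s) <= (l1 + 1) * t by apply: ler_pM; lra.
lra.
Qed.

Lemma inv_deriv_lim n : exists2 l,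
  s ^+ (n.+1 - m) * inv_deriv n.+1 s @[s --> within F_range (0^'+)] --> l &
  ((m < n.+1)%N -> l = 0).
Proof.
have [l hl l0] := weighted_lim (weighted_inv_deriv_param n).
exists l => //; apply: (@cvg_F_range (fun s => s ^+ (n.+1 - m) * inv_deriv n.+1 s)).
apply: (@cvg_trans _ (F 0%N t ^+ (n.+1 - m) * inv_deriv_param n.+1 t @[t --> 0^'+])).
  by apply: near_eq_cvg; near=> t; rewrite /inv_deriv FK//; near: t; exact: nbhs_right_gt.
have [mn|mn] := ltnP m n.+1; last first.
  move: hl; rewrite (_ : (n.+1 - m = 0)%N); last by lia.
  apply: cvg_trans; apply: near_eq_cvg; near=> t.
  by rewrite !expr0.
rewrite l0// in hl *; have [C [d d0 hd]] := F0_le_linear.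
set k := (n.+1 - m)%N in hl *.
apply/cvg_at_rightP => e e0.
have /cvg_at_rightP/(_ (e / (`|C| ^+ k + 1))) := hl.
have C0 : 0 < `|C| ^+ k + 1 by rewrite ltr_wpDl// exprn_ge0.
rewrite divr_gt0// => /(_ isT)[d' d'0 hd'].
exists (Num.min d d'); first by rewrite lt_min d0.
move=> t; rewrite lt_min => /and3P[t0 td td'].
have := hd' t; rewrite t0 td' => /(_ isT); rewrite !subr0 ltr_pdivlMr//.
move: (inv_deriv_param n.+1 t) => w.
apply: le_lt_trans; rewrite !normrM !normrX (gtr0_norm t0).
apply: (@le_trans _ _ (`|C| ^+ k * (t ^+ k * `|w|))).
  rewrite [leRHS]mulrA -exprMn; apply: ler_wpM2r => //.
  rewrite lerXn2r ?nnegrE//; first by rewrite mulr_ge0// ltW.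
  rewrite gtr0_norm ?F_gt0//; apply: (@le_trans _ _ (C * t)); first by rewrite hd// t0.
  by rewrite ler_pM2r// ler_norm.
rewrite mulrC ler_wpM2l// ?lerDl// mulr_ge0// exprn_ge0// ltW//.
Unshelve. all: by end_near. Qed.

End inverse.

(** * Curves in a semi-inner product space *)

Lemma dvP {R : realType} (f : R -> R) (x d : R) :
  dv f x d <-> h^-1 * (f (x + h) - f x) @[h --> 0^'] --> d.
Proof.
have E : (fun h : R => h^-1 *: (f (h *: (1 : R) + x) - f x)) =
         (fun h : R => h^-1 * (f (x + h) - f x)).
  apply/funext => h; rewrite /GRing.scale /= mulr1 [h + x]addrC//.
split=> [[hd hv]|hd].
  by rewrite -hv -E; move: hd; rewrite /derivable => /cvg_ex[l hl]; rewrite /derive (cvg_lim _ hl).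
split; first by rewrite /derivable /= E; apply/cvg_ex; exists d.
by rewrite /derive /= E; exact: cvg_lim hd.
Qed.

(** Definiteness is left out because the vectors will be square-integrable functions, not classes
    modulo almost sure equality. *)
Record semi_inner {R : realType} {V : lmodType R} (ip : V -> V -> R) : Prop := SemiInner {
  ipC : forall u v, ip u v = ip v u ;
  ipDl : forall u v w, ip (u + v) w = ip u w + ip v w ;
  ipZl : forall a u v, ip (a *: u) v = a * ip u v ;
  ipvv_ge0 : forall u, 0 <= ip u u }.

Section semi_inner.
Context {R : realType} {V : lmodType R} {ip : V -> V -> R} (S : semi_inner ip).
Implicit Types (u v w : V) (a b c x y h : R).

Lemma ipDr u v w : ip w (u + v) = ip w u + ip w v.
Proof. by rewrite (ipC S) (ipDl S) !(ipC S w). Qed.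
Lemma ipZr a u v : ip v (a *: u) = a * ip v u.
Proof. by rewrite (ipC S) (ipZl S) (ipC S v). Qed.
Lemma ipNl u v : ip (- u) v = - ip u v.
Proof. by rewrite -scaleN1r (ipZl S) mulN1r. Qed.
Lemma ipNr u v : ip v (- u) = - ip v u.
Proof. by rewrite (ipC S) ipNl (ipC S v). Qed.
Lemma ipBl u v w : ip (u - v) w = ip u w - ip v w.
Proof. by rewrite (ipDl S) ipNl. Qed.
Lemma ipBr u v w : ip w (u - v) = ip w u - ip w v.
Proof. by rewrite ipDr ipNr. Qed.
Lemma ip0l u : ip 0 u = 0.
Proof. by rewrite -(scale0r (0 : V)) (ipZl S) mul0r. Qed.
Lemma ip0r u : ip u 0 = 0.
Proof. by rewrite (ipC S) ip0l. Qed.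

Lemma ip_suml I (r : seq I) (F : I -> V) v :
  ip (\sum_(i <- r) F i) v = \sum_(i <- r) ip (F i) v.
Proof.
elim: r => [|i r IH]; first by rewrite !big_nil ip0l.
by rewrite !big_cons (ipDl S) IH.
Qed.
Lemma ip_sumr I (r : seq I) (F : I -> V) v :
  ip v (\sum_(i <- r) F i) = \sum_(i <- r) ip v (F i).
Proof. by rewrite (ipC S) ip_suml; apply: eq_bigr => i _; rewrite (ipC S). Qed.

Definition nsq v := ip v v.
Definition nrm v := Num.sqrt (nsq v).

Lemma nsq_ge0 v : 0 <= nsq v. Proof. exact: ipvv_ge0 S v. Qed.
Lemma nrm_ge0 v : 0 <= nrm v. Proof. exact: sqrtr_ge0. Qed.
Lemma nrm_gt0 v : (0 < nrm v) = (0 < nsq v).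
Proof. exact: sqrtr_gt0. Qed.
Lemma sqr_nrm v : nrm v ^+ 2 = nsq v.
Proof. by rewrite sqr_sqrtr// nsq_ge0. Qed.
Lemma nrmZ a v : nrm (a *: v) = `|a| * nrm v.
Proof.
rewrite /nrm /nsq (ipZl S) ipZr mulrA -expr2 sqrtrM ?sqr_ge0//.
by rewrite sqrtr_sqr.
Qed.
Lemma nrm0 : nrm 0 = 0.
Proof. by rewrite -(scale0r (0 : V)) nrmZ normr0 mul0r. Qed.
Lemma nrmN v : nrm (- v) = nrm v.
Proof. by rewrite -scaleN1r nrmZ normrN1 mul1r. Qed.
Lemma nrmB u v : nrm (u - v) = nrm (v - u).
Proof. by rewrite -nrmN opprB. Qed.
Lemma nsqB u v : nsq (u - v) = nsq u + nsq v - 2 * ip u v.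
Proof. by rewrite /nsq !ipBl !ipBr (ipC S v u); ring. Qed.

Lemma nsqZ a v : nsq (a *: v) = a ^+ 2 * nsq v.
Proof. by rewrite /nsq (ipZl S) ipZr; ring. Qed.

Lemma ip_sqr_le u v : ip u v ^+ 2 <= nsq u * nsq v.
Proof.
have [v0|v0] := eqVneq (nsq v) 0; last first.
  have vp : 0 < nsq v by rewrite lt_def v0 nsq_ge0.
  have := nsq_ge0 (nsq v *: u - ip u v *: v).
  rewrite nsqB !nsqZ (ipZl S) ipZr.
  rewrite (_ : _ - _ = nsq v * (nsq u * nsq v - ip u v ^+ 2)); last by ring.
  by rewrite pmulr_rge0// subr_ge0.
(* When v is null, the square of u - t v is affine in t; a nonzero slope would let it reach -1, at
   the value of t chosen below. *)
have h t : 0 <= nsq u - 2 * t * ip u v.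
  have := nsq_ge0 (u - t *: v); rewrite nsqB nsqZ ipZr v0.
  by rewrite !mulr0 addr0 mulrA.
rewrite v0 mulr0; have [->|uv0] := eqVneq (ip u v) 0; first by rewrite expr0n.
have := h ((nsq u + 1) / (2 * ip u v)).
rewrite (_ : 2 * _ * _ = nsq u + 1); last by field.
by rewrite opprD addrA subrr sub0r oppr_ge0 ler10.
Qed.

Lemma ip_le u v : `|ip u v| <= nrm u * nrm v.
Proof.
rewrite -ler_sqr ?nnegrE ?mulr_ge0 ?nrm_ge0//.
by rewrite real_normK ?num_real// exprMn !sqr_nrm ip_sqr_le.
Qed.

Lemma nrmD u v : nrm (u + v) <= nrm u + nrm v.
Proof.
rewrite -ler_sqr ?nnegrE ?addr_ge0 ?nrm_ge0// sqrrD !sqr_nrm.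
rewrite {1}/nsq (ipDl S) !ipDr (ipC S v u) -!/(nsq _).
have := le_trans (ler_norm _) (ip_le u v); lra.
Qed.

Definition vcvg {T} (F : set_system T) (f : T -> V) (a : V) :=
  nrm (f t - a) @[t --> F] --> 0.

Lemma ip_cvg {T} {F : set_system T} {FF : Filter F} (f g : T -> V) u v :
  vcvg F f u -> vcvg F g v -> ip (f t) (g t) @[t --> F] --> ip u v.
Proof.
move=> hf hg; apply/subr_cvg0; apply/norm_cvg0P.
apply: (@squeeze_cvgr _ _ _ _ (fun=> 0) (fun t =>
  nrm (f t - u) * (nrm (g t - v) + nrm v) + nrm u * nrm (g t - v))).
- near=> t; rewrite normr_ge0 /=.
  have -> : ip (f t) (g t) - ip u v = ip (f t - u) (g t) + ip u (g t - v).
    by rewrite ipBl ipBr; ring.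
  apply: (le_trans (ler_normD _ _)); apply: lerD; last exact: ip_le.
  apply: (le_trans (ip_le _ _)); rewrite ler_wpM2l ?nrm_ge0//.
  by rewrite -{1}[g t](subrK v) nrmD.
- exact: cvg_cst.
- rewrite [X in _ --> X](_ : 0 = 0 * (0 + nrm v) + nrm u * 0); last by ring.
  apply: cvgD; first by apply: cvgM => //; apply: cvgD => //; exact: cvg_cst.
  by apply: cvgM => //; exact: cvg_cst.
Unshelve. all: by end_near. Qed.

Lemma vcvg_cst {T} {F : set_system T} {FF : Filter F} v : vcvg F (fun=> v) v.
Proof. by rewrite /vcvg subrr nrm0; exact: cvg_cst. Qed.

Implicit Types A B X : R -> V.

Definition hcont X := forall x : R, vcvg (nbhs x) X (X x).
Definition hderiv X X' := forall x : R,
  vcvg (0^') (fun h : R => h^-1 *: (X (x + h) - X x)) (X' x).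

Fixpoint hC (m : nat) X : Prop :=
  match m with
  | 0%N => hcont X
  | k.+1 => exists2 X', hderiv X X' & hC k X'
  end.

Lemma hderiv_cont X X' : hderiv X X' -> hcont X.
Proof.
move=> h x.
have h0 : h0 @[h0 --> (0 : R)^'] --> (0 : R) by apply: cvg_within.
have : nrm (X (x + h) - X x) @[h --> 0^'] --> 0.
  apply: (@squeeze_cvgr _ _ _ _ (fun=> 0) (fun h =>
    `|h| * (nrm (h^-1 *: (X (x + h) - X x) - X' x) + nrm (X' x)))).
  - near=> t; rewrite nrm_ge0 /=.
    have t0 : t != 0 by near: t; exact: nbhs_dnbhs_neq.
    have {1}-> : X (x + t) - X x = t *: (t^-1 *: (X (x + t) - X x)).
      by rewrite scalerA divff// scale1r.
    rewrite nrmZ ler_wpM2l//.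
    by rewrite -{1}[_^-1 *: _](subrK (X' x)) nrmD.
  - exact: cvg_cst.
  - have hn : `|t| @[t --> (0 : R)^'] --> `|0 : R| by apply: cvg_norm.
    have hd : nrm (t^-1 *: (X (x + t) - X x) - X' x) + nrm (X' x) @[t --> (0 : R)^'] -->
        0 + nrm (X' x) by apply: cvgD; [exact: h|exact: cvg_cst].
    by have := cvgM hn hd; rewrite normr0 mul0r; apply.
move=> /cvgrPdist_lt hh; apply/cvgrPdist_lt => e e0 /=.
have [d /= d0 hd] := hh e e0; exists d => // y /= xy.
have [->|yx] := eqVneq y x; first by rewrite subrr nrm0 subrr normr0.
have := hd (y - x); rewrite /= sub0r normrN distrC => /(_ xy).
by rewrite subr_eq0 => /(_ yx); rewrite (addrC x) subrK.
Unshelve. all: by end_near. Qed.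

Lemma hcont_shift X x : hcont X -> vcvg (0^') (fun h => X (x + h)) (X x).
Proof.
move=> /(_ x) /cvgrPdist_lt h; apply/cvgrPdist_lt => e e0 /=.
have [d /= d0 hd] := h e e0; exists d => // y /= xy y0.
by apply: hd; rewrite /= opprD addrA subrr sub0r normrN; rewrite sub0r normrN in xy.
Qed.

Lemma ip_dv A A' B B' x : hderiv A A' -> hderiv B B' ->
  dv (fun x => ip (A x) (B x)) x (ip (A' x) (B x) + ip (A x) (B' x)).
Proof.
move=> hA hB; apply/dvP.
have -> : (fun h => h^-1 * (ip (A (x + h)) (B (x + h)) - ip (A x) (B x))) =
  (fun h => ip (h^-1 *: (A (x + h) - A x)) (B (x + h)) +
            ip (A x) (h^-1 *: (B (x + h) - B x))).
  apply/funext => h; rewrite (ipZl S) ipZr -mulrDr ipBl ipBr; congr (_ * _); ring.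
apply: cvgD; apply: ip_cvg.
- exact: hA.
- exact/hcont_shift/hderiv_cont/hB.
- exact: vcvg_cst.
- exact: hB.
Qed.

Lemma hderiv_cst v : hderiv (fun=> v) (fun=> 0).
Proof.
move=> x; rewrite /vcvg; under eq_fun do rewrite subrr scaler0 subrr nrm0.
exact: cvg_cst.
Qed.

Lemma ip_dvl A A' v x : hderiv A A' -> dv (fun x => ip (A x) v) x (ip (A' x) v).
Proof.
by move=> hA; apply: (dvE (ip_dv x hA (hderiv_cst v))); rewrite ip0r addr0.
Qed.
Lemma ip_dvr B B' v x : hderiv B B' -> dv (fun x => ip v (B x)) x (ip v (B' x)).
Proof.
by move=> hB; apply: (dvE (ip_dv x (hderiv_cst v) hB)); rewrite ip0l add0r.
Qed.

Lemma ip_cont2 A B : hcont A -> hcont B ->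
  continuous (fun p : R * R => ip (A p.1) (B p.2)).
Proof.
move=> hA hB [x y]; apply: ip_cvg => /=.
  by apply: (@cvg_comp _ _ _ fst (fun t => nrm (A t - A x)) _ (nbhs x)); [exact: cvg_fst|exact: hA].
by apply: (@cvg_comp _ _ _ snd (fun t => nrm (B t - B y)) _ (nbhs y)); [exact: cvg_snd|exact: hB].
Qed.

Lemma hC_le k m X : (k <= m)%N -> hC m X -> hC k X.
Proof.
elim: m k X => [|m IH] [|k] X //= km [X' hX hX'].
  by apply: hderiv_cont hX.
by exists X' => //; exact: IH.
Qed.

Lemma hC_family m X : hC m X -> exists D : nat -> R -> V,
  [/\ D 0%N = X, forall k, (k < m)%N -> hderiv (D k) (D k.+1) &
      forall k, (k <= m)%N -> hcont (D k)].
Proof.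
elim: m X => [|m IH] X.
  by move=> h; exists (fun=> X); split => // -[].
move=> [X' h /IH [D [D0 D1 D2]]].
exists (fun k => if k is j.+1 then D j else X); split=> // -[|k]//.
- by rewrite D0.
- exact: D1.
- by move=> _; exact: hderiv_cont h.
- exact: D2.
Qed.

(** Leibniz rule without binomial coefficients: the derivative of <A 0, B 0> is <A 1, B 0> + <A 0, B
    1>, and the induction applies to both terms. *)
Lemma ip_family m (A B : nat -> R -> V) :
  (forall k, (k < m)%N -> hderiv (A k) (A k.+1)) -> (forall k, (k <= m)%N -> hcont (A k)) ->
  (forall k, (k < m)%N -> hderiv (B k) (B k.+1)) -> (forall k, (k <= m)%N -> hcont (B k)) ->
  exists N : nat -> R -> R,
  [/\ N 0%N = (fun x => ip (A 0%N x) (B 0%N x)),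
      forall k (x : R), (k < m)%N -> dv (N k) x (N k.+1 x) &
      forall k, (k <= m)%N -> continuous (N k)].
Proof.
elim: m A B => [|m IH] A B A1 A2 B1 B2.
  exists (fun _ x => ip (A 0%N x) (B 0%N x)); split=> //.
  by move=> k _ x; apply: ip_cvg; [exact: A2|exact: B2].
have [N1 [N10 N1d N1c]] := IH (fun k => A k.+1) B (fun k => A1 k.+1) (fun k => A2 k.+1)
  (fun k km => B1 k (ltnW km)) (fun k km => B2 k (leqW km)).
have [N2 [N20 N2d N2c]] := IH A (fun k => B k.+1) (fun k km => A1 k (ltnW km))
  (fun k km => A2 k (leqW km)) (fun k => B1 k.+1) (fun k => B2 k.+1).
exists (fun k => if k is j.+1 then fun x => N1 j x + N2 j x else
   fun x => ip (A 0%N x) (B 0%N x)); split=> // -[|k].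
- move=> x _; rewrite N10 N20; apply: ip_dv; [exact: A1|exact: B1].
- by move=> x km; apply: dvD; [exact: N1d|exact: N2d].
- by move=> _ x; apply: ip_cvg; [exact: A2|exact: B2].
- by move=> km x; apply: cvgD; [exact: N1c|exact: N2c].
Qed.

End semi_inner.

(** * Differentiability criterion on the kernel *)

Lemma dvMVT_signed {R : realType} (f f' : R -> R) (a h : R) :
  (forall x : R, dv f x (f' x)) ->
  exists2 c, `|c - a| <= `|h| & f (a + h) - f a = f' c * h.
Proof.
move=> hf; have [h0|h0|->] := ltgtP h 0.
- have ah : a + h < a by lra.
  have [c [/andP[c1 c2] e]] := dvMVT ah (fun x _ => hf x).
  exists c; last by rewrite -opprB e; ring.
  by rewrite ler0_norm ?ltr0_norm//; lra.
- have ah : a < a + h by lra.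
  have [c [/andP[c1 c2] e]] := dvMVT ah (fun x _ => hf x).
  exists c; last by rewrite e; ring.
  by rewrite ger0_norm ?gtr0_norm//; lra.
- by exists a; rewrite ?addr0 ?subrr ?normr0 ?mulr0.
Qed.

(** Kernel counterpart of [hC]: one derivation of a curve corresponds to one in each variable of its
    kernel, and continuity is asked only of the mixed derivatives of equal orders. *)
Fixpoint kernel_C {R : realType} (m : nat) (G : R -> R -> R) : Prop :=
  continuous (fun p : R * R => G p.1 p.2) /\
  match m with
  | 0%N => True
  | k.+1 => exists G1 G11 : R -> R -> R,
    [/\ forall x y : R, dv (fun x => G x y) x (G1 x y),
        forall x y : R, dv (G1 x) y (G11 x y) & kernel_C k G11]
  end.

Lemma kernel_C_continuous {R : realType} m (G : R -> R -> R) : kernel_C m G ->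
  continuous (fun p : R * R => G p.1 p.2).
Proof. by case: m => [|m] []. Qed.

Lemma mixed_difference {R : realType} (G G1 G11 : R -> R -> R) :
  (forall x y : R, dv (fun x => G x y) x (G1 x y)) ->
  (forall x y : R, dv (G1 x) y (G11 x y)) -> forall x y h k : R,
  exists c1 c2, [/\ `|c1 - x| <= `|h|, `|c2 - y| <= `|k| &
    G (x + h) (y + k) - G x (y + k) - G (x + h) y + G x y = G11 c1 c2 * (h * k)].
Proof.
move=> d1 d2 x y h k.
have [c1 c1P e1] := @dvMVT_signed _ (fun s => G s (y + k) - G s y)
  (fun s => G1 s (y + k) - G1 s y) x h (fun s => dvB (d1 s (y + k)) (d1 s y)).
have [c2 c2P e2] := @dvMVT_signed _ (G1 c1) (G11 c1) y k (d2 c1).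
exists c1, c2; split=> //; move: e1; rewrite e2 => e.
have -> : G11 c1 c2 * (h * k) = G11 c1 c2 * k * h by ring.
by rewrite -e; ring.
Qed.

Definition ip_complete {R : realType} {V : lmodType R} (ip : V -> V -> R) :=
  forall u : nat -> V,
  (forall e : R, 0 < e -> exists N, forall n p, (N <= n)%N -> (N <= p)%N ->
    nrm (ip:=ip) (u n - u p) < e) ->
  exists l, nrm (ip:=ip) (u n - l) @[n --> \oo] --> 0.

Section criterion.
Context {R : realType} {V : lmodType R} {ip : V -> V -> R} (S : semi_inner ip).
Local Notation nrm := (@nrm _ _ ip).
Hypothesis ipK : ip_complete ip.

(** G may differ from <X x, X y> by functions of a single variable, as the kernel -1/2 |X x - X y|^2
    does. *)
Definition increments_kernel (X : R -> V) (G : R -> R -> R) := forall x x' y y',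
  ip (X x' - X x) (X y' - X y) = G x' y' - G x y' - G x' y + G x y.

Lemma kernel_hcont X G : increments_kernel X G ->
  continuous (fun p : R * R => G p.1 p.2) -> hcont (ip:=ip) X.
Proof.
move=> XG /continuous2P Gc x; apply/cvgrPdist_lt => e e0.
have [d d0 hd] := Gc x x (e ^+ 2 / 4) (divr_gt0 (exprn_gt0 2 e0) (ltr0Sn R 3)).
exists d => // y; rewrite /ball_ /= distrC => yx.
rewrite sub0r normrN ger0_norm ?nrm_ge0//.
rewrite -ltr_sqr ?nnegrE ?nrm_ge0 ?(ltW e0)// (sqr_nrm S) /nsq XG.
have xx : `|x - x| < d by rewrite subrr normr0.
have := hd _ _ yx yx; have := hd _ _ yx xx; have := hd _ _ xx yx.
rewrite !ltr_norml => /andP[a1 a2] /andP[b1 b2] /andP[c1 c2].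
have := sqr_ge0 e; lra.
Qed.

(** Loeve's criterion. By [mixed_difference], inner products of difference quotients are values of
    G11 at nearby points; so the quotients are Cauchy, their limit X' has kernel G11, and the
    induction applies to X'. *)
Lemma kernel_hC m X G : increments_kernel X G -> kernel_C m G -> hC (ip:=ip) m X.
Proof.
elim: m X G => [|m IH] X G XG; first by case=> Gc _; exact: kernel_hcont XG Gc.
move=> [Gc [G1 [G11 [d1 d2 G11C]]]].
have G11c := kernel_C_continuous G11C.
pose D (x h : R) := h^-1 *: (X (x + h) - X x).
have DD x y e : 0 < e -> exists2 d : R, 0 < d & forall h k : R, h != 0 -> k != 0 ->
    `|h| < d -> `|k| < d -> `|ip (D x h) (D y k) - G11 x y| < e.
  move=> e0; have /continuous2P/(_ x y e e0)[d d0 hd] := G11c.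
  exists d => // h k h0 k0 hh hk.
  have [c1 [c2 [c1x c2y E]]] := mixed_difference d1 d2 x y h k.
  rewrite /D (ipZl S) (ipZr S) XG E.
  rewrite (_ : h^-1 * _ = G11 c1 c2); last by field; rewrite h0 k0.
  by apply: hd; [exact: le_lt_trans hh|exact: le_lt_trans hk].
have Cauchy x (e : R) : 0 < e -> exists2 d : R, 0 < d & forall h k : R, h != 0 -> k != 0 ->
    `|h| < d -> `|k| < d -> nrm (D x h - D x k) < e.
  move=> e0.
  (* The square of D x h - D x k combines inner products with coefficients 1, 1 and -2, each within
     e^2/4 of the same number. *)
  have [d d0 hd] := DD x x (e ^+ 2 / 4) (divr_gt0 (exprn_gt0 2 e0) (ltr0Sn R 3)).
  exists d => // h k h0 k0 hh hk.
  rewrite -ltr_sqr ?nnegrE ?nrm_ge0 ?(ltW e0)// (sqr_nrm S) (nsqB S).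
  have := hd _ _ h0 h0 hh hh; have := hd _ _ h0 k0 hh hk; have := hd _ _ k0 k0 hk hk.
  rewrite !ltr_norml /nsq => /andP[a1 a2] /andP[b1 b2] /andP[a3 a4]; lra.
have inv_lt (d : R) : 0 < d -> exists N, forall n, (N <= n)%N ->
    n.+1%:R^-1 != 0 :> R /\ `|n.+1%:R^-1 : R| < d.
  move=> d0; have := @near_infty_natSinv_lt R (PosNum d0) => -[N _ hN].
  exists N => n Nn; split; first by rewrite invr_eq0 pnatr_eq0.
  by rewrite ger0_norm ?invr_ge0//; exact: hN.
have /choice[X' X'P] : forall x, exists l, nrm (D x n.+1%:R^-1 - l) @[n --> \oo] --> 0.
  move=> x; apply: ipK => e e0; have [d d0 hd] := Cauchy x e e0.
  have [N hN] := inv_lt d d0; exists N => n p Nn Np.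
  by have [? ?] := hN n Nn; have [? ?] := hN p Np; apply: hd.
have X'd : hderiv (ip:=ip) X X'.
  move=> x; apply/cvgrPdist_lt => e e0.
  have e20 : 0 < e / 2 by rewrite divr_gt0.
  have [d d0 hd] := Cauchy x _ e20.
  exists d => // h; rewrite /ball_ /= sub0r normrN => hd' h0.
  rewrite sub0r normrN ger0_norm ?nrm_ge0// -/(D x h).
  have [N hN] := inv_lt d d0.
  have /cvgrPdist_lt/(_ _ e20)[N' _ hN'] := X'P x.
  pose n := maxn N N'.
  have [n0 nd] := hN n (leq_maxl _ _).
  have := hN' n (leq_maxr _ _); rewrite /= sub0r normrN ger0_norm ?nrm_ge0// => h2.
  have := hd _ _ h0 n0 hd' nd => h1.
  have := nrmD S (D x h - D x n.+1%:R^-1) (D x n.+1%:R^-1 - X' x).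
  rewrite addrA subrK; lra.
exists X' => //; apply: (IH X' G11) => // x x' y y'.
suff E a b : ip (X' a) (X' b) = G11 a b by rewrite !(ipBl S) !(ipBr S) !E; ring.
have l1 : ip (D a h) (D b h) @[h --> (0 : R)^'] --> ip (X' a) (X' b).
  exact: (ip_cvg S (X'd a) (X'd b)).
suff l2 : ip (D a h) (D b h) @[h --> (0 : R)^'] --> G11 a b.
  exact: (cvg_unique (@Rhausdorff R) l1 l2).
apply/cvgrPdist_lt => e e0; have [d d0 hd] := DD a b e e0.
exists d => // h; rewrite /ball_ /= sub0r normrN => hh h0.
by rewrite distrC; apply: hd.
Qed.

End criterion.

(** * Kernels composed with a function of the variogram *)

(** The mean value theorem asks for derivatives only inside the interval, so x0 may be one of its
    endpoints. *)
Lemma dv_extend {R : realType} (f f1 : R -> R) (x0 : R) : continuous f ->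
  (forall x : R, x != x0 -> dv f x (f1 x)) -> {for x0, continuous f1} -> dv f x0 (f1 x0).
Proof.
move=> fc fd f1c; apply/dvP/cvgrPdist_lt => e e0.
move/cvgrPdist_lt : f1c => /(_ e e0)[d /= d0 hd].
exists d => //= h; rewrite /ball_ /= sub0r normrN => hh h0.
have [c cP ->] : exists2 c, `|x0 - c| < d & h^-1 * (f (x0 + h) - f x0) = f1 c.
  move: h0; rewrite neq_lt => /orP[h0|h0].
  - have ah : x0 + h < x0 by lra.
    have [||c] := @MVT R f f1 _ _ ah.
    + by move=> x; rewrite in_itv/= => /andP[_ xx0]; apply: fd; rewrite lt_eqF.
    + exact: continuous_subspaceT.
    + rewrite in_itv/= => /andP[c1 c2] E; exists c.
        by rewrite ltr0_norm// in hh; rewrite gtr0_norm; lra.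
      by rewrite -opprB E; field; rewrite lt_eqF.
  - have ah : x0 < x0 + h by lra.
    have [||c] := @MVT R f f1 _ _ ah.
    + by move=> x; rewrite in_itv/= => /andP[xx0 _]; apply: fd; rewrite gt_eqF.
    + exact: continuous_subspaceT.
    + rewrite in_itv/= => /andP[c1 c2] E; exists c.
        by rewrite gtr0_norm// in hh; rewrite ltr0_norm; lra.
      by rewrite E; field; rewrite gt_eqF.
exact: hd.
Qed.

Section composed_kernel.
Context {R : realType}.
(** [g a b] is the derivative of gam of order a in x and b in y; a curve of class C^m provides
    orders up to m in each variable. *)
Variables (m : nat) (g : nat -> nat -> R -> R -> R).
Local Notation gam := (g 0 0).
Local Notation rt x y := (Num.sqrt (g 0%N 0%N x y)).
Hypothesis g_dx : forall a b (x y : R), (a < m)%N -> (b <= m)%N ->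
  dv (fun x => g a b x y) x (g a.+1 b x y).
Hypothesis g_dy : forall a b (x y : R), (a <= m)%N -> (b < m)%N ->
  dv (g a b x) y (g a b.+1 x y).
Hypothesis g_cont : forall a b, (a <= m)%N -> (b <= m)%N ->
  continuous (fun p : R * R => g a b p.1 p.2).
Hypothesis gam_ge0 : forall x y, 0 <= gam x y.
Hypothesis gam_diag : forall x, gam x x = 0.
Hypothesis g_small : forall a b (x : R), (a + b = 1)%N -> (a <= m)%N -> (b <= m)%N ->
  exists2 C : R, 0 <= C & \forall p \near ((x, x) : R * R), `|g a b p.1 p.2| <= C * rt p.1 p.2.
(** D contains the values of gam off the diagonal: ]0, +oo[ for the passage from Z to Y, the range
    of [gap] for the way back. *)
Variables (D : set R) (F : nat -> R -> R).
Hypothesis D_gam : forall x y, x != y -> D (gam x y).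
Hypothesis D_gt0 : forall t, D t -> 0 < t.
Hypothesis F_dv : forall n (t : R), D t -> dv (F n) t (F n.+1 t).
Hypothesis F_lim : forall n, (n <= m.*2)%N -> exists2 l : R,
  t ^+ (n - m) * F n t @[t --> within D (0^'+)] --> l & ((m < n)%N -> l = 0).

(* Sums of products of n partial derivatives of gam with i derivations in the
   first variable and j in the second one, as in the formula of Faa di Bruno. *)
Inductive gam_product : nat -> nat -> nat -> (R -> R -> R) -> Prop :=
| gam_product1 : gam_product 0 0 0 (fun _ _ => 1)
| gam_product0 n i j : (n <= i + j)%N -> gam_product n i j (fun _ _ => 0)
| gam_productM n i j a b f : (0 < a + b)%N -> gam_product n i j f ->
    gam_product n.+1 (i + a) (j + b) (fun x y => f x y * g a b x y)
| gam_productD n i j f1 f2 : gam_product n i j f1 -> gam_product n i j f2 ->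
    gam_product n i j (fun x y => f1 x y + f2 x y).

Lemma gam_product_le n i j f : gam_product n i j f -> (n <= i + j)%N.
Proof. by elim=> {n i j f} // n i j a b f ab _ nij; lia. Qed.

Lemma gam_product_cont n i j f : gam_product n i j f -> (i <= m)%N -> (j <= m)%N ->
  continuous (fun p : R * R => f p.1 p.2).
Proof.
elim=> {n i j f} [_ _|n i j _ _ _|n i j a b f _ _ IH im jm|n i j f1 f2 _ IH1 _ IH2 im jm] p;
  try exact: cvg_cst.
- by apply: cvgM; [apply: IH; lia|apply: g_cont; lia].
- by apply: cvgD; [exact: IH1|exact: IH2].
Qed.

Lemma gam_product_dx n i j f : gam_product n i j f -> (i < m)%N -> (j <= m)%N ->
  exists2 f', gam_product n i.+1 j f' & forall x y : R, dv (fun x => f x y) x (f' x y).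
Proof.
elim=> {n i j f} [_ _|n i j nij _ _|n i j a b f ab wf IH im jm|
  n i j f1 f2 _ IH1 _ IH2 im jm].
- exists (fun _ _ => 0); first exact: gam_product0.
  by move=> x y; exact: dvC.
- exists (fun _ _ => 0); last by move=> x y; exact: dvC.
  by apply: gam_product0; lia.
- have [||f' wf' f'P] := IH.
    by lia.
    by lia.
  exists (fun x y => f' x y * g a b x y + f x y * g a.+1 b x y).
    apply: gam_productD; first by rewrite -addSn; exact: gam_productM.
    by rewrite -addnS; apply: gam_productM; rewrite ?addSn.
  by move=> x y; apply: (dvM (f'P x y)); apply: g_dx; lia.
- have [f1' w1 f1P] := IH1 im jm; have [f2' w2 f2P] := IH2 im jm.
  exists (fun x y => f1' x y + f2' x y); first exact: gam_productD.
  by move=> x y; apply: dvD.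
Qed.

Lemma gam_product_dy n i j f : gam_product n i j f -> (i <= m)%N -> (j < m)%N ->
  exists2 f', gam_product n i j.+1 f' & forall x y : R, dv (f x) y (f' x y).
Proof.
elim=> {n i j f} [_ _|n i j nij _ _|n i j a b f ab wf IH im jm|
  n i j f1 f2 _ IH1 _ IH2 im jm].
- exists (fun _ _ => 0); first exact: gam_product0.
  by move=> x y; exact: dvC.
- exists (fun _ _ => 0); last by move=> x y; exact: dvC.
  by apply: gam_product0; lia.
- have [||f' wf' f'P] := IH.
    by lia.
    by lia.
  exists (fun x y => f' x y * g a b x y + f x y * g a b.+1 x y).
    apply: gam_productD; first by rewrite -addSn; exact: gam_productM.
    by rewrite -addnS; apply: gam_productM; rewrite ?addnS.
  by move=> x y; apply: (dvM (f'P x y)); apply: g_dy; lia.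
- have [f1' w1 f1P] := IH1 im jm; have [f2' w2 f2P] := IH2 im jm.
  exists (fun x y => f1' x y + f2' x y); first exact: gam_productD.
  by move=> x y; apply: dvD.
Qed.

Lemma gam_near_diag (x : R) (e : R) : 0 < e -> \forall p \near ((x, x) : R * R), gam p.1 p.2 < e.
Proof.
move=> e0; have gc := g_cont (leq0n m) (leq0n m).
have /cvgrPdist_lt/(_ e e0) := gc (x, x).
apply: filterS => p /=; rewrite gam_diag sub0r normrN.
by apply: le_lt_trans; exact: ler_norm.
Qed.

Lemma rt_near_diag (x : R) : \forall p \near ((x, x) : R * R), rt p.1 p.2 <= 1.
Proof.
have := gam_near_diag x (@ltr01 R); apply: filterS => p /ltW h.
by rewrite -sqrtr1 ler_wsqrtr.
Qed.

(** Each of the n factors has order at least one, so a total order i + j leaves at least 2n - (i +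
    j) factors of order exactly one, each O(sqrt gam); the others are locally bounded. *)
Lemma gam_product_bound n i j f (x : R) : gam_product n i j f -> (i <= m)%N -> (j <= m)%N ->
  exists2 C : R, 0 <= C &
    \forall p \near ((x, x) : R * R), `|f p.1 p.2| <= C * rt p.1 p.2 ^+ (n.*2 - (i + j)).
Proof.
elim=> {n i j f} [_ _|n i j nij _ _|n i j a b f ab wf IH im jm|
  n i j f1 f2 _ IH1 _ IH2 im jm].
- by exists 1 => //; near=> p; rewrite expr0 mulr1 normr1.
- by exists 0 => //; near=> p; rewrite normr0 mul0r.
- have [||C1 C10 h1] := IH.
    by lia.
    by lia.
  have [C2 C20 h2] : exists2 C : R, 0 <= C &
      \forall p \near ((x, x) : R * R), `|g a b p.1 p.2| <= C * rt p.1 p.2 ^+ (2 - (a + b)).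
    have [ab1|ab1] := eqVneq (a + b)%N 1%N.
      have [||C C0 h] := @g_small a b x ab1.
        by lia.
        by lia.
      by exists C => //; move: h; apply: filterS => p; rewrite ab1 expr1.
    rewrite (_ : (2 - (a + b) = 0)%N); last by lia.
    exists (`|g a b x x| + 1); first by rewrite addr_ge0.
    have am : (a <= m)%N by lia.
    have bm : (b <= m)%N by lia.
    have gc := g_cont am bm.
    have /cvgrPdist_lt/(_ _ (@ltr01 R)) := gc (x, x).
    apply: filterS => p /=; rewrite expr0 mulr1 distrC => h.
    have := ler_normD (g a b p.1 p.2 - g a b x x) (g a b x x).
    by rewrite subrK; lra.
  exists (C1 * C2); first exact: mulr_ge0.
  near=> p.
  have p1 : rt p.1 p.2 <= 1 by near: p; exact: rt_near_diag.
  apply: (@le_trans _ _ (C1 * C2 * rt p.1 p.2 ^+ (n.*2 - (i + j) + (2 - (a + b))))).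
    rewrite normrM exprD.
    rewrite [leRHS](_ : _ = (C1 * rt p.1 p.2 ^+ (n.*2 - (i + j))) *
                          (C2 * rt p.1 p.2 ^+ (2 - (a + b)))); last by ring.
    by apply: ler_pM => //; near: p.
  rewrite ler_wpM2l ?mulr_ge0//; apply: ler_wiXn2l => //.
  by lia.
- have [C1 C10 h1] := IH1 im jm; have [C2 C20 h2] := IH2 im jm.
  exists (C1 + C2); first exact: addr_ge0.
  near=> p; apply: (le_trans (ler_normD _ _)); rewrite mulrDl.
  by apply: lerD; near: p.
Unshelve. all: by end_near. Qed.

Definition diag_extend (L : R -> R) (G : R -> R -> R) (x y : R) : R :=
  if x == y then L x else G x y.

Lemma offdiag_near (x y : R) : x != y -> \forall p \near ((x, y) : R * R), p.1 != p.2.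
Proof.
move=> xy; have d0 : 0 < `|x - y| / 2 by rewrite divr_gt0// normr_gt0 subr_eq0.
exists (ball x (`|x - y| / 2), ball y (`|x - y| / 2)).
  by split => /=; exact: nbhsx_ballx.
move=> [x' y'] /= [] ; rewrite -ball_normE /= => hx hy; apply/eqP => e.
have := ler_normD (x - x') (y' - y); rewrite e subrKA (distrC y' y) -e.
by rewrite e in hx *; lra.
Qed.

Lemma diag_extend_cont_off (G : R -> R -> R) L (x y : R) : x != y ->
  {for (x, y), continuous (fun p : R * R => G p.1 p.2)} ->
  {for (x, y), continuous (fun p : R * R => diag_extend L G p.1 p.2)}.
Proof.
move=> xy Gc; have E : diag_extend L G x y = G x y by rewrite /diag_extend (negbTE xy).
change (diag_extend L G p.1 p.2 @[p --> (x, y)] --> diag_extend L G x y); rewrite E.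
apply: cvg_trans Gc; apply: near_eq_cvg.
by have := offdiag_near xy; apply: filterS => p /negbTE pp; rewrite /diag_extend pp.
Qed.

Lemma gam_term_diag_cont n (l : R) :
  t ^+ (n - m) * F n t @[t --> within D (0^'+)] --> l -> forall x : R,
  diag_extend (fun=> l) (fun x y => gam x y ^+ (n - m) * F n (gam x y)) p.1 p.2
    @[p --> (x, x)] --> l.
Proof.
move=> /cvg_within_at_rightP h x; apply/cvgrPdist_lt => e e0.
have [d d0 hd] := h e e0.
have := gam_near_diag x d0; apply: filterS => -[x' y'] /= hg.
rewrite /diag_extend; case: eqP => [_|/eqP xy].
  by rewrite subrr normr0.
by rewrite distrC; apply: hd; [exact: D_gam|rewrite hg andbT; exact/D_gt0/D_gam].
Qed.

(** Up to order m, F^(n) itself extends to the diagonal. Beyond it the extension is 0: the factor f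
    is O(gam^(n-m)) since i + j <= 2m, while gam^(n-m) F^(n)(gam) tends to 0. *)
Lemma gam_term_cont n i j f (l : R) : gam_product n i j f -> (i <= m)%N -> (j <= m)%N ->
  t ^+ (n - m) * F n t @[t --> within D (0^'+)] --> l -> ((m < n)%N -> l = 0) ->
  continuous (fun p : R * R => diag_extend (fun x => l * f x x)
    (fun x y => F n (gam x y) * f x y) p.1 p.2).
Proof.
move=> wf im jm hl l0 [x y].
have fc := gam_product_cont wf im jm.
have [xy|xy] := eqVneq x y; last first.
  apply: diag_extend_cont_off => //; apply: cvgM; last exact: fc.
  apply: (@continuous_comp _ _ _ (fun p : R * R => gam p.1 p.2) (F n)).
    exact: g_cont.
  exact: dv_cont (F_dv n (D_gam xy)).
rewrite -{y}xy; have Ac := gam_term_diag_cont hl x.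
have E (L : R -> R) G : diag_extend L G x x = L x by rewrite /diag_extend eqxx.
change (diag_extend (fun x => l * f x x) (fun x y => F n (gam x y) * f x y) p.1 p.2
  @[p --> (x, x)] --> diag_extend (fun x => l * f x x) (fun x y => F n (gam x y) * f x y) x x).
rewrite E.
have [nm|mn] := leqP n m.
  have -> : (fun p : R * R => diag_extend (fun x => l * f x x)
      (fun x y => F n (gam x y) * f x y) p.1 p.2) =
    (fun p : R * R => diag_extend (fun=> l)
      (fun x y => gam x y ^+ (n - m) * F n (gam x y)) p.1 p.2 * f p.1 p.2).
    apply/funext => -[x' y'] /=; rewrite /diag_extend.
    rewrite (_ : (n - m = 0)%N); last by lia.
    by case: eqP => [->//|_]; rewrite expr0 mul1r.
  by apply: cvgM; [exact: Ac|exact: (fc (x, x))].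
have l_0 := l0 mn; have [C C0 hC] := gam_product_bound x wf im jm.
rewrite l_0 mul0r; apply/norm_cvg0P.
apply: (@squeeze_cvgr _ _ _ _ (fun=> 0) (fun p : R * R => C * `|diag_extend (fun=> l)
   (fun x y => gam x y ^+ (n - m) * F n (gam x y)) p.1 p.2|)).
- near=> p; rewrite normr_ge0 /=; rewrite /diag_extend; case: eqP => [_|/eqP xy].
    by rewrite l_0 !mul0r normr0 mulr0.
  have h : `|f p.1 p.2| <= C * rt p.1 p.2 ^+ (n.*2 - (i + j)) by near: p.
  have p1 : rt p.1 p.2 <= 1 by near: p; exact: rt_near_diag.
  rewrite !normrM mulrA [leRHS]mulrC; apply: ler_wpM2l => //.
  apply: (le_trans h); apply: ler_wpM2l => //.
  rewrite ger0_norm ?exprn_ge0// -{2}(sqr_sqrtr (gam_ge0 p.1 p.2)) -exprM.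
  apply: ler_wiXn2l => //.
  lia.
- exact: cvg_cst.
- rewrite -[X in _ --> X](mulr0 C) -(normr0 R); apply: cvgM; first exact: cvg_cst.
  by have := cvg_norm Ac; rewrite l_0; apply.
Unshelve. all: by end_near. Qed.

(** Multiplicities are repeated terms, so the class is closed under both derivations with no
    coefficients to track. *)
Inductive faa_di_bruno : nat -> nat -> (R -> R -> R) -> Prop :=
| faa_term n i j f : gam_product n i j f ->
    faa_di_bruno i j (fun x y => F n (gam x y) * f x y)
| faa_add i j G1 G2 : faa_di_bruno i j G1 -> faa_di_bruno i j G2 ->
    faa_di_bruno i j (fun x y => G1 x y + G2 x y).

Lemma faa_extend i j G : faa_di_bruno i j G -> (i <= m)%N -> (j <= m)%N ->
  exists L, continuous (fun p : R * R => diag_extend L G p.1 p.2).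
Proof.
elim=> {i j G} [n i j f wf|i j G1 G2 _ IH1 _ IH2] im jm.
  have [|l hl l0] := F_lim (n := n).
    by have := gam_product_le wf; lia.
  by eexists; exact: gam_term_cont wf im jm hl l0.
have [L1 h1] := IH1 im jm; have [L2 h2] := IH2 im jm.
exists (fun x => L1 x + L2 x).
rewrite (_ : (fun p : R * R => _) = fun p : R * R =>
  diag_extend L1 G1 p.1 p.2 + diag_extend L2 G2 p.1 p.2).
  by move=> p; apply: cvgD; [exact: h1|exact: h2].
by apply/funext => p; rewrite /diag_extend; case: eqP.
Qed.

Lemma faa_dx i j G : faa_di_bruno i j G -> (i < m)%N -> (j <= m)%N ->
  exists2 G', faa_di_bruno i.+1 j G' &
    forall x y : R, x != y -> dv (fun x => G x y) x (G' x y).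
Proof.
elim=> {i j G} [n i j f wf|i j G1 G2 _ IH1 _ IH2] im jm; last first.
  have [G1' w1 h1] := IH1 im jm; have [G2' w2 h2] := IH2 im jm.
  exists (fun x y => G1' x y + G2' x y); first exact: faa_add.
  by move=> x y xy; apply: dvD; [exact: h1|exact: h2].
have [f' wf' f'P] := gam_product_dx wf im jm.
exists (fun x y => F n.+1 (gam x y) * (f x y * g 1 0 x y) + F n (gam x y) * f' x y).
  apply: faa_add; last exact: faa_term.
  have w := @gam_productM n i j 1 0 f isT wf; rewrite addn1 addn0 in w.
  exact: (faa_term w).
move=> x y xy.
have h1 : dv (fun x => gam x y) x (g 1 0 x y) by apply: g_dx => //; lia.
have h2 := dv_comp (F_dv n (D_gam xy)) h1.
by apply: (dvE (dvM h2 (f'P x y))); ring.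
Qed.

Lemma faa_dy i j G : faa_di_bruno i j G -> (i <= m)%N -> (j < m)%N ->
  exists2 G', faa_di_bruno i j.+1 G' &
    forall x y : R, x != y -> dv (G x) y (G' x y).
Proof.
elim=> {i j G} [n i j f wf|i j G1 G2 _ IH1 _ IH2] im jm; last first.
  have [G1' w1 h1] := IH1 im jm; have [G2' w2 h2] := IH2 im jm.
  exists (fun x y => G1' x y + G2' x y); first exact: faa_add.
  by move=> x y xy; apply: dvD; [exact: h1|exact: h2].
have [f' wf' f'P] := gam_product_dy wf im jm.
exists (fun x y => F n.+1 (gam x y) * (f x y * g 0 1 x y) + F n (gam x y) * f' x y).
  apply: faa_add; last exact: faa_term.
  have w := @gam_productM n i j 0 1 f isT wf; rewrite addn1 addn0 in w.
  exact: (faa_term w).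
move=> x y xy.
have h1 : dv (gam x) y (g 0 1 x y) by apply: g_dy => //; lia.
have h2 := dv_comp (F_dv n (D_gam xy)) h1.
by apply: (dvE (dvM h2 (f'P x y))); ring.
Qed.

Lemma cont2_x (G : R -> R -> R) (y : R) : continuous (fun p : R * R => G p.1 p.2) ->
  continuous (fun x => G x y).
Proof.
move=> /continuous2P Gc x; apply/cvgrPdist_lt => e e0; have [d d0 hd] := Gc x y e e0.
exists d => // x' /=; rewrite distrC => xx'; rewrite distrC; apply: hd => //.
by rewrite subrr normr0.
Qed.

Lemma cont2_y (G : R -> R -> R) (x : R) : continuous (fun p : R * R => G p.1 p.2) ->
  continuous (G x).
Proof.
move=> /continuous2P Gc y; apply/cvgrPdist_lt => e e0; have [d d0 hd] := Gc x y e e0.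
exists d => // x' /=; rewrite distrC => xx'; rewrite distrC; apply: hd => //.
by rewrite subrr normr0.
Qed.

(** Off the diagonal the derivatives are computed formally; on it, [dv_extend] obtains them from the
    continuous extensions, in one variable at a time. *)
Lemma faa_kernel_C k i G L : (i + k <= m)%N -> faa_di_bruno i i G ->
  continuous (fun p : R * R => diag_extend L G p.1 p.2) ->
  kernel_C k (diag_extend L G).
Proof.
elim: k i G L => [|k IH] i G L ikm wG Gc; first by split.
split=> //.
have [||G1 wG1 d1] := faa_dx wG.
  by lia.
  by lia.
have [||G11 wG11 d11] := faa_dy wG1.
  by lia.
  by lia.
have [||L1 c1] := faa_extend wG1.
  by lia.
  by lia.
have [||L11 c11] := faa_extend wG11.
  by lia.
  by lia.
have near_ne (x y : R) : x != y -> \forall x' \near x, x' != y.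
  move=> xy; exists `|x - y|; first by rewrite /= normr_gt0 subr_eq0.
  by move=> z /= hz; apply: contraTneq hz => ->; rewrite ltxx.
exists (diag_extend L1 G1), (diag_extend L11 G11); split.
- have off (x y : R) : x != y -> dv (fun x => diag_extend L G x y) x (diag_extend L1 G1 x y).
    move=> xy; rewrite /diag_extend (negbTE xy); apply: dv_near (d1 x y xy).
    by have := near_ne _ _ xy; apply: filterS => x' /negbTE ->.
  move=> x y; have [<-|xy] := eqVneq x y; last exact: off.
  apply: (@dv_extend _ (fun z => diag_extend L G z x) (fun z => diag_extend L1 G1 z x)).
  + exact: cont2_x.
  + exact: cont2_x.
- have off (x y : R) : x != y -> dv (diag_extend L1 G1 x) y (diag_extend L11 G11 x y).
    move=> xy; rewrite /diag_extend (negbTE xy); apply: dv_near (d11 x y xy).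
    rewrite eq_sym in xy.
    by have := near_ne _ _ xy; apply: filterS => x'; rewrite eq_sym => /negbTE ->.
  move=> x y; have [<-|xy] := eqVneq x y; last exact: off.
  apply: (@dv_extend _ (diag_extend L1 G1 x) (diag_extend L11 G11 x)).
  + exact: cont2_y.
  + by move=> z zx; apply: (off x z); rewrite eq_sym.
  + exact: cont2_y.
- by apply: (IH i.+1) => //; lia.
Qed.

Lemma composed_kernel_C : F 0%N t @[t --> within D (0^'+)] --> 0 ->
  kernel_C m (diag_extend (fun=> 0) (fun x y => F 0%N (gam x y))).
Proof.
move=> F0; have w0 : faa_di_bruno 0 0 (fun x y => F 0%N (gam x y) * 1).
  by apply: faa_term; exact: gam_product1.
have E : (fun x y => F 0%N (gam x y) * 1) = (fun x y => F 0%N (gam x y)).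
  by apply/funext => x; apply/funext => y; rewrite mulr1.
rewrite E in w0; apply: (faa_kernel_C _ w0) => //.
have := @gam_term_cont 0 0 0 _ 0 gam_product1 (leq0n m) (leq0n m).
rewrite sub0n; under eq_fun do rewrite expr0 mul1r.
move=> /(_ F0 (fun=> erefl)).
rewrite (_ : (fun p : R * R => diag_extend (fun x => 0 * 1) _ p.1 p.2) = (fun p : R * R =>
  diag_extend (fun=> 0) (fun x y => F 0%N (gam x y)) p.1 p.2)) //.
by apply/funext => p; rewrite /diag_extend mul0r mulr1.
Qed.

End composed_kernel.

Lemma near_fst {R : realType} (x y : R) (P : R -> Prop) :
  (\forall z \near x, P z) -> \forall p \near ((x, y) : R * R), P p.1.
Proof. by move=> h; exact: (cvg_fst h). Qed.
Lemma near_snd {R : realType} (x y : R) (P : R -> Prop) :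
  (\forall z \near y, P z) -> \forall p \near ((x, y) : R * R), P p.2.
Proof. by move=> h; exact: (cvg_snd h). Qed.

Section transfer.
Context {R : realType} {V : lmodType R} {ip : V -> V -> R} (S : semi_inner ip).

Lemma hcont_nrm_bounded (X : R -> V) (x : R) : hcont (ip:=ip) X ->
  exists2 C : R, 0 <= C & \forall z \near x, nrm (ip:=ip) (X z) <= C.
Proof.
move=> /(_ x)/cvgrPdist_lt/(_ 1 ltr01) h.
exists (1 + nrm (ip:=ip) (X x)); first by rewrite addr_ge0 ?nrm_ge0.
move: h; apply: filterS => z; rewrite sub0r normrN ger0_norm ?nrm_ge0// => /ltW h.
by rewrite -{1}[X z](subrK (X x)) (le_trans (nrmD S _ _))// lerD2r.
Qed.

Lemma variogram_family m (X : R -> V) : hC (ip:=ip) m X ->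
  exists g : nat -> nat -> R -> R -> R,
  [/\ [/\ forall x y, g 0%N 0%N x y = nsq (ip:=ip) (X x - X y),
      forall a b (x y : R), (a < m)%N -> (b <= m)%N -> dv (fun x => g a b x y) x (g a.+1 b x y),
      forall a b (x y : R), (a <= m)%N -> (b < m)%N -> dv (g a b x) y (g a b.+1 x y) &
      forall a b, (a <= m)%N -> (b <= m)%N -> continuous (fun p : R * R => g a b p.1 p.2)] &
      forall a b (x : R), (a + b = 1)%N -> (a <= m)%N -> (b <= m)%N ->
      exists2 C : R, 0 <= C & \forall p \near ((x, x) : R * R),
        `|g a b p.1 p.2| <= C * Num.sqrt (g 0%N 0%N p.1 p.2)].
Proof.
move=> hX; have [d [d0 dd dc]] := hC_family S hX.
have [N [N0 Nd Nc]] := ip_family S dd dc dd dc.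
(* Derivatives of |X x|^2 + |X y|^2 - 2 <X x, X y>: a square depends on one variable and disappears
   once the other is differentiated. *)
exists (fun a b x y => (if b == 0%N then N a x else 0) + (if a == 0%N then N b y else 0)
  - 2 * ip (d a x) (d b y)).
split; first split.
- by move=> x y; rewrite /= N0 d0 (nsqB S).
- move=> a b x y am bm /=.
  have h1 : dv (fun x => if b == 0%N then N a x else 0) x (if b == 0%N then N a.+1 x else 0).
    by case: eqP => _; [exact: Nd|exact: dvC].
  apply: (dvE (dvB (dvD h1 (dvC (if a == 0%N then N b y else 0) x))
    (dvZ 2 (ip_dvl S (d b y) x (dd a am))))).
  by rewrite addr0.
- move=> a b x y am bm /=.
  have h1 : dv (fun y => if a == 0%N then N b y else 0) y (if a == 0%N then N b.+1 y else 0).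
    by case: eqP => _; [exact: Nd|exact: dvC].
  apply: (dvE (dvB (dvD (dvC (if b == 0%N then N a x else 0) y) h1)
    (dvZ 2 (ip_dvr S (d a x) y (dd b bm))))).
  by rewrite /= add0r.
- move=> a b am bm p /=.
  apply: cvgB; last first.
    apply: cvgM; first exact: cvg_cst.
    exact: (@ip_cont2 _ _ _ S _ _ (dc a am) (dc b bm) p).
  apply: cvgD.
    case: eqP => _; last exact: cvg_cst.
    by apply: (@continuous_comp _ _ _ fst (N a)); [exact: cvg_fst|exact: Nc].
  case: eqP => _; last exact: cvg_cst.
  by apply: (@continuous_comp _ _ _ snd (N b)); [exact: cvg_snd|exact: Nc].
(* This makes the x-derivative of gam equal to 2 <X' x, X x - X y>, which Cauchy-Schwarz bounds by 2
   |X' x| sqrt gam. *)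
have N1 x : (0 < m)%N -> N 1%N x = 2 * ip (d 1%N x) (X x).
  move=> m0; have := Nd 0%N x m0; rewrite N0 => h.
  rewrite (dv_unique h (ip_dv S x (dd 0%N m0) (dd 0%N m0))) d0 (ipC S (X x)); ring.
have E x y : N 0%N x + N 0%N y - 2 * ip (d 0%N x) (d 0%N y) = nsq (ip:=ip) (X x - X y).
  by rewrite N0 d0 (nsqB S).
move=> a b x ab am bm /=.
have m0 : (0 < m)%N by lia.
have [C C0 hC] := hcont_nrm_bounded x (dc 1%N m0).
exists (2 * C); first by rewrite mulr_ge0.
case: a ab am => [|[|a]] ab am; last by lia.
- have -> : b = 1%N by lia.
  have := @near_snd _ x x _ hC; apply: filterS => p /= h.
  rewrite add0r E N1// -/(nrm _) d0 (ipC S (X p.1)) -mulrBr -(ipBr S) normrM gtr0_norm//.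
  rewrite -mulrA ler_pM2l//; apply: (le_trans (ip_le S _ _)).
  by rewrite (nrmB S) ler_wpM2r ?nrm_ge0.
- have -> : b = 0%N by lia.
  have := @near_fst _ x x _ hC; apply: filterS => p /= h.
  rewrite addr0 E N1// -/(nrm _) d0 -mulrBr -(ipBr S) normrM gtr0_norm//.
  rewrite -mulrA ler_pM2l//; apply: (le_trans (ip_le S _ _)).
  by rewrite ler_wpM2r ?nrm_ge0.
Qed.

Context {W : lmodType R} {ip' : W -> W -> R} (S' : semi_inner ip').
Hypothesis ipK : ip_complete ip'.

Lemma hC_transfer m (X : R -> V) (X2 : R -> W) (D : set R) (F : nat -> R -> R) :
  (forall x y, x != y -> D (nsq (ip:=ip) (X x - X y))) ->
  (forall t, D t -> 0 < t) ->
  (forall n (t : R), D t -> dv (F n) t (F n.+1 t)) ->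
  (forall n, (n <= m.*2)%N -> exists2 l : R,
    t ^+ (n - m) * F n t @[t --> within D (0^'+)] --> l & ((m < n)%N -> l = 0)) ->
  F 0%N t @[t --> within D (0^'+)] --> 0 ->
  (forall x y, x != y ->
    nsq (ip:=ip') (X2 x - X2 y) = F 0%N (nsq (ip:=ip) (X x - X y))) ->
  hC (ip:=ip) m X -> hC (ip:=ip') m X2.
Proof.
move=> D_nsq D_gt0 F_dv F_lim F0 X2E /variogram_family[g [[g00 g_dx g_dy g_cont] g_small]].
pose F' n t := - 2^-1 * F n t.
have gam_ge0 x y : 0 <= g 0%N 0%N x y by rewrite g00 nsq_ge0.
have gam_diag x : g 0%N 0%N x x = 0 by rewrite g00 subrr /nsq (ip0l S).
have D_gam x y : x != y -> D (g 0%N 0%N x y) by move=> xy; rewrite g00; exact: D_nsq.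
have F'_dv n (t : R) : D t -> dv (F' n) t (F' n.+1 t).
  by move=> Dt; apply: dvZ; exact: F_dv.
have F'_lim n : (n <= m.*2)%N -> exists2 l : R,
    t ^+ (n - m) * F' n t @[t --> within D (0^'+)] --> l & ((m < n)%N -> l = 0).
  move=> nm; have [l hl l0] := F_lim n nm.
  exists (- 2^-1 * l); last by move=> mn; rewrite l0// mulr0.
  rewrite (_ : (fun t => _) = fun t => - 2^-1 * (t ^+ (n - m) * F n t)); last first.
    by apply/funext => t; rewrite /F'; ring.
  by apply: cvgM => //; exact: cvg_cst.
have F'0 : F' 0%N t @[t --> within D (0^'+)] --> 0.
  by rewrite -[X in _ --> X](mulr0 (- 2^-1)); apply: cvgM => //; exact: cvg_cst.
have := composed_kernel_C g_dx g_dy g_cont gam_ge0 gam_diag g_small D_gam D_gt0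
  F'_dv F'_lim F'0.
apply: (kernel_hC S' ipK).
have E x y : diag_extend (fun=> 0) (fun x y => F' 0%N (g 0%N 0%N x y)) x y =
    - 2^-1 * nsq (ip:=ip') (X2 x - X2 y).
  rewrite /diag_extend; case: eqP => [->|/eqP xy].
    by rewrite subrr /nsq (ip0l S') mulr0.
  by rewrite /F' X2E// g00.
move=> x x' y y'; rewrite !E !(nsqB S') (ipBl S') !(ipBr S').
by field.
Qed.

End transfer.

(** * Finite differences *)

Lemma subACA {V : zmodType} (a b c d : V) : a - b - (c - d) = a - c - (b - d).
Proof. by rewrite !opprB addrACA [- b + _]addrC addrACA. Qed.

Section finite_differences.
Context {R : realType}.

Definition fdiff {V : lmodType R} (h : R) (X : R -> V) : R -> V :=
  fun x => X (x + h) - X x.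

(** Differences commute with derivation, so each use of the mean value theorem turns one difference
    into one derivative. *)
Lemma iter_fdiff_real (f : nat -> R -> R) (k : nat) (x h : R) :
  (forall j (x : R), dv (f j) x (f j.+1 x)) ->
  exists c, iter k (fdiff (V:=R^o) h) (f 0%N) x = f k c * h ^+ k.
Proof.
have D j (g g' : R -> R) : (forall x : R, dv g x (g' x)) ->
    forall x : R, dv (iter j (fdiff (V:=R^o) h) g) x (iter j (fdiff (V:=R^o) h) g' x).
  move=> gd; elim: j => [|j IH] y; first exact: gd.
  have hc := @dv_comp _ _ (fun y => y + h) y _ _ (IH (y + h)) (dvD (dvI y) (dvC h y)).
  by apply: (dvE (dvB hc (IH y))); rewrite addr0 mulr1.
elim: k f x => [|k IH] f x fd; first by exists x; rewrite expr0 mulr1.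
have [c _ e] := dvMVT_signed x h (D k _ _ (fd 0%N)).
have [c' e'] := IH (fun j => f j.+1) c (fun j => fd j.+1).
by exists c'; rewrite iterS /fdiff e e' exprS; ring.
Qed.

(* The value [k!] of the k-th difference of [x^k], which certifies that the
   coefficients below are not degenerate, comes from the mean value theorem. *)
Lemma fdiff_coefficients (k : nat) : exists a : nat -> R,
  (forall (V : lmodType R) (X : R -> V) (x h : R),
    iter k (fdiff h) X x = \sum_(i < k.+1) a i *: X (x + i%:R * h)) /\
  \sum_(i < k.+1) a i * i%:R ^+ k = k`!%:R.
Proof.
have [a aE] : exists a : nat -> R, forall (V : lmodType R) (X : R -> V) (x h : R),
    iter k (fdiff h) X x = \sum_(i < k.+1) a i *: X (x + i%:R * h).
  elim: k => [|k [a aE]].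
    by exists (fun=> 1) => V X x h; rewrite big_ord1 mul0r addr0 scale1r.
  exists (fun i => (if i is j.+1 then a j else 0) - (if (i < k.+1)%N then a i else 0)).
  move=> V X x h; rewrite iterS /fdiff !aE.
  under [RHS]eq_bigr do rewrite scalerBl.
  rewrite sumrB; congr (_ - _).
    rewrite [RHS]big_ord_recl /= scale0r add0r; apply: eq_bigr => i _.
    by rewrite /bump /= natrD mulrDl mul1r addrA.
  rewrite [RHS]big_ord_recr /= ltnn scale0r addr0; apply: eq_bigr => i _.
  by rewrite ltn_ord.
exists a; split=> //.
pose f j (x : R) : R := (k ^_ j)%:R * x ^+ (k - j).
have fd j (x : R) : dv (f j) x (f j.+1 x).
  apply: (dvE (dvZ (k ^_ j)%:R (dvX (k - j) (dvI x)))).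
  by rewrite mulr1 mulrA -natrM -ffactnSr -subn1 -subnDA addn1.
have [c] := iter_fdiff_real k 0 1 fd.
rewrite aE /f ffactnn subnn expr0 expr1n !mulr1 => <-.
by apply: eq_bigr => i _; rewrite ffactn0 subn0 mul1r add0r mulr1.
Qed.

Context {V : lmodType R} {ip : V -> V -> R} (S : semi_inner ip).
Local Notation nrm := (nrm (ip:=ip)).
Local Notation hderiv := (hderiv (ip:=ip)).
Local Notation hC := (hC (ip:=ip)).

(** The scalar mean value theorem is applied to s |-> <X s, v> with v the increment itself; after
    Cauchy-Schwarz one factor |v| cancels. *)
Lemma hderiv_mean_value (X X' : R -> V) (x h M : R) : 0 <= h -> hderiv X X' ->
  (forall c, x <= c <= x + h -> nrm (X' c) <= M) -> nrm (X (x + h) - X x) <= M * h.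
Proof.
rewrite le_eqVlt => /predU1P[<-|h0] Xd hM.
  by rewrite addr0 subrr (nrm0 S) mulr0.
set v := X (x + h) - X x.
have xh : x < x + h by lra.
have [c [/andP[xc ch]]] := dvMVT xh (fun s _ => ip_dvl S v s Xd).
rewrite -(ipBl S) -/v -/(nsq _) -(sqr_nrm S) => e.
have [v0|v0] := eqVneq (nrm v) 0.
  rewrite v0 mulr_ge0 ?(ltW h0)//; apply: (le_trans (nrm_ge0 (ip:=ip) (X' c))).
  by rewrite hM// (ltW xc) (ltW ch).
have vp : 0 < nrm v by rewrite lt_def v0 nrm_ge0.
rewrite -(ler_pM2r vp) -expr2 e [x + h - x]addrAC subrr add0r mulrAC ler_pM2r//.
apply: (le_trans (ler_norm _)); apply: (le_trans (ip_le S _ _)).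
by rewrite ler_wpM2r ?nrm_ge0// hM// (ltW xc) (ltW ch).
Qed.

Lemma hderiv_null (X X' : R -> V) a b : hderiv X X' ->
  (forall x, nsq (ip:=ip) (X' x) = 0) -> nsq (ip:=ip) (X b - X a) = 0.
Proof.
move=> Xd X0; wlog ab : a b / a <= b.
  move=> H; have [/H//|/ltW/H] := leP a b.
  by rewrite -!(sqr_nrm S) (nrmB S).
have n0 : nrm (X b - X a) <= 0 * (b - a).
  rewrite -{1}(subrK a b) (addrC _ a); apply: hderiv_mean_value => //; first by lra.
  by move=> c _; rewrite /nrm X0 sqrtr0.
by rewrite -(sqr_nrm S); apply/eqP; rewrite sqrf_eq0 eq_le nrm_ge0 -(mul0r (b - a)) n0.
Qed.

Lemma hderiv_fdiff (X X' : R -> V) h : hderiv X X' -> hderiv (fdiff h X) (fdiff h X').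
Proof.
move=> Xd x; rewrite /vcvg.
apply: (@squeeze_cvgr _ _ _ _ (fun=> 0) (fun t : R =>
  nrm (t^-1 *: (X (x + h + t) - X (x + h)) - X' (x + h)) +
  nrm (t^-1 *: (X (x + t) - X x) - X' x))).
- near=> t; rewrite nrm_ge0 /=.
  rewrite (_ : _ *: _ - _ = t^-1 *: (X (x + h + t) - X (x + h)) - X' (x + h) -
    (t^-1 *: (X (x + t) - X x) - X' x)); first by apply: (le_trans (nrmD S _ _)); rewrite (nrmN S).
  rewrite [RHS]subACA -scalerBr; congr (_ *: _ - _).
  by rewrite /fdiff subACA [x + t + h]addrAC.
- exact: cvg_cst.
- by rewrite -[X in _ --> X](addr0 (0 : R)); apply: cvgD; exact: Xd.
Unshelve. all: by end_near. Qed.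

Lemma hderiv_iter_fdiff (X X' : R -> V) h k : hderiv X X' ->
  hderiv (iter k (fdiff h) X) (iter k (fdiff h) X').
Proof. by move=> Xd; elim: k => //= k IH; exact: hderiv_fdiff. Qed.

(** The difference of order k + 1 is an increment of the one of order k, whose derivative is a
    difference of X'. Uniformity in x near x0 is needed because the mean value bound involves all
    intermediate points. *)
Lemma iter_fdiff_bound k (X : R -> V) (x0 : R) : hC k X ->
  exists M, exists2 d : R, 0 < d & forall x h : R, `|x - x0| < d -> 0 < h -> h < d ->
    nrm (iter k (fdiff h) X x) <= M * h ^+ k.
Proof.
elim: k X => [|k IH] X.
  move=> /(_ x0)/cvgrPdist_lt/(_ 1 ltr01)[d /= d0 hd].
  exists (1 + nrm (X x0)), d => // x h xx0 h0 hh /=; rewrite expr0 mulr1.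
  have bx : ball_ Num.Def.normr x0 d x by rewrite /ball_ /= distrC.
  have := hd x bx; rewrite sub0r normrN ger0_norm ?nrm_ge0// => /ltW hx.
  by rewrite -{1}[X x](subrK (X x0)) (le_trans (nrmD S _ _))// lerD2r.
move=> [X' Xd /IH[M [d d0 hM]]].
exists M, (d / 2); first by rewrite divr_gt0.
move=> x h xx0 h0 hh; rewrite exprSr mulrA iterS /fdiff.
apply: (hderiv_mean_value (ltW h0) (hderiv_iter_fdiff h k Xd)).
move=> c /andP[xc ch]; apply: hM => //; last by lra.
by move: xx0; rewrite !ltr_norml => /andP[? ?]; apply/andP; split; lra.
Qed.

End finite_differences.

(** * Gaussian kernels *)

Section gaussian_kernel.
Context {R : realType}.

Definition psd {n} (K : 'I_n -> 'I_n -> R) :=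
  forall c : 'I_n -> R, 0 <= \sum_i \sum_j c i * c j * K i j.

Lemma sum_rank1 n (c u : 'I_n -> R) :
  \sum_i \sum_j c i * c j * (u i * u j) = (\sum_i c i * u i) ^+ 2.
Proof.
rewrite expr2 mulr_suml; apply: eq_bigr => i _.
by rewrite mulr_sumr; apply: eq_bigr => j _; ring.
Qed.

Lemma psdD n (K1 K2 : 'I_n -> 'I_n -> R) : psd K1 -> psd K2 ->
  psd (fun i j => K1 i j + K2 i j).
Proof.
move=> h1 h2 c; rewrite (_ : \sum_i _ = \sum_i \sum_j c i * c j * K1 i j +
  \sum_i \sum_j c i * c j * K2 i j); first by rewrite addr_ge0.
rewrite -big_split; apply: eq_bigr => i _; rewrite -big_split.
by apply: eq_bigr => j _ /=; ring.
Qed.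

Lemma psd_scale n (K : 'I_n -> 'I_n -> R) (v : 'I_n -> R) : psd K ->
  psd (fun i j => v i * v j * K i j).
Proof.
move=> h c; have := h (fun i => c i * v i); congr (_ <= _).
by apply: eq_bigr => i _; apply: eq_bigr => j _; ring.
Qed.

Context {V : lmodType R} {ip : V -> V -> R} (S : semi_inner ip).

Definition schur_product := forall n (K : 'I_n -> 'I_n -> R) (z : 'I_n -> V),
  psd K -> psd (fun i j => K i j * ip (z i) (z j)).
Hypothesis schur : schur_product.

Lemma sum_gram n (c : 'I_n -> R) (z : 'I_n -> V) :
  \sum_i \sum_j c i * c j * ip (z i) (z j) = nsq (ip:=ip) (\sum_i c i *: z i).
Proof.
rewrite /nsq (ip_suml S); apply: eq_bigr => i _; rewrite (ip_sumr S).
by apply: eq_bigr => j _; rewrite (ipZl S) (ipZr S) mulrA.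
Qed.

Lemma psd_gram_exp n (z : 'I_n -> V) k : psd (fun i j => ip (z i) (z j) ^+ k).
Proof.
elim: k => [|k IH] c; last first.
  by under eq_bigr do under eq_bigr do rewrite exprSr; exact: schur.
have := sqr_ge0 (\sum_i c i * 1); rewrite -sum_rank1; congr (_ <= _).
by apply: eq_bigr => i _; apply: eq_bigr => j _; rewrite expr0 mulr1.
Qed.

(** With G the Gram matrix and r its rank one part along e, G - r is positive by Cauchy-Schwarz. For
    powers, G^(k+1) - r^(k+1) = (G^k - r^k) G + r^k (G - r) entrywise: Schur's theorem handles the
    first term, a rank one scaling the second. *)
Lemma psd_gram_exp_sub n (z : 'I_n -> V) e k : nsq (ip:=ip) e <= 1 ->
  psd (fun i j => ip (z i) (z j) ^+ k - (ip (z i) e * ip (z j) e) ^+ k).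
Proof.
move=> e1; elim: k => [|k IH] c.
  by rewrite big1// => i _; rewrite big1// => j _; rewrite !expr0 subrr mulr0.
have h1 : psd (fun i j => ip (z i) (z j) - ip (z i) e * ip (z j) e).
  move=> b; rewrite (_ : \sum_i _ = nsq (ip:=ip) (\sum_i b i *: z i) -
      ip (\sum_i b i *: z i) e ^+ 2).
    rewrite subr_ge0; apply: (le_trans (ip_sqr_le S _ _)).
    by rewrite ler_piMr ?(nsq_ge0 S).
  rewrite -sum_gram (ip_suml S) (_ : \sum_i ip _ e = \sum_i b i * ip (z i) e); last first.
    by apply: eq_bigr => i _; rewrite (ipZl S).
  rewrite -sum_rank1 -sumrB; apply: eq_bigr => i _; rewrite -sumrB.
  by apply: eq_bigr => j _; ring.
have := psdD (schur z IH) (psd_scale (fun i => ip (z i) e ^+ k) h1) c.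
congr (_ <= _); apply: eq_bigr => i _; apply: eq_bigr => j _.
by rewrite !exprSr exprMn; ring.
Qed.

Lemma expR_cvg (x : R) : \sum_(0 <= k < N) x ^+ k / k`!%:R @[N --> \oo] --> expR x.
Proof.
have := is_cvg_series_exp_coeff x; rewrite /expR => /cvg_ex[l hl].
by rewrite /expR (cvg_lim _ hl).
Qed.

Lemma sum_cvg {T : Type} {F : set_system T} {FF : Filter F} (I : Type) (r : seq I)
    (u : I -> T -> R) (l : I -> R) :
  (forall i, u i t @[t --> F] --> l i) ->
  \sum_(i <- r) u i t @[t --> F] --> \sum_(i <- r) l i.
Proof.
move=> h; elim: r => [|i r IH].
  by rewrite big_nil; under eq_fun do rewrite big_nil; exact: cvg_cst.
by rewrite big_cons; under eq_fun do rewrite big_cons; apply: cvgD.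
Qed.

(* The lower bound keeps the k-th term of exp(2 xi <z_i, z_j>) and, in it, the
   component along e. *)
Lemma gaussian_form_ge n (a : 'I_n -> R) (z : 'I_n -> V) e k (xi : R) :
  0 <= xi -> nsq (ip:=ip) e <= 1 ->
  (2 * xi) ^+ k / k`!%:R *
    (\sum_i a i * expR (- xi * nsq (ip:=ip) (z i)) * ip (z i) e ^+ k) ^+ 2 <=
  \sum_i \sum_j a i * a j * expR (- xi * nsq (ip:=ip) (z i - z j)).
Proof.
(* Expanding |z_i - z_j|^2, the squares |z_i|^2 go into the weights b and leave exp (2 xi <z_i,
   z_j>), a power series with nonnegative coefficients. *)
move=> xi0 e1; pose b i := a i * expR (- xi * nsq (ip:=ip) (z i)).
pose Q p := \sum_i \sum_j b i * b j * ip (z i) (z j) ^+ p.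
have Q0 p : 0 <= Q p by exact: psd_gram_exp.
have cN : \sum_(0 <= p < N) (2 * xi) ^+ p / p`!%:R * Q p @[N --> \oo] -->
    \sum_i \sum_j a i * a j * expR (- xi * nsq (ip:=ip) (z i - z j)).
  rewrite (_ : (fun N => _) = fun N => \sum_i \sum_j b i * b j *
      \sum_(0 <= p < N) (2 * xi * ip (z i) (z j)) ^+ p / p`!%:R); last first.
    apply/funext => N; under eq_bigr do rewrite mulr_sumr.
    rewrite exchange_big; apply: eq_bigr => i _ /=.
    under eq_bigr do rewrite mulr_sumr.
    rewrite exchange_big; apply: eq_bigr => j _ /=.
    by rewrite mulr_sumr; apply: eq_bigr => p _; rewrite !exprMn; ring.
  rewrite (_ : \sum_i _ = \sum_i \sum_j b i * b j * expR (2 * xi * ip (z i) (z j))).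
    apply: sum_cvg => i; apply: sum_cvg => j; apply: cvgM; first exact: cvg_cst.
    exact: expR_cvg.
  apply: eq_bigr => i _; apply: eq_bigr => j _; rewrite /b (nsqB S).
  rewrite (_ : - xi * (_ - _) = - xi * nsq (ip:=ip) (z i) + - xi * nsq (ip:=ip) (z j)
     + 2 * xi * ip (z i) (z j)); last by ring.
  by rewrite !expRD; ring.
apply: (@le_trans _ _ ((2 * xi) ^+ k / k`!%:R * Q k)).
  rewrite ler_wpM2l ?divr_ge0 ?exprn_ge0 ?mulr_ge0//.
  have := psd_gram_exp_sub z k e1 b.
  rewrite (_ : \sum_i _ = Q k - (\sum_i b i * ip (z i) e ^+ k) ^+ 2).
    by rewrite subr_ge0.
  rewrite -sum_rank1 -sumrB; apply: eq_bigr => i _; rewrite -sumrB.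
  by apply: eq_bigr => j _; rewrite exprMn; ring.
apply: (cvgr_to_ge cN); near=> N.
have kN : (k < N)%N by near: N; exact: nbhs_infty_gt.
rewrite big_mkord (bigD1 (Ordinal kN))//= lerDl; apply: sumr_ge0 => i _.
by rewrite mulr_ge0// divr_ge0// exprn_ge0// mulr_ge0.
Unshelve. all: by end_near. Qed.

End gaussian_kernel.

(** * Lower bound of Gaussian forms at small scale *)

Section small_scale.
Context {R : realType} {V : lmodType R} {ip : V -> V -> R} (S : semi_inner ip).
Hypothesis schur : schur_product (ip:=ip).
Local Notation nrm := (nrm (ip:=ip)).
Local Notation nsq := (nsq (ip:=ip)).

Lemma vcvg_slope (Z : R -> V) (x0 : R) (z' : V) (i : nat) :
  vcvg (ip:=ip) (0^') (fun h : R => h^-1 *: (Z (x0 + h) - Z x0)) z' ->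
  vcvg (ip:=ip) (0^'+) (fun h : R => h^-1 *: (Z (x0 + i%:R * h) - Z x0)) (i%:R *: z').
Proof.
case: i => [|i] hZ.
  rewrite /vcvg; under eq_fun do rewrite mul0r addr0 subrr scaler0 scale0r subrr (nrm0 S).
  exact: cvg_cst.
have i0 : 0 < i.+1%:R :> R by rewrite ltr0n.
apply/cvg_at_rightP => e e0.
move/cvgrPdist_lt : hZ => /(_ (e / i.+1%:R)).
rewrite divr_gt0// => /(_ isT)[d /= d0 hd].
exists (d / i.+1%:R); first by rewrite divr_gt0.
move=> h /andP[h0 hh]; rewrite subr0 ger0_norm ?nrm_ge0//.
have ih0 : i.+1%:R * h != 0 by rewrite mulf_neq0 ?gt_eqF.
have bh : ball_ Num.Def.normr 0 d (i.+1%:R * h).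
  by rewrite /ball_ /= sub0r normrN gtr0_norm ?mulr_gt0// mulrC -ltr_pdivlMr.
have := hd _ bh ih0; rewrite sub0r normrN ger0_norm ?nrm_ge0// ltr_pdivlMr//.
apply: le_lt_trans.
have -> : h^-1 *: (Z (x0 + i.+1%:R * h) - Z x0) - i.+1%:R *: z' =
    i.+1%:R *: ((i.+1%:R * h)^-1 *: (Z (x0 + i.+1%:R * h) - Z x0) - z').
  by rewrite [RHS]scalerBr scalerA invfM mulrA mulfV ?gt_eqF// mul1r.
by rewrite (nrmZ S) gtr0_norm// mulrC.
Qed.

(** At scale h, <z_i, e> is about i h rho and xi |z_i|^2 is O(A h^2), so the square in
    [gaussian_form_ge] is close to (K h^k)^2. The constant c keeps half of K to absorb the error and
    does not depend on A; only the range d of h does. *)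
Lemma gaussian_form_small_scale (Z : R -> V) (x0 : R) (z' : V) (k : nat) (a : nat -> R) :
  vcvg (ip:=ip) (0^') (fun h : R => h^-1 *: (Z (x0 + h) - Z x0)) z' ->
  0 < nsq z' -> 0 < \sum_(i < k.+1) a i * i%:R ^+ k ->
  exists2 c : R, 0 < c & forall A : R, 0 <= A -> exists2 d : R, 0 < d &
    forall h xi : R, 0 < h < d -> 0 <= xi <= A ->
    c * xi ^+ k * h ^+ k.*2 <= \sum_(i < k.+1) \sum_(j < k.+1)
      a i * a j * expR (- xi * nsq (Z (x0 + i%:R * h) - Z (x0 + j%:R * h))).
Proof.
move=> Zd z'0 a0; pose rho := nrm z'.
have rho0 : 0 < rho by rewrite /rho nrm_gt0.
pose e := rho^-1 *: z'.
have e1 : nsq e <= 1.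
  rewrite /e (nsqZ S) -(sqr_nrm S) -/rho exprVn mulVf//.
  by rewrite expf_neq0// gt_eqF.
have z'e : ip z' e = rho.
  by rewrite /e (ipZr S) -/(nsq _) -(sqr_nrm S) -/rho expr2 mulKf// gt_eqF.
pose s := \sum_(i < k.+1) a i * i%:R ^+ k.
pose K := rho ^+ k * s.
have K0 : 0 < K by rewrite mulr_gt0// exprn_gt0.
exists (2 ^+ k / k`!%:R * (K / 2) ^+ 2).
  by rewrite mulr_gt0 ?exprn_gt0// divr_gt0 ?exprn_gt0// ltr0n fact_gt0.
move=> A A0.
pose w (i : nat) (h : R) := h^-1 *: (Z (x0 + i%:R * h) - Z x0).
have wc i := vcvg_slope i Zd; rewrite -/(w _) in wc.
pose v (i : nat) (h : R) := ip (w i h) e.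
have vc i : v i h @[h --> (0 : R)^'+] --> i%:R * rho.
  rewrite -z'e -(ipZl S); apply: (ip_cvg S (wc i)); exact: (vcvg_cst S).
(* First the cost of replacing exp (- xi |z_i|^2) by 1, through 1 - exp (- u) <= u; then that of
   replacing <w_i, e> by its limit i rho. *)
pose err (h : R) := \sum_(i < k.+1) `|a i| *
  (A * (h ^+ 2 * nsq (w i h)) * `|v i h| ^+ k + `|v i h ^+ k - (i%:R * rho) ^+ k|).
have hc : h @[h --> (0 : R)^'+] --> (0 : R) by apply: cvg_within.
have errc : err h @[h --> (0 : R)^'+] --> 0.
  have Xc (f : R -> R) (l : R) p : f h @[h --> (0 : R)^'+] --> l ->
      f h ^+ p @[h --> (0 : R)^'+] --> l ^+ p.
    by move=> fl; exact: (continuous_cvg _ (@exprn_continuous R p l) fl).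
  suff : err h @[h --> (0 : R)^'+] --> \sum_(i < k.+1) `|a i| *
      (A * (0 ^+ 2 * nsq (i%:R *: z')) * `|i%:R * rho| ^+ k +
       `|(i%:R * rho) ^+ k - (i%:R * rho) ^+ k|).
    rewrite big1// => i _.
    by rewrite subrr normr0 expr0n /= mul0r mulr0 mul0r addr0 mulr0.
  apply: sum_cvg => i; apply: cvgM; first exact: cvg_cst.
  apply: cvgD.
    apply: cvgM; last by apply: (Xc (fun h => `|v i h|)); apply: cvg_norm.
    apply: cvgM; first exact: cvg_cst.
    apply: cvgM; first exact: (Xc id).
    exact: (ip_cvg S (wc i) (wc i)).
  by apply: cvg_norm; apply: cvgB; [exact: Xc|exact: cvg_cst].
have /cvg_at_rightP/(_ (K / 2)) := errc.
rewrite divr_gt0// => /(_ isT)[d d0 hd]; exists d => // h xi hP /andP[xi0 xiA].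
have /andP[h0 _] := hP.
pose z (i : 'I_k.+1) := Z (x0 + i%:R * h) - Z x0.
have zw i : z i = h *: w i h by rewrite /z /w scalerA mulfV ?gt_eqF// scale1r.
have := gaussian_form_ge S schur (fun i : 'I_k.+1 => a i) z k xi0 e1.
under [leRHS]eq_bigr do under eq_bigr do rewrite /z opprB addrA subrK.
apply: le_trans.
have -> : 2 ^+ k / k`!%:R * (K / 2) ^+ 2 * xi ^+ k * h ^+ k.*2 =
    (2 * xi) ^+ k / k`!%:R * (K / 2 * h ^+ k) ^+ 2.
  by rewrite -muln2 exprM [(2 * xi) ^+ k]exprMn [(K / 2 * h ^+ k) ^+ 2]exprMn; ring.
rewrite ler_wpM2l//; first by rewrite divr_ge0 ?exprn_ge0// mulr_ge0.
have Es : \sum_(i < k.+1) a i * (i%:R * rho) ^+ k = K.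
  by rewrite /K /s mulr_sumr; apply: eq_bigr => i _; rewrite exprMn; ring.
have lb : K / 2 <= \sum_(i < k.+1) a i * expR (- xi * nsq (z i)) * v i h ^+ k.
  have := hd h hP; rewrite subr0 => /(le_lt_trans (ler_norm _)) herr.
  suff : `|\sum_(i < k.+1) a i * expR (- xi * nsq (z i)) * v i h ^+ k - K| <= err h.
    by rewrite ler_norml => /andP[+ _]; lra.
  rewrite -Es -sumrB; apply: (le_trans (ler_norm_sum _ _ _)); apply: ler_sum => i _.
  rewrite -mulrA -mulrBr normrM ler_wpM2l//.
  set E := expR _; set vk := v i h ^+ k; set w0 := (_ * rho) ^+ k.
  rewrite (_ : E * vk - w0 = (E - 1) * vk + (vk - w0)); last by ring.
  apply: (le_trans (ler_normD _ _)); rewrite lerD2r normrM [`|vk|]normrX.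
  rewrite ler_wpM2r ?exprn_ge0//.
  have E1 : E <= 1 by rewrite -expR0 ler_expR mulNr oppr_le0 mulr_ge0// (nsq_ge0 S).
  have E2 := expR_ge1Dx (- xi * nsq (z i)); rewrite -/E in E2.
  rewrite ler0_norm ?subr_le0// opprB.
  have : xi * nsq (z i) <= A * (h ^+ 2 * nsq (w i h)).
    by rewrite zw (nsqZ S) ler_wpM2r// mulr_ge0 ?sqr_ge0 ?(nsq_ge0 S).
  lra.
have E : \sum_(i < k.+1) a i * expR (- xi * nsq (z i)) * ip (z i) e ^+ k =
    (\sum_(i < k.+1) a i * expR (- xi * nsq (z i)) * v i h ^+ k) * h ^+ k.
  rewrite mulr_suml; apply: eq_bigr => i _.
  by rewrite [in ip _ _]zw (ipZl S) exprMn /v; ring.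
rewrite E; have hk : 0 <= h ^+ k by rewrite exprn_ge0// ltW.
have K2 : 0 <= K / 2 by rewrite divr_ge0// ltW.
have lb2 := ler_wpM2r hk lb; have ge1 := mulr_ge0 K2 hk.
by apply: lerXn2r => //; rewrite nnegrE//; exact: le_trans lb2.
Qed.

End small_scale.

(** * Approximation by mixtures of exponentials *)

Section exponential_bounds.
Context {R : realType}.
Implicit Types (u x t : R) (n k : nat).

(** From exp u >= 1 + u, since (1 + u) (1 - u + u^2) = 1 + u^3. *)
Lemma expRN_le u : 0 <= u -> expR (- u) <= 1 - u + u ^+ 2.
Proof.
move=> u0; have h := expR_ge1Dx u.
have u1 : 0 < 1 + u by lra.
rewrite expRN; apply: (@le_trans _ _ (1 + u)^-1).
  by rewrite lef_pV2 ?posrE ?expR_gt0.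
rewrite -[X in X <= _]mul1r ler_pdivrMr//.
rewrite (_ : _ * _ = 1 + u ^+ 3); last by ring.
by rewrite lerDl exprn_ge0.
Qed.

(** Comparing the powers one factor at a time gives at most n u^2 exp (- (n - 1) u). The factor n is
    absorbed by y exp (- y) <= 1, so the error is uniform in n. *)
Lemma expr_exp_dist n u : 0 <= u <= 1 -> `|(1 - u) ^+ n - expR (- u) ^+ n| <= 2 * u.
Proof.
move=> /andP[u0 u1]; set b := expR (- u).
have b0 : 0 < b by exact: expR_gt0.
have b1 : b <= 1 by rewrite /b -expR0 ler_expR; lra.
have sb : 1 - u <= b by have := expR_ge1Dx (- u); rewrite -/b; lra.
have s0 : 0 <= 1 - u by lra.
have bs : b - (1 - u) <= u ^+ 2 by have := expRN_le u0; rewrite -/b; lra.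
have pw m : b ^+ m.+1 - (1 - u) ^+ m.+1 <= m.+1%:R * b ^+ m * u ^+ 2.
  elim: m => [|m IH]; first by rewrite !expr1 expr0 !mul1r.
  rewrite (_ : _ - _ = b * (b ^+ m.+1 - (1 - u) ^+ m.+1) +
    (1 - u) ^+ m.+1 * (b - (1 - u))); last by rewrite !(exprS _ m.+1); ring.
  have h1 : b * (b ^+ m.+1 - (1 - u) ^+ m.+1) <= b * (m.+1%:R * b ^+ m * u ^+ 2).
    by rewrite ler_pM2l.
  have h2 : (1 - u) ^+ m.+1 * (b - (1 - u)) <= b ^+ m.+1 * u ^+ 2.
    apply: ler_pM => //; first exact: exprn_ge0.
      by rewrite subr_ge0.
    by apply: lerXn2r; rewrite ?nnegrE// ltW.
  apply: (le_trans (lerD h1 h2)); rewrite -[m.+2%:R]natr1 (exprS b m).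
  by rewrite le_eqVlt; apply/orP; left; apply/eqP; move: m.+1%:R (b ^+ m) => M B; ring.
have le_b m : (1 - u) ^+ m <= b ^+ m by apply: lerXn2r; rewrite ?nnegrE// ltW.
rewrite ler0_norm ?subr_le0// opprB; case: n => [|m].
  by rewrite !expr0 subrr mulr_ge0.
apply: (le_trans (pw m)).
have bm1 : b ^+ m <= 1 by rewrite exprn_ile1// ltW.
have mu : m%:R * u * b ^+ m <= 1.
  rewrite /b -expRM_natl mulrN expRN -ler_pdivlMr ?invr_gt0 ?expR_gt0// invrK mul1r.
  by have := expR_ge1Dx (m%:R * u); lra.
rewrite (_ : m.+1%:R * b ^+ m * u ^+ 2 = (m%:R * u * b ^+ m + u * b ^+ m) * u).
  rewrite ler_wpM2r//; suff : u * b ^+ m <= 1 by lra.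
  by rewrite mulr_ile1// exprn_ge0// ltW.
by rewrite -natr1; ring.
Qed.

(** Keeping the term of order k + 1 of exp (x t), rather than k, leaves a factor 1/x that makes the
    tail x > A small. *)
Lemma exprn_expRN_le k x t : 0 < x -> 0 < t ->
  x ^+ k * expR (- x * t) <= k.+1`!%:R / (t ^+ k.+1 * x).
Proof.
move=> x0 t0; have h := expR_ge1Dxn k (ltW (mulr_gt0 x0 t0)).
have h2 : (x * t) ^+ k.+1 / k.+1`!%:R <= expR (x * t) by lra.
rewrite mulNr expRN ler_pdivlMr ?mulr_gt0 ?exprn_gt0// mulrAC.
rewrite ler_pdivrMr ?expR_gt0//.
rewrite ler_pdivrMr in h2; last by rewrite ltr0n fact_gt0.
rewrite [leRHS]mulrC; apply: le_trans h2.
by rewrite exprMn !(exprS _ k) le_eqVlt; apply/orP; left; apply/eqP; ring.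
Qed.

Lemma fact_ratio_le k j : ((k + j)`!%:R / j`!%:R : R) <= (k + j)%:R ^+ k.
Proof.
rewrite ler_pdivrMr ?ltr0n ?fact_gt0// -natrX -natrM ler_nat.
elim: k => [|k IH]; first by rewrite add0n expn0 mul1n.
rewrite addSn factS expnS -mulnA leq_mul2l /=.
apply: (leq_trans IH); rewrite leq_mul2r; apply/orP; right.
by case: k {IH} => // k; rewrite leq_exp2r.
Qed.

End exponential_bounds.

Section approximate_bernstein.
Context {R : realType}.
Variables (q : nat -> R -> R) (p0 : R).
Hypothesis q_cm : cmseq q.
Hypothesis q_le : forall t, 0 < t -> q 0%N t <= p0.

(* The masses at n / a of a measure whose Laplace transform approximates q 0. *)
Definition bernstein_mass (a : R) (n : nat) : R := q n a * a ^+ n / n`!%:R.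
Local Notation c := bernstein_mass.

Lemma bernstein_mass_ge0 a n : 0 < a -> 0 <= c a n.
Proof.
move=> a0; apply: divr_ge0 => //; apply: mulr_ge0; first exact: cmseq_ge0.
by rewrite exprn_ge0// ltW.
Qed.

Lemma taylor_mass a N t : 0 < a ->
  taylor q a N t = \sum_(n < N) c a n * (1 - t / a) ^+ n.
Proof.
move=> a0; apply: eq_bigr => n _; rewrite /c.
have -> : a - t = a * (1 - t / a) by field; rewrite gt_eqF.
by rewrite exprMn; ring.
Qed.

(** The total mass is the Taylor polynomial at 0, a limit of its values at t > 0, where it is below
    q 0 t. *)
Lemma mass_sum_le a N : 0 < a -> \sum_(n < N) c a n <= p0.
Proof.
move=> a0; have -> : \sum_(n < N) c a n = taylor q a N 0.
  by rewrite taylor_mass//; apply: eq_bigr => n _; rewrite mul0r subr0 expr1n mulr1.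
have tc : taylor q a N t @[t --> (0 : R)^'+] --> taylor q a N 0.
  case: N => [|N]; last exact/cvg_at_right_filter/(dv_cont (dv_taylor q a N 0)).
  by rewrite /taylor; under eq_fun do rewrite big_ord0; rewrite big_ord0; exact: cvg_cst.
apply: (cvgr_to_le tc); near=> t.
have t0 : 0 < t by near: t; exact: nbhs_right_gt.
have ta : t <= a by near: t; exact: nbhs_right_le.
apply: le_trans (q_le t0); have := taylor_rem_ge0 N q_cm (t := t) (a := a).
by rewrite t0 ta => /(_ isT); rewrite /taylor_rem subr_ge0.
Unshelve. all: by end_near. Qed.

Lemma p0_ge0 : 0 <= p0.
Proof. by have := mass_sum_le 0 ltr01; rewrite big_ord0. Qed.

Section form.
Variables (I : finType) (b : I -> R) (gam : I -> I -> R) (Psi : I -> I -> R).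
Hypothesis gam_diag : forall i, gam i i = 0.
Hypothesis gam_gt0 : forall i j, i != j -> 0 < gam i j.
Hypothesis Psi_diag : forall i, Psi i i = p0.
Hypothesis Psi_off : forall i j, i != j -> Psi i j = q 0%N (gam i j).

Let gam_ge0 i j : 0 <= gam i j.
Proof. by have [->|/gam_gt0/ltW//] := eqVneq i j; rewrite gam_diag. Qed.

Let V (xi : R) := \sum_i \sum_j b i * b j * expR (- xi * gam i j).
Hypothesis V_ge0 : forall xi, 0 <= xi -> 0 <= V xi.

Let K := 2 * p0 * \sum_i \sum_j `|b i * b j| * gam i j.

(** Replacing exp (- (n/a) gam) by (1 - gam/a)^n costs 2 gam/a for each n, hence K/a in all, the
    total mass being at most p0. What remains are Taylor sums of q 0 at gam, which converge to [Psi]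
    off the diagonal. *)
Lemma mixture_form_le a N : 0 < a -> (forall i j, gam i j < a) ->
  \sum_(n < N) c a n * V (n%:R / a) <= \sum_i \sum_j b i * b j * Psi i j + K / a.
Proof.
move=> a0 gam_lt.
(* On the diagonal the Taylor sums are only known to be at most p0, which suffices as the
   coefficient b i * b i is nonnegative. *)
pose T N i j := if i == j then p0 else taylor q a N (gam i j).
pose f N := \sum_i \sum_j b i * b j * T N i j + K / a.
have fc : f N @[N --> \oo] --> \sum_i \sum_j b i * b j * Psi i j + K / a.
  apply: cvgD; last exact: cvg_cst.
  apply: sum_cvg => i; apply: sum_cvg => j; apply: cvgM; first exact: cvg_cst.
  rewrite /T; case: eqVneq => [<-|ij]; first by rewrite Psi_diag; exact: cvg_cst.
  by rewrite Psi_off//; apply: taylor_cvg => //; exact: gam_gt0.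
apply: (cvgr_to_ge fc); near=> N'.
have NN' : (N <= N')%N by near: N'; exact: nbhs_infty_ge.
apply: (@le_trans _ _ (\sum_(n < N') c a n * V (n%:R / a))).
  rewrite -(subnKC NN') big_split_ord /= lerDl; apply: sumr_ge0 => n _.
  by rewrite mulr_ge0 ?bernstein_mass_ge0// V_ge0// divr_ge0// ltW.
have -> : \sum_(n < N') c a n * V (n%:R / a) =
    \sum_i \sum_j b i * b j * \sum_(n < N') c a n * expR (- (gam i j / a)) ^+ n.
  under eq_bigr do rewrite mulr_sumr.
  rewrite exchange_big; apply: eq_bigr => i _ /=.
  under eq_bigr do rewrite mulr_sumr.
  rewrite exchange_big; apply: eq_bigr => j _ /=.
  rewrite mulr_sumr; apply: eq_bigr => n _.
  rewrite -expRM_natl (_ : - (n%:R / a) * gam i j = n%:R * - (gam i j / a)); last by ring.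
  by ring.
rewrite /f /K -lerBlDl !mulr_sumr mulr_suml -sumrB; apply: ler_sum => i _.
rewrite !mulr_sumr mulr_suml -sumrB; apply: ler_sum => j _.
rewrite -mulrBr.
have h1 : b i * b j * T N' i j >= b i * b j * \sum_(n < N') c a n * (1 - gam i j / a) ^+ n.
  rewrite /T; case: eqVneq => [<-|ij]; last by rewrite taylor_mass.
  rewrite ler_wpM2l//; first by rewrite -expr2 sqr_ge0.
  rewrite gam_diag mul0r subr0; under eq_bigr do rewrite expr1n mulr1.
  exact: mass_sum_le.
have h2 : `|\sum_(n < N') c a n * expR (- (gam i j / a)) ^+ n -
     \sum_(n < N') c a n * (1 - gam i j / a) ^+ n| <= p0 * (2 * (gam i j / a)).
  rewrite -sumrB; apply: (le_trans (ler_norm_sum _ _ _)).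
  apply: (@le_trans _ _ (\sum_(n < N') c a n * (2 * (gam i j / a)))).
    apply: ler_sum => n _; rewrite -mulrBr normrM ger0_norm ?bernstein_mass_ge0//.
    rewrite ler_wpM2l ?bernstein_mass_ge0// distrC; apply: expr_exp_dist.
    by rewrite divr_ge0 ?(ltW a0)//= ler_pdivrMr// mul1r ltW.
  by rewrite -mulr_suml ler_wpM2r ?mass_sum_le// mulr_ge0// divr_ge0// ltW.
have h3 := ler_wpM2l (normr_ge0 (b i * b j)) h2.
rewrite -normrM mulrBr in h3.
have h4 := le_trans (ler_norm _) h3.
rewrite mulrBr (_ : 2 * p0 * _ / a = `|b i * b j| * (p0 * (2 * (gam i j / a)))); last by ring.
lra.
Unshelve. all: by end_near. Qed.

End form.

Variables (k : nat) (C : R).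

(* Splitting the mass at n > A a, where the Laplace kernel is small, from the
   rest, whose k-th moment is bounded. *)
Lemma bounded_moment_bounded : (forall A : R, 0 < A -> exists a0 : R,
    forall a N, a0 <= a -> 0 < a ->
    \sum_(n < N | n%:R <= A * a) c a n * (n%:R / a) ^+ k <= C) ->
  forall t, 0 < t -> q k t <= C + 1.
Proof.
move=> hM t t0.
(* A mass located beyond A enters q k t with a factor at most B / A. As A exceeds p0 B, the tail
   contributes at most 1, the 1 of the conclusion. *)
pose B := expR k%:R * (k.+1`!%:R / t ^+ k.+1).
have B0 : 0 < B by rewrite mulr_gt0 ?expR_gt0// divr_gt0 ?exprn_gt0// ltr0n fact_gt0.
have pB0 : 0 <= p0 * B by rewrite mulr_ge0 ?p0_ge0// ltW.
pose A := p0 * B + 1.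
have A0 : 0 < A by rewrite /A; lra.
have [a0 ha0] := hM A A0.
pose a := Num.max a0 (t + 1).
have ta : t < a by rewrite /a lt_max ltrDl ltr01 orbT.
have a_gt0 : 0 < a by exact: lt_trans ta.
have a0a : a0 <= a by rewrite le_max lexx.
have tc := taylor_cvg (cmseq_shiftn k q_cm) t0 ta; rewrite addn0 in tc.
apply: (cvgr_to_le tc).
near=> N.
have c0 n := bernstein_mass_ge0 n a_gt0.
have term j : q (k + j)%N a * (a - t) ^+ j / j`!%:R <=
    (if (k + j)%:R <= A * a then c a (k + j) * ((k + j)%:R / a) ^+ k else 0) +
    c a (k + j) * (B / A).
  pose xi : R := (k + j)%:R / a.
  have xi0 : 0 <= xi by rewrite divr_ge0// ltW.
  have s0 : 0 <= 1 - t / a by rewrite subr_ge0 ler_pdivrMr// mul1r ltW.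
  have s1 : 1 - t / a <= 1 by rewrite gerBl divr_ge0// ltW.
  have -> : q (k + j)%N a * (a - t) ^+ j / j`!%:R =
      c a (k + j) * ((k + j)`!%:R / j`!%:R / a ^+ k * (1 - t / a) ^+ j).
    have -> : a - t = a * (1 - t / a) by field; rewrite gt_eqF.
    rewrite /c exprD exprMn; field.
    by rewrite !pnatr_eq0 -!lt0n !fact_gt0 expf_neq0// gt_eqF.
  apply: (@le_trans _ _ (c a (k + j) * (xi ^+ k * (1 - t / a) ^+ j))).
    rewrite ler_wpM2l// ler_wpM2r ?exprn_ge0//.
    by rewrite /xi expr_div_n ler_pM2r ?invr_gt0 ?exprn_gt0// fact_ratio_le.
  case: ifPn => [_|].
    rewrite -[X in X <= _]addr0; apply: lerD.
      by rewrite ler_wpM2l// ler_piMr ?exprn_ge0// exprn_ile1.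
    by rewrite mulr_ge0// divr_ge0// ltW.
  rewrite -ltNge add0r => Axi; rewrite ler_wpM2l//.
  have xiA : A < xi by rewrite /xi ltr_pdivlMr.
  have xi_gt0 := lt_trans A0 xiA.
  (* Here j = a xi - k, and the k missing factors cost exp (k t/a) <= exp k, the constant in B. *)
  have h1 : (1 - t / a) ^+ j <= expR (- xi * t) * expR k%:R.
    apply: (@le_trans _ _ (expR (- (t / a)) ^+ j)).
      apply: lerXn2r; rewrite ?nnegrE ?expR_ge0//.
      by have := expR_ge1Dx (- (t / a)).
    rewrite -expRM_natl -expRD ler_expR.
    have -> : j%:R * - (t / a) = - xi * t + k%:R * (t / a).
      by rewrite /xi natrD; ring.
    by rewrite lerD2l ler_piMr// ler_pdivrMr// mul1r ltW.
  apply: (le_trans (ler_wpM2l (exprn_ge0 k xi0) h1)); rewrite mulrA.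
  apply: (@le_trans _ _ (k.+1`!%:R / (t ^+ k.+1 * xi) * expR k%:R)).
    by rewrite ler_wpM2r ?exprn_expRN_le ?expR_ge0.
  rewrite /B invfM mulrA [leRHS](_ : _ = k.+1`!%:R / t ^+ k.+1 * expR k%:R * A^-1); last by ring.
  rewrite mulrAC ler_wpM2l ?lef_pV2 ?posrE ?(ltW xiA)//.
  by rewrite mulr_ge0 ?expR_ge0// divr_ge0// exprn_ge0// ltW.
apply: (@le_trans _ _ (\sum_(j < N) ((if (k + j)%:R <= A * a
    then c a (k + j) * ((k + j)%:R / a) ^+ k else 0) + c a (k + j) * (B / A)))).
  by apply: ler_sum => j _; exact: term.
rewrite big_split /=; apply: lerD.
  apply: le_trans (ha0 a (k + N)%N a0a a_gt0).
  rewrite [leRHS]big_mkcond big_split_ord /= lerDr.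
  by apply: sumr_ge0 => i _; case: ifP => // _; rewrite mulr_ge0// exprn_ge0// divr_ge0// ltW.
rewrite -mulr_suml; apply: (@le_trans _ _ (p0 * (B / A))).
  rewrite ler_wpM2r ?divr_ge0 ?(ltW A0) ?(ltW B0)//.
  apply: le_trans (mass_sum_le (k + N) a_gt0).
  by rewrite big_split_ord /= lerDr; apply: sumr_ge0.
by rewrite mulrA ler_pdivrMr// mul1r /A lerDl.
Unshelve. all: by end_near. Qed.

End approximate_bernstein.

(** * The theorem for curves *)

Section completely_monotonic_function.
Context {R : realType} (psi : R -> R).
Hypothesis psi_cm : completely_monotonic psi.
Hypothesis psi_nonconst : nonconstant_on_nonneg psi.

Definition cm_deriv (k : nat) (t : R) : R := (-1) ^+ k * derive1n k psi t.
Local Notation q := cm_deriv.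

Lemma cm_deriv0 t : q 0 t = psi t.
Proof. by rewrite /q expr0 mul1r. Qed.

Lemma cmseq_cm_deriv : cmseq q.
Proof.
have [_ hd h0] := psi_cm; move=> k t t0; split; last exact: h0.
have h : dv (derive1n k psi) t (derive1n k.+1 psi t).
  by rewrite derive1nS derive1E; have := hd k t t0; split.
by apply: (dvE (dvZ ((-1) ^+ k) h)); rewrite /q exprS; ring.
Qed.

Lemma cm_deriv0_cvg : q 0 t @[t --> 0^'+] --> psi 0.
Proof.
have [/continuous_within_itvcyP[_ h] _ _] := psi_cm.
by rewrite (_ : q 0 = psi)//; apply/funext => t; exact: cm_deriv0.
Qed.

Lemma cm_deriv0_le t : 0 < t -> q 0 t <= psi 0.
Proof. exact: cmseq_le_lim cmseq_cm_deriv cm_deriv0_cvg. Qed.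

(** A zero of psi' would make psi constant on ]0, +oo[, hence on [0, +oo[ by continuity at 0. *)
Lemma cm_deriv1_gt0 t : 0 < t -> 0 < q 1 t.
Proof.
move=> t0; rewrite lt_def (cmseq_ge0 _ cmseq_cm_deriv t0) andbT; apply/eqP => q0.
have cst := cmseq_eq_cst cmseq_cm_deriv t0 q0.
have E s : 0 <= s -> psi s = psi 0.
  rewrite le_eqVlt => /predU1P[<-//|s0]; rewrite -cm_deriv0.
  have : q 0 u @[u --> (0 : R)^'+] --> q 0 s.
    apply/cvg_at_rightP => e e0; exists 1 => // u /andP[u0 _].
    by rewrite (cst u s)// subrr normr0.
  by move=> h; exact: (cvg_unique (@Rhausdorff R) h cm_deriv0_cvg).
have [s [u [s0 u0]]] := psi_nonconst.
by rewrite (E s)// (E u)// eqxx.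
Qed.

(** A convexity inequality. As psi is only continuous at 0, the mean value theorem is applied on
    [s, t], with s so small that s * q 1 t <= e. *)
Lemma cm_deriv0_gap t : 0 < t -> t * q 1 t <= psi 0 - q 0 t.
Proof.
move=> t0; apply/ler_addgt0Pr => e e0.
pose e' := e / (q 1 t + 1).
have q1 := cm_deriv1_gt0 t0; have q1' : 0 < q 1 t + 1 by lra.
have e'0 : 0 < e' by rewrite divr_gt0.
pose s := Num.min (t / 2) e'.
have s0 : 0 < s by rewrite lt_min e'0 divr_gt0.
have st : s < t by rewrite gt_min ltr_pdivrMr// ltr_pMr// ltr1n.
have [|c [/andP[sc ct]]] := @dvMVT _ (q 0) (fun x => - q 1 x) _ _ st.
  by move=> x /andP[sx _]; have [] := cmseq_cm_deriv 0 (lt_le_trans s0 sx).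
move=> E; have h1 := cm_deriv0_le s0.
have h2 := cmseq_nincr 1 cmseq_cm_deriv (lt_trans s0 sc) (ltW ct).
have h3 : (t - s) * q 1 t <= (t - s) * q 1 c by rewrite ler_wpM2l// subr_ge0 ltW.
have h4 : s * q 1 t <= e.
  apply: (@le_trans _ _ (e' * q 1 t)); first by rewrite ler_wpM2r ?(ltW q1)// ge_min lexx orbT.
  rewrite /e' mulrAC ler_pdivrMr// ler_wpM2l ?(ltW e0)//; lra.
rewrite mulrBl in h3; lra.
Qed.

Definition finite_at_0 (m : nat) :=
  forall k, (k <= m)%N -> exists l : R, q k t @[t --> 0^'+] --> l.

Lemma finite_at_0P m : finite_at_0 m <-> derivatives_finite_at_0 psi m.
Proof.
have E k : derive1n k psi = fun t => (-1) ^+ k * q k t.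
  by apply/funext => t; rewrite /q mulrA -exprMn mulrNN mulr1 expr1n mul1r.
split=> h k /h[l hl]; exists ((-1) ^+ k * l); last first.
  by apply: cvgM => //; exact: cvg_cst.
by rewrite E; apply: cvgM => //; exact: cvg_cst.
Qed.

(* 2 (psi 0 - psi) maps the variogram of Z to that of Y. *)
Definition gap (n : nat) (t : R) : R :=
  if n is 0%N then 2 * (psi 0 - q 0 t) else - 2 * (-1) ^+ n * q n t.

Lemma dv_gap n (t : R) : 0 < t -> dv (gap n) t (gap n.+1 t).
Proof.
move=> t0; have [h _] := cmseq_cm_deriv n t0.
case: n h => [|n] h.
  by apply: (dvE (dvZ 2 (dvB (dvC (psi 0) t) h))); rewrite /=; ring.
by apply: (dvE (dvZ (- 2 * (-1) ^+ n.+1) h)); rewrite /= [_ ^+ n.+2]exprS; ring.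
Qed.

Lemma gap1_gt0 t : 0 < t -> 0 < gap 1 t.
Proof. by move=> t0; rewrite /gap expr1 mulrN1 opprK mulr_gt0// cm_deriv1_gt0. Qed.

Lemma gap0_cvg : gap 0 t @[t --> 0^'+] --> 0.
Proof.
have : 2 * (psi 0 - q 0 t) @[t --> 0^'+] --> 2 * (psi 0 - psi 0).
  apply: cvgM; first exact: cvg_cst.
  by apply: cvgB; [exact: cvg_cst|exact: cm_deriv0_cvg].
by rewrite subrr mulr0.
Qed.

Lemma gap_lim m n : finite_at_0 m -> exists2 l : R,
  t ^+ (n - m) * gap n t @[t --> 0^'+] --> l & ((m < n)%N -> l = 0).
Proof.
move=> fin; case: n => [|n].
  by exists 0 => //; under eq_fun do rewrite expr0 mul1r; exact: gap0_cvg.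
have [mn|nm] := ltnP m n.+1; last first.
  have [l hl] := fin n.+1 nm; exists (- 2 * (-1) ^+ n.+1 * l) => //.
  rewrite (_ : (n.+1 - m = 0)%N); last by lia.
  by under eq_fun do rewrite expr0 mul1r; apply: cvgM => //; exact: cvg_cst.
have [l hl] := fin m (leqnn m).
exists (- 2 * (-1) ^+ n.+1 * 0); last by rewrite mulr0.
have -> : (n.+1 - m = (n - m).+1)%N by lia.
have := cmseq_vanish (n - m) cmseq_cm_deriv hl.
rewrite (_ : (m + (n - m).+1 = n.+1)%N); last by lia.
move=> h; rewrite (_ : (fun t => _) = fun t => - 2 * (-1) ^+ n.+1 *
  (t ^+ (n - m).+1 * q n.+1 t)); first by apply: cvgM => //; exact: cvg_cst.
by apply/funext => t; rewrite /gap; ring.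
Qed.

Section schoenberg.
Context {V W : lmodType R} {ip : V -> V -> R} {ip' : W -> W -> R}.
Hypotheses (S : semi_inner ip) (S' : semi_inner ip').
Hypotheses (ipK : ip_complete ip) (ipK' : ip_complete ip').
Hypothesis schur : schur_product (ip:=ip).
Variables (Z : R -> V) (Y : R -> W).
Local Notation gam x y := (nsq (ip:=ip) (Z x - Z y)).
Hypothesis sep : forall x y, x != y -> 0 < gam x y.
Hypothesis YE : forall x y, ip' (Y x) (Y y) = psi (gam x y).

Lemma gam_xx x : gam x x = 0.
Proof. by rewrite subrr /nsq (ip0l S). Qed.

Lemma nsqY x y : x != y -> nsq (ip:=ip') (Y x - Y y) = gap 0 (gam x y).
Proof. by move=> xy; rewrite (nsqB S') /nsq !YE !gam_xx /gap cm_deriv0; ring. Qed.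

Lemma hC_Y_of_Z m : finite_at_0 m -> hC (ip:=ip) m Z -> hC (ip:=ip') m Y.
Proof.
move=> fin; apply: (hC_transfer S S' ipK' (D := [set t | 0 < t]) (F := gap)) => //.
- by move=> n t; exact: dv_gap.
- move=> n _; have [l hl l0] := gap_lim n fin; exists l => //.
  move/cvg_at_rightP : hl => hl; apply/cvg_within_at_rightP => e e0.
  by have [d d0 hd] := hl e e0; exists d => // t _; exact: hd.
- move/cvg_at_rightP : gap0_cvg => hl; apply/cvg_within_at_rightP => e e0.
  by have [d d0 hd] := hl e e0; exists d => // t _; exact: hd.
- by move=> x y; exact: nsqY.
Qed.

Lemma hC_Z_of_Y m : finite_at_0 m -> hC (ip:=ip') m Y -> hC (ip:=ip) m Z.
Proof.
move=> fin.
apply: (hC_transfer S' S ipK (D := F_range gap) (F := inv_deriv gap)).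
- by move=> x y xy; rewrite nsqY//; exists (gam x y) => //; exact: sep.
- by move=> _ [t t0 <-]; exact: (F_gt0 dv_gap gap1_gt0 gap0_cvg).
- by move=> n _ [t t0 <-]; exact: (dv_inv_deriv dv_gap gap1_gt0).
(* As n <= 2m, derivatives of the inverse occur only when m > 0; then psi' has a finite limit at 0,
   nonzero because -psi' is at least its value at 1 there. *)
- move=> [|n] nm.
    exists 0 => //; under eq_fun do rewrite expr0 mul1r.
    exact: (inv_deriv0_lim dv_gap gap1_gt0 gap0_cvg).
  have m0 : (0 < m)%N by lia.
  have [l hl] := fin 1%N m0.
  have l0 : 0 < l.
    exact: lt_le_trans (cm_deriv1_gt0 ltr01) (cmseq_le_lim cmseq_cm_deriv hl ltr01).
  have g1 : gap 1 t @[t --> 0^'+] --> 2 * l.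
    rewrite (_ : gap 1 = fun t => 2 * q 1 t); first by apply: cvgM => //; exact: cvg_cst.
    by apply/funext => t; rewrite /gap; ring.
  have l20 : 2 * l != 0 by rewrite gt_eqF// mulr_gt0.
  exact: (inv_deriv_lim dv_gap gap1_gt0 gap0_cvg m0 (fun j => gap_lim j.+1 fin) g1 l20).
- exact: (inv_deriv0_lim dv_gap gap1_gt0 gap0_cvg).
- by move=> x y xy; rewrite nsqY// (inv_deriv0 dv_gap gap1_gt0)//; exact: sep.
Qed.


Lemma exists_nonnull_derivative (Z' : R -> V) : hderiv (ip:=ip) Z Z' ->
  exists x0, 0 < nsq (ip:=ip) (Z' x0).
Proof.
move=> Zd; apply: contrapT => /forallNP h.
have := sep (oner_neq0 R); rewrite (hderiv_null S 0 1 Zd) ?ltxx// => x.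
by apply/eqP; rewrite eq_le (nsq_ge0 S) andbT leNgt; apply/negP; exact: h.
Qed.

Lemma slopes_bounded (X : R -> W) X' (x : R) : hderiv (ip:=ip') X X' ->
  exists2 M : R, 0 < M & exists2 d : R, 0 < d & forall h, h != 0 -> `|h| < d ->
    nsq (ip:=ip') (X (x + h) - X x) <= M * h ^+ 2.
Proof.
move=> /(_ x)/cvgrPdist_lt/(_ 1 ltr01)[d /= d0 hd].
pose B := 1 + nrm (ip:=ip') (X' x).
have B0 : 0 < B by rewrite ltr_pwDl// nrm_ge0.
exists (B ^+ 2); first by rewrite exprn_gt0.
exists d => // h h0 hh.
have bh : ball_ Num.Def.normr 0 d h by rewrite /ball_ /= sub0r normrN.
have := hd h bh h0; rewrite sub0r normrN ger0_norm ?nrm_ge0// => h1.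
have h2 : nrm (ip:=ip') (h^-1 *: (X (x + h) - X x)) <= B.
  rewrite -[_ *: _](subrK (X' x)); apply: (le_trans (nrmD S' _ _)).
  by rewrite lerD2r ltW.
rewrite (nrmZ S') normfV ler_pdivrMl ?normr_gt0// in h2.
rewrite -(sqr_nrm S') -[h ^+ 2]real_normK ?num_real// -exprMn [B * _]mulrC.
by apply: lerXn2r; rewrite ?nnegrE ?nrm_ge0// mulr_ge0// ltW.
Qed.

(** With g = gam (x + h) x, [cm_deriv0_gap] bounds 2 g q 1 g by the variogram of Y, which is O(h^2).
    An unbounded q 1 tends to +oo at 0, so g = o(h^2), Z' = 0, and Z would be constant. *)
Lemma cm_deriv1_bounded : hC (ip:=ip') 1 Y -> exists C, forall t, 0 < t -> q 1 t <= C.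
Proof.
move=> [Y' Yd _]; apply: contrapT => /forallNP unb.
have unb' C : exists2 t, 0 < t & C < q 1 t.
  have := unb C; move=> /existsNP[t /not_implyP[t0 /negP]]; rewrite -ltNge => h.
  by exists t.
have Zd : hderiv (ip:=ip) Z (fun=> 0).
  move=> x; apply/cvgrPdist_lt => e e0.
  have [M M0 [d d0 hM]] := slopes_bounded x Yd.
  (* q 1 exceeds M / e^2 on ]0, t0], which turns g q 1 g <= M h^2 into g < e^2 h^2; the bound d' on
     h, defined below, forces g < t0. *)
  have [t0 t00 ht0] := unb' (M / e ^+ 2).
  have g0 : 0 < t0 * q 1 t0 by rewrite mulr_gt0// cm_deriv1_gt0.
  pose d' := Num.min 1 (t0 * q 1 t0 / M).
  have d'0 : 0 < d' by rewrite lt_min ltr01 divr_gt0.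
  exists (Num.min d d'); first by rewrite /= lt_min d0.
  move=> h; rewrite /ball_ /= sub0r normrN !lt_min => /and3P[hd h1 hd'] h0.
  rewrite subr0 sub0r normrN ger0_norm ?nrm_ge0//.
  have xh : x + h != x by rewrite -subr_eq0 addrAC subrr add0r.
  have := hM h h0 hd; rewrite nsqY// /gap => hY.
  have gp := sep xh; set g := gam (x + h) x in hY gp.
  have hh2 : h ^+ 2 <= `|h| by rewrite -real_normK ?num_real// expr2 ler_piMl// ltW.
  have Mh : M * h ^+ 2 < t0 * q 1 t0.
    by apply: (le_lt_trans (ler_wpM2l (ltW M0) hh2)); rewrite mulrC -ltr_pdivlMr.
  have gt0 : g < t0.
    rewrite ltNge; apply/negP => t0g.
    have := cmseq_nincr 0 cmseq_cm_deriv t00 t0g; have := cm_deriv0_gap t00; lra.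
  have qg := cmseq_nincr 1 cmseq_cm_deriv gp (ltW gt0).
  have := cm_deriv0_gap gp.
  have : g * (M / e ^+ 2) < g * q 1 g by rewrite ltr_pM2l// (lt_le_trans ht0).
  rewrite mulrA; move=> a1 a2.
  have a3 : g * M / e ^+ 2 < M * h ^+ 2 by have := mulr_ge0 (ltW M0) (sqr_ge0 h); lra.
  rewrite (nrmZ S) normfV ltr_pdivrMl ?normr_gt0// -ltr_sqr ?nnegrE ?nrm_ge0//; last first.
    by rewrite mulr_ge0// ltW.
  rewrite (sqr_nrm S) exprMn real_normK ?num_real// -/g.
  move: a3; rewrite ltr_pdivrMr ?exprn_gt0// (mulrC g) -mulrA.
  by rewrite ltr_pM2l.
have [x0] := exists_nonnull_derivative Zd; rewrite /nsq (ip0l S) ltxx//.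
Qed.

Lemma cm_derivk_bounded k : (0 < k)%N -> hC (ip:=ip) 1 Z -> hC (ip:=ip') k Y ->
  exists C, forall t, 0 < t -> q k t <= C.
Proof.
move=> k0 [Z' Zd _] Yk.
have [x0 z'0] := exists_nonnull_derivative Zd.
have [a [aE ak]] := @fdiff_coefficients R k.
have ak0 : 0 < \sum_(i < k.+1) a i * i%:R ^+ k by rewrite ak ltr0n fact_gt0.
have [c c0 lower] := gaussian_form_small_scale S schur (Zd x0) z'0 ak0.
have [M [d d0 upper]] := iter_fdiff_bound S' x0 Yk.
(* M^2 / c compares the upper bound M^2 h^2k with the lower bound c xi^k h^2k; the first 1 absorbs
   the error K / a', the second the tail beyond A. *)
exists (M ^+ 2 / c + 1 + 1).
apply: (bounded_moment_bounded cmseq_cm_deriv cm_deriv0_le) => A A0.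
have [d' d'0 lower'] := lower A (ltW A0).
(* h depends on A through d', but the powers h^2k cancel in the final bound. *)
pose h := Num.min d d' / 2.
have h0 : 0 < h by rewrite divr_gt0// lt_min d0.
have hmin : h < Num.min d d' by rewrite /h ltr_pdivrMr// ltr_pMr ?ltr1n// lt_min d0.
have [hd hd'] : h < d /\ h < d' by move: hmin; rewrite lt_min => /andP[].
pose x (i : 'I_k.+1) := x0 + i%:R * h.
have x_inj i j : i != j -> x i != x j.
  apply: contraNneq => /addrI e; apply/eqP/val_inj/eqP; rewrite -(eqr_nat R).
  by apply/eqP; exact: (mulIf (lt0r_neq0 h0) e).
pose g i j := gam (x i) (x j).
have g0 i : g i i = 0 by exact: gam_xx.
have gp i j : i != j -> 0 < g i j by move=> ij; exact/sep/x_inj.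
have g_ge0 i j : 0 <= g i j by exact: nsq_ge0.
pose b (i : 'I_k.+1) := a i.
have V0 xi : 0 <= xi -> 0 <= \sum_i \sum_j b i * b j * expR (- xi * g i j).
  move=> xi0; have e1 : nsq (ip:=ip) 0 <= 1 by rewrite /nsq (ip0l S).
  (* At order 0 and e = 0 the lower bound is just a nonnegative multiple of a square. *)
  apply: le_trans (gaussian_form_ge S schur b (fun i => Z (x i)) 0 xi0 e1).
  by rewrite mulr_ge0 ?sqr_ge0// divr_ge0// exprn_ge0// mulr_ge0.
pose Psi i j := psi (g i j).
have form_le : \sum_i \sum_j b i * b j * Psi i j <= M ^+ 2 * h ^+ k.*2.
  rewrite (_ : \sum_i _ = nsq (ip:=ip') (iter k (fdiff h) Y x0)).
    have x00 : `|x0 - x0| < d by rewrite subrr normr0.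
    rewrite -(sqr_nrm S') -muln2 exprM -exprMn.
    have hu := upper x0 h x00 h0 hd.
    by apply: lerXn2r; rewrite ?nnegrE ?nrm_ge0// (le_trans _ hu)// nrm_ge0.
  rewrite aE -(sum_gram S'); apply: eq_bigr => i _; apply: eq_bigr => j _.
  by rewrite YE.
pose K := 2 * psi 0 * \sum_i \sum_j `|b i * b j| * g i j.
pose s := \sum_i \sum_j g i j.
have ch : 0 < c * h ^+ k.*2 by rewrite mulr_gt0// exprn_gt0.
have psi0 : 0 <= psi 0 by exact: p0_ge0 cmseq_cm_deriv cm_deriv0_le.
have K0 : 0 <= K.
  rewrite mulr_ge0 ?mulr_ge0//; apply: sumr_ge0 => i _; apply: sumr_ge0 => j _.
  by rewrite mulr_ge0.
(* The sum s puts a' above all values of the variogram; the last term makes K / a' at most c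
   h^2k. *)
exists (s + 1 + K / (c * h ^+ k.*2)) => a' N aa a'0.
have s0 : 0 <= s by apply: sumr_ge0 => i _; apply: sumr_ge0.
have Kc0 : 0 <= K / (c * h ^+ k.*2) by rewrite divr_ge0// ltW.
have g_lt i j : g i j < a'.
  apply: (@le_lt_trans _ _ s); last by lra.
  rewrite /s (bigD1 i)//= (bigD1 j)//= -addrA lerDl addr_ge0//.
    by apply: sumr_ge0.
  by apply: sumr_ge0 => i' _; apply: sumr_ge0.
have := @mixture_form_le _ q (psi 0) cmseq_cm_deriv cm_deriv0_le _ b g Psi g0 gp _ _ V0 a' N a'0 g_lt.
have Psi1 i : Psi i i = psi 0 by rewrite /Psi g0.
have Psi2 i j : i != j -> Psi i j = q 0 (g i j) by rewrite /Psi cm_deriv0.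
move=> /(_ Psi1 Psi2) mix.
rewrite -(ler_pM2r ch).
have Ka : K / a' <= c * h ^+ k.*2.
  rewrite ler_pdivrMr// mulrC -ler_pdivrMr//; lra.
apply: (@le_trans _ _ (M ^+ 2 * h ^+ k.*2 + K / a')); last first.
  rewrite (_ : (_ / c + 1) * _ = M ^+ 2 * h ^+ k.*2 + c * h ^+ k.*2); first by rewrite lerD2l.
  by field; rewrite gt_eqF.
apply: (le_trans _ (le_trans mix _)); last by rewrite lerD2r.
rewrite big_mkcond mulr_suml; apply: ler_sum => n _.
have cn : 0 <= bernstein_mass q a' n by exact: bernstein_mass_ge0 cmseq_cm_deriv _ _ a'0.
have na : 0 <= n%:R / a' by rewrite divr_ge0// ltW.
case: ifPn => nA; last by rewrite mul0r mulr_ge0// V0.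
rewrite -mulrA ler_wpM2l// mulrA [_ * c]mulrC; apply: lower'; first by rewrite h0.
by rewrite na ler_pdivrMr.
Qed.

Theorem hC_Y_iff m : hC (ip:=ip') m Y <-> (hC (ip:=ip) m Z /\ derivatives_finite_at_0 psi m).
Proof.
rewrite -finite_at_0P; split=> [Ym|[Zm fin]]; last exact: hC_Y_of_Z.
suff fin : finite_at_0 m by split=> //; exact: hC_Z_of_Y.
have f0 : exists l : R, q 0 t @[t --> 0^'+] --> l by exists (psi 0); exact: cm_deriv0_cvg.
have [m0|m0] := posnP m; first by rewrite m0 => -[|].
have Y1 := hC_le S' m0 Ym.
(* Inverting at order m requires finiteness up to order m; order 1 alone already gives Z in C^1,
   which is what the bounds of higher order ask of Z. *)
have f1 : finite_at_0 1.
  move=> [|[|]]// _; have [C hC1] := cm_deriv1_bounded Y1.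
  exact: cmseq_lim cmseq_cm_deriv hC1.
have Z1 := hC_Z_of_Y f1 Y1.
move=> [//|k] km; have [C hCk] := cm_derivk_bounded (ltn0Sn k) Z1 (hC_le S' km Ym).
exact: cmseq_lim cmseq_cm_deriv hCk.
Qed.

End schoenberg.
End completely_monotonic_function.

(** * Square-integrable processes *)

Section L2.
Context {d : measure_display} {T : measurableType d} {R : realType}.
Variable P : probability T R.

Lemma le12 : (1 <= 2%:E :> \bar R)%E.
Proof. by rewrite lee_fin ler1n. Qed.

Local Notation L2 := (LfunType P le12).
Implicit Types f g : L2.

Lemma Lfun2P (f : T -> R) : f \in Lfun P 2%:E <->
  measurable_fun setT f /\ (\int[P]_w (f w ^+ 2)%:E < +oo)%E.
Proof.
split=> [f2|[mf fi]].
  move: (f2); rewrite inE => /andP[/[!inE]/= mf _]; split=> //.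
  have /integrableP[_] := Lfun2_integrable_sqr f2; apply: le_lt_trans.
  have m2 : measurable_fun setT (fun w => (f w ^+ 2)%:E).
    by apply/measurable_EFinP; exact: measurable_funX.
  apply: ge0_le_integral => //=; last by move=> w _; rewrite lee_fin ler_norm.
  - by move=> w _; rewrite lee_fin sqr_ge0.
  - by apply/measurable_EFinP; apply: measurableT_comp => //; exact: measurable_funX.
rewrite inE; apply/andP; split; first by rewrite inE.
rewrite inE /= /finite_norm unlock; apply: poweR_lty.
rewrite (_ : (\int[P]_x _)%E = \int[P]_w (f w ^+ 2)%:E)%E//.
apply: eq_integral => w _ /=.
by rewrite powR_mulrn// real_normK// num_real.
Qed.

Lemma L2_measurable f : measurable_fun setT f.
Proof. by have [] := (Lfun2P f).1 (LfunP f). Qed.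

Definition ip2 f g : R := \int[P]_w (f w * g w).

Lemma ip2_integrable f g : P.-integrable setT (EFin \o (fun w => f w * g w)).
Proof. by apply/Lfun1_integrable; exact: (Lfun2_mul_Lfun1 (LfunP f) (LfunP g)). Qed.

Lemma ip2E f g : (ip2 f g)%:E = (\int[P]_w (f w * g w)%:E)%E.
Proof. by rewrite fineK// integrable_fin_num//; exact: ip2_integrable. Qed.

Lemma L2_addE f g w : (f + g) w = f w + g w.
Proof. by []. Qed.
Lemma L2_scaleE (a : R) f w : (a *: f) w = a * f w.
Proof. by []. Qed.

Lemma semi_inner_ip2 : semi_inner ip2.
Proof.
split.
- by move=> f g; apply: eq_Rintegral => w _; rewrite mulrC.
- move=> f g h; rewrite /ip2 -RintegralD//; try exact: ip2_integrable.
  by apply: eq_Rintegral => w _; rewrite L2_addE mulrDl.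
- move=> a f g; rewrite /ip2 -RintegralZl//; try exact: ip2_integrable.
  by apply: eq_Rintegral => w _; rewrite L2_scaleE mulrA.
- by move=> f; apply: Rintegral_ge0 => w _; rewrite -expr2 sqr_ge0.
Qed.

Lemma sum_ip2 (I : Type) (r : seq I) (a : I -> R) (f g : I -> L2) :
  P.-integrable setT (EFin \o (fun w => \sum_(i <- r) a i * (f i w * g i w))) /\
  \sum_(i <- r) a i * ip2 (f i) (g i) = \int[P]_w (\sum_(i <- r) a i * (f i w * g i w)).
Proof.
elim: r => [|i r [IH1 IH2]].
  split; last by rewrite big_nil; under eq_Rintegral do rewrite big_nil; rewrite Rintegral_cst// mul0r.
  rewrite (_ : _ \o _ = cst 0%:E); first exact: integrable0.
  by apply/funext => w; rewrite /= big_nil.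
have h : P.-integrable setT (EFin \o (fun w => a i * (f i w * g i w))).
  rewrite (_ : _ \o _ = (fun w => (a i)%:E * (f i w * g i w)%R%:E)%E).
    by apply: integrableZl => //; exact: ip2_integrable.
  by apply/funext => w; rewrite /= EFinM.
have E : (fun w => \sum_(j <- i :: r) a j * (f j w * g j w)) =
    (fun w => a i * (f i w * g i w) + \sum_(j <- r) a j * (f j w * g j w)).
  by apply/funext => w; rewrite big_cons.
split.
  rewrite E (_ : _ \o _ = (fun w => (a i * (f i w * g i w))%R%:E +
    (\sum_(j <- r) a j * (f j w * g j w))%R%:E)%E).
    exact: integrableD.
  by apply/funext => w; rewrite /= EFinD.
rewrite big_cons IH2 E RintegralD//; congr (_ + _).
by rewrite RintegralZl//; exact: ip2_integrable.
Qed.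

(* The Schur product theorem is a pointwise statement here: the Gram matrix is
   an average of the rank one matrices z_i(w) z_j(w). *)
Lemma schur_ip2 : schur_product (ip:=ip2).
Proof.
move=> n K z hK c.
rewrite (_ : \sum_i _ = \sum_(p : 'I_n * 'I_n) (c p.1 * c p.2 * K p.1 p.2) * ip2 (z p.1) (z p.2)).
  have [_ ->] := sum_ip2 (index_enum _) (fun p : 'I_n * 'I_n => c p.1 * c p.2 * K p.1 p.2)
    (fun p => z p.1) (fun p => z p.2).
  apply: Rintegral_ge0 => w _.
  have := hK (fun i => c i * z i w); rewrite pair_bigA /=; congr (_ <= _).
  by apply: eq_bigr => p _; ring.
by rewrite pair_bigA /=; apply: eq_bigr => p _; ring.
Qed.

Lemma nsq2_eq0 f : nsq (ip:=ip2) f = 0 -> \forall w \ae P, f w = 0.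
Proof.
move=> f0; have mf := L2_measurable f.
have /ae_eq_integral_abs : (\int[P]_w `|(f w * f w)%:E| = 0)%E.
  rewrite -[RHS]/(0%:E) -f0 /nsq ip2E; apply: eq_integral => w _.
  by rewrite gee0_abs// lee_fin -expr2 sqr_ge0.
move=> /(_ measurableT) h.
have /h : measurable_fun setT (fun w => (f w * f w)%:E).
  by apply/measurable_EFinP; exact: measurable_funM.
apply: filterS => w /= /(_ I) [] /eqP.
by rewrite mulf_eq0 orbb => /eqP.
Qed.

End L2.

Lemma geometric_half_le {R : realType} n : \sum_(0 <= k < n) (2^-1 : R) ^+ k <= 2.
Proof.
suff -> : \sum_(0 <= k < n) (2^-1 : R) ^+ k = 2 - 2 * 2^-1 ^+ n.
  by rewrite gerBl mulr_ge0// exprn_ge0.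
elim: n => [|n IH]; first by rewrite big_nil expr0; ring.
by rewrite big_nat_recr//= IH exprS; field.
Qed.

(** * Completeness of L2 (Riesz-Fischer) *)

Section L2_complete.
Context {d : measure_display} {T : measurableType d} {R : realType}.
Variable P : probability T R.
Local Notation L2 := (LfunType P (@le12 R)).
Local Notation nsq := (nsq (ip:=@ip2 _ _ _ P)).
Local Notation nrm := (nrm (ip:=@ip2 _ _ _ P)).
Let S := semi_inner_ip2 P.

Lemma nsq2E (f : L2) : (nsq f)%:E = (\int[P]_w (f w ^+ 2)%:E)%E.
Proof. by rewrite ip2E; apply: eq_integral => w _; rewrite expr2. Qed.

(** The sum of 2^k g_k^2 is integrable, hence finite almost everywhere, and |g_k| <= 2^k g_k^2 +
    2^-k makes the increments g_k summable there. *)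
Lemma fast_cauchy_cvg (v : nat -> L2) :
  (forall k, nrm (v k.+1 - v k) < 2^-1 ^+ k) ->
  \forall w \ae P, cvgn (fun k => v k w).
Proof.
move=> hv; pose g k := v k.+1 - v k.
pose A k w : \bar R := (2 ^+ k * g k w ^+ 2)%:E.
have sq0 k (x : R) : 0 <= 2 ^+ k * x ^+ 2 by apply: mulr_ge0; [exact: exprn_ge0|exact: sqr_ge0].
have A0 k w : (0 <= A k w)%E by rewrite lee_fin sq0.
have mA k : measurable_fun setT (A k).
  apply/measurable_EFinP; apply: measurable_funM => //.
  by apply: measurable_funX; exact: L2_measurable.
have iA k : (\int[P]_w A k w = (2 ^+ k * nsq (g k))%:E)%E.
  rewrite EFinM nsq2E -ge0_integralZl_EFin ?exprn_ge0//.
  - by move=> w _; rewrite lee_fin sqr_ge0.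
  - by apply/measurable_EFinP; apply: measurable_funX; exact: L2_measurable.
have mS : measurable_fun setT (fun w => \sum_(0 <= k <oo) A k w)%E.
  exact: (ge0_emeasurable_sum (P := xpredT)).
have iS : (\int[P]_w (\sum_(0 <= k <oo) A k w) <= 2%:E)%E.
  rewrite integral_nneseries//; apply: lime_le.
    by apply: is_cvg_nneseries => k _ _; apply: integral_ge0 => w _; exact: A0.
  near=> n; under eq_bigr do rewrite iA.
  rewrite sumEFin lee_fin; apply: le_trans (geometric_half_le n).
  apply: ler_sum => k _; rewrite -(sqr_nrm S) -/(g k).
  have h : nrm (g k) ^+ 2 <= (2^-1 ^+ k) ^+ 2.
    by apply: lerXn2r; rewrite ?nnegrE ?nrm_ge0 ?exprn_ge0//; exact: ltW (hv k).
  rewrite mulrC -ler_pdivlMr ?exprn_gt0// -exprVn -expr2 -[leRHS]/(_ ^+ 2).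
  exact: h.
have : P.-integrable setT (fun w => \sum_(0 <= k <oo) A k w)%E.
  apply/integrableP; split=> //; apply: le_lt_trans (ltry 2); apply: le_trans iS.
  by under eq_integral do rewrite gee0_abs ?nneseries_ge0//.
move=> /(integrable_ae measurableT); apply: filterS => w /(_ I) fin.
have cA : cvgn (series (fun k => 2 ^+ k * g k w ^+ 2)).
  apply: nnseries_is_cvg; first by move=> k; exact: sq0.
  by rewrite -ge0_fin_numE ?nneseries_ge0// => k _ _; exact: A0.
have cG : cvgn (series (geometric (1 : R) 2^-1)).
  apply: is_cvg_geometric_series; rewrite ger0_norm//; lra.
have cg : cvgn (series (fun k => g k w)).
  apply: normed_cvg; apply: (series_le_cvg _ _ _ (is_cvg_seriesD cA cG)) => k //=.
  - by apply: addr_ge0; [exact: sq0|apply: mulr_ge0 => //; exact: exprn_ge0].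
  - rewrite -[leRHS]/(2 ^+ k * g k w ^+ 2 + 1 * 2^-1 ^+ k) mul1r.
    set x := `|g k w|; have -> : g k w ^+ 2 = x ^+ 2 by rewrite /x real_normK// num_real.
    have b0 : 0 < 2 ^+ k :> R by rewrite exprn_gt0.
    rewrite exprVn -[leLHS](mulKf (lt0r_neq0 b0)) mulrC ler_pdivrMr// mulrDl mulVf ?gt_eqF//.
    have -> : 2 ^+ k * x ^+ 2 * 2 ^+ k = (2 ^+ k * x) ^+ 2 by ring.
    have := sqr_ge0 (2 ^+ k * x - 1); have : 0 <= 2 ^+ k * x by apply: mulr_ge0; [exact: ltW|exact: normr_ge0].
    set y := 2 ^+ k * x; rewrite sqrrB expr1n mulr1; nra.
have E : (fun k => v k w) = (fun k => series (fun k => g k w) k + v 0%N w).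
  apply/funext => n; rewrite /series /= telescope_sumr//= subrK//.
by rewrite E; apply: is_cvgD => //; exact: is_cvg_cst.
Unshelve. all: by end_near. Qed.

Lemma limn_einf_le (u : (\bar R)^nat) (M : \bar R) :
  (\forall n \near \oo, (u n <= M)%E) -> (limn_einf u <= M)%E.
Proof.
move=> h; rewrite limn_einf_lim; apply: lime_le; first exact: is_cvg_einfs.
near=> n; apply: (@le_trans _ _ (u n)); last by near: n.
by apply: ereal_inf_lbound; exists n => /=.
Unshelve. all: by end_near. Qed.

Lemma limn_einf_ge0 (u : (\bar R)^nat) : (forall n, (0 <= u n)%E) -> (0 <= limn_einf u)%E.
Proof.
move=> h; rewrite limn_einf_lim; apply: lime_ge; first exact: is_cvg_einfs.
by near=> n; apply/ereal_infP => _ [k _ <-].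
Unshelve. all: by end_near. Qed.

(** A fast Cauchy subsequence v converges almost everywhere to some f, and Fatou's lemma bounds the
    distance from f to u n by those from v k to u n. *)
Lemma ip2_complete : ip_complete (@ip2 _ _ _ P).
Proof.
move=> u hu.
have half k : 0 < (2^-1 : R) ^+ k by rewrite exprn_gt0.
have [psi hpsi] := choice (fun k => hu _ (half k)).
(* Partial sums of successors make phi monotone, above psi, and at least k. *)
pose phi k := (\sum_(i < k.+1) (psi i).+1)%N.
have psi_phi k : (psi k <= phi k)%N.
  by rewrite /phi big_ord_recr; apply: (leq_trans (leqnSn _)); exact: leq_addl.
have k_phi k : (k <= phi k)%N.
  elim: k => // k IH; rewrite /phi big_ord_recr /= -[X in (X <= _)%N]addn1.
  exact: leq_add IH (ltn0Sn _).
have phiS k : (phi k <= phi k.+1)%N by rewrite /phi [leqRHS]big_ord_recr leq_addr.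
have phi_mono : {homo phi : i j / (i <= j)%N}.
  by apply: homo_leq => // i j k; exact: leq_trans.
pose v k := u (phi k).
have vf k : nrm (v k.+1 - v k) < 2^-1 ^+ k.
  by apply: hpsi => //; rewrite (leq_trans (psi_phi k)).
have vcv := fast_cauchy_cvg vf.
(* The upper limit gives a function measurable everywhere that equals the limit wherever there is
   one. *)
pose f w : R := fine (limn_esup (fun k => (v k w)%:E)).
have mf : measurable_fun setT f.
  apply: (measurableT_comp (fine_measurable _)) => //.
  by apply: measurable_fun_limn_esup => k; apply/measurable_EFinP; exact: L2_measurable.
have fE w : cvgn (fun k => v k w) -> v k w @[k --> \oo] --> f w.
  move=> /cvg_ex[l vl].
  have : (v k w)%:E @[k --> \oo] --> l%:E by apply: cvg_EFin; [exact: nearW|exact: vl].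
  by move=> /cvg_limn_einf_sup[_]; rewrite /f => ->.
have key n N e : 0 < e -> (N <= n)%N ->
    (forall p q, (N <= p)%N -> (N <= q)%N -> nrm (u p - u q) < e) ->
    (\int[P]_w ((f w - u n w) ^+ 2)%:E <= (e ^+ 2)%:E)%E.
  move=> e0 Nn he.
  pose F k w : \bar R := ((v k w - u n w) ^+ 2)%:E.
  have F0 k w : (0 <= F k w)%E by rewrite lee_fin sqr_ge0.
  have mF k : measurable_fun setT (F k).
    apply/measurable_EFinP; apply: measurable_funX.
    by apply: measurable_funB; exact: L2_measurable.
  apply: (@le_trans _ _ (\int[P]_w limn_einf (F ^~ w))%E).
    rewrite (@ge0_ae_eq_integral _ _ _ P setT (fun w => limn_einf (F ^~ w))
      (fun w => ((f w - u n w) ^+ 2)%:E))//.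
    - rewrite /limn_einf; apply: measurableT_comp => //.
      by apply: measurable_fun_limn_esup => k; apply: measurableT_comp.
    - apply/measurable_EFinP; apply: measurable_funX.
      by apply: measurable_funB => //; exact: L2_measurable.
    - by move=> w _; exact: limn_einf_ge0.
    - by move=> w _; rewrite lee_fin sqr_ge0.
    move: vcv; apply: filterS => w /fE vw _.
    have : F k w @[k --> \oo] --> ((f w - u n w) ^+ 2)%:E.
      apply: cvg_EFin; first exact: nearW.
      have vu : v k w - u n w @[k --> \oo] --> f w - u n w by apply: cvgB => //; exact: cvg_cst.
      exact: (cvgM vu vu).
    by move=> /cvg_limn_einf_sup[].
  apply: (le_trans (fatou _ _ _ _)) => //.
  apply: limn_einf_le; exists N => // k /= Nk.
  rewrite (_ : (\int[P]_w F k w)%E = (nsq (v k - u n))%:E); last by rewrite nsq2E.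
  rewrite lee_fin -(sqr_nrm S); apply: lerXn2r; rewrite ?nnegrE ?nrm_ge0 ?(ltW e0)//.
  by apply/ltW/he => //; exact: leq_trans (k_phi k).
have f2 : f \in Lfun P 2%:E.
  have [N hN] := hu 1 ltr01.
  have h1 := key N N 1 ltr01 (leqnn N) hN.
  have fu : (fun w => f w - u N w) \in Lfun P 2%:E.
    apply/Lfun2P; split; last exact: le_lt_trans h1 (ltry _).
    by apply: measurable_funB => //; exact: L2_measurable.
  rewrite (_ : f = (fun w => f w - u N w) \+ u N); first exact: (Lfun_addr_closed P (@le12 R)).2 _ _ fu (LfunP (u N)).
  by apply/funext => w /=; rewrite subrK.
pose l : L2 := Lfun_Sub (@le12 R) f2.
exists l; apply/cvgrPdist_lt => e e0.
have e20 : 0 < e / 2 by rewrite divr_gt0.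
have [N hN] := hu _ e20; exists N => // n /= Nn.
rewrite sub0r normrN ger0_norm ?nrm_ge0//.
have := key n N _ e20 Nn hN.
rewrite (_ : (\int[P]_w _)%E = (nsq (l - u n))%:E); last by rewrite nsq2E.
rewrite lee_fin -(sqr_nrm S) => h; rewrite (nrmB S).
apply: (@le_lt_trans _ _ (e / 2)); last by rewrite ltr_pdivrMr// ltr_pMr// ltr1n.
by rewrite -ler_sqr ?nnegrE ?nrm_ge0// ltW.
Qed.

End L2_complete.

(** * Processes as curves in L2 *)

Section processes_as_curves.
Context {d : measure_display} {T : measurableType d} {R : realType}.
Variable P : probability T R.
Local Notation L2 := (LfunType P (@le12 R)).
Local Notation nsq := (nsq (ip:=@ip2 _ _ _ P)).
Local Notation nrm := (nrm (ip:=@ip2 _ _ _ P)).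
Local Notation hC := (hC (ip:=@ip2 _ _ _ P)).
Let S := semi_inner_ip2 P.

Definition curve (X : process P) (X2 : square_integrable X) : R -> L2 :=
  fun x => Lfun_Sub (@le12 R) (X2 x).

Lemma expectation_nsq (f : L2) (g : T -> R) : (forall w, g w = f w) ->
  'E_P[(fun w => g w ^+ 2)%R]%E = (nsq f)%:E.
Proof. by move=> gf; rewrite unlock nsq2E; apply: eq_integral => w _; rewrite gf. Qed.

Lemma cvg_nsq_nrm (I : Type) (F : set_system I) (FF : Filter F) (f : I -> L2) :
  (nsq (f i))%:E @[i --> F] --> 0%E <-> nrm (f i) @[i --> F] --> 0.
Proof.
split=> [/fine_cvgP[_ h]|h].
  rewrite -(@sqrtr0 R).
  exact: (continuous_cvg _ (@sqrt_continuous R 0) h).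
apply: cvg_EFin; first exact: nearW.
rewrite (_ : _ \o _ = fun i => nrm (f i) * nrm (f i)); last first.
  by apply/funext => i; rewrite /= -(sqr_nrm S) expr2.
by rewrite -[X in _ --> X](mulr0 0); exact: (cvgM h h).
Qed.

Lemma ms_continuousP X (X2 : square_integrable X) :
  ms_continuous X <-> hcont (ip:=@ip2 _ _ _ P) (curve X2).
Proof.
have E x : (fun y => 'E_P[(fun w => (X y w - X x w) ^+ 2)%R]%E) =
    (fun y => (nsq (curve X2 y - curve X2 x))%:E).
  by apply/funext => y; apply: (@expectation_nsq _ (fun w => X y w - X x w)).
split=> h x; have := h x.
  by rewrite E => /cvg_nsq_nrm.
by rewrite E => /cvg_nsq_nrm.
Qed.

Lemma ms_derivativeP X X' (X2 : square_integrable X) (X'2 : square_integrable X') :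
  ms_derivative X X' <-> hderiv (ip:=@ip2 _ _ _ P) (curve X2) (curve X'2).
Proof.
have E x : (fun h => 'E_P[(fun w => ((X (x + h) w - X x w) / h - X' x w) ^+ 2)%R]%E) =
    (fun h : R => (nsq (h^-1 *: (curve X2 (x + h) - curve X2 x) - curve X'2 x))%:E).
  apply/funext => h.
  apply: (@expectation_nsq _ (fun w => (X (x + h) w - X x w) / h - X' x w)) => w.
  by rewrite mulrC.
split=> h x; have := h x.
  by rewrite E => /cvg_nsq_nrm.
by rewrite E => /cvg_nsq_nrm.
Qed.

Lemma ms_C_square_integrable m (X : process P) : ms_C m X -> square_integrable X.
Proof. by case: m => [|m] []. Qed.

Lemma ms_CP m X (X2 : square_integrable X) : ms_C m X <-> hC m (curve X2).
Proof.
elim: m X X2 => [|m IH] X X2 /=.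
  by rewrite -ms_continuousP; split=> [[]|].
split=> [[_ [X' [dX X'C]]]|[X' dX X'C]].
  have X'2 := ms_C_square_integrable X'C.
  exists (curve X'2); last exact/IH.
  exact/ms_derivativeP.
(* Vectors of [LfunType] are genuine measurable functions, so a derivative curve is itself a
   process. *)
split=> //; pose X'' : process P := fun x => X' x.
have X''2 : square_integrable X'' by move=> x; exact: LfunP.
have E : curve X''2 = X' by apply/funext => x; exact: val_inj.
exists X''; split.
  by apply/(ms_derivativeP X2 X''2); rewrite E.
by apply/(IH _ X''2); rewrite E.
Qed.

End processes_as_curves.

Theorem theorem4p1 (R : realType)
    (d : measure_display) (T : measurableType d) (P : probability T R)
    (d' : measure_display) (T' : measurableType d') (P' : probability T' R)
    (Z : process P) (Y : process P') (psi : R -> R) (m : nat)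
    (Z_gaussian : gaussian_process Z) (Z_zero_mean : zero_mean Z)
    (Z_square_integrable : square_integrable Z)
    (Z_separates : forall x1 x2 : R,
      {ae P, forall w, Z x1 w = Z x2 w} -> x1 = x2)
    (psi_cm : completely_monotonic psi)
    (psi_nonconstant : nonconstant_on_nonneg psi)
    (Y_Sch : is_Schoenberg psi Z Y) :
  ms_C m Y <-> (ms_C m Z /\ derivatives_finite_at_0 psi m).
Proof.
have [_ Y_mean Y_cov] := Y_Sch.
(* Both processes being centred, covariances and variograms are inner products and squared distances
   in L2. *)
have Y_covE x1 x2 : (\int[P']_w (Y x1 w * Y x2 w)%:E)%E = (psi (variogram Z x1 x2))%:E.
  rewrite -Y_cov unlock !Y_mean /= unlock; apply: eq_integral => w _.
  by rewrite -[RHS]/((Y x1 w - 0) * (Y x2 w - 0))%:E !subr0.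
(* The second moment of Y x is the finite number psi (variogram Z x x). *)
have Y2 : square_integrable Y.
  move=> x; apply/Lfun2P; split; first exact: measurable_funPT.
  rewrite (_ : (\int[P']_w _)%E = (psi (variogram Z x x))%:E) ?ltry//.
  by rewrite -Y_covE; apply: eq_integral => w _; rewrite expr2.
rewrite (ms_CP m Y2) (ms_CP m Z_square_integrable).
set z := curve Z_square_integrable.
have gamE x1 x2 : variogram Z x1 x2 = nsq (ip:=@ip2 _ _ _ P) (z x1 - z x2).
  have Z1 x : (Z x : T -> R) \in Lfun P 1.
    by apply: Lfun_subset12; rewrite ?fin_num_measure.
  have EZ : 'E_P[(Z x1 \- Z x2)%R]%E = 0%E.
    by rewrite expectationB// !Z_zero_mean subee.
  rewrite /variogram /variance unlock EZ /= unlock.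
  rewrite -[RHS]/(fine (nsq (ip:=@ip2 _ _ _ P) (z x1 - z x2))%:E) nsq2E; congr fine.
  apply: eq_integral => w _.
  by rewrite -[LHS]/((Z x1 w - Z x2 w - 0) * (Z x1 w - Z x2 w - 0))%:E !subr0 -expr2.
apply: (hC_Y_iff psi_cm psi_nonconstant (semi_inner_ip2 P) (semi_inner_ip2 P')
  (@ip2_complete _ _ _ P) (@ip2_complete _ _ _ P') (@schur_ip2 _ _ _ P)).
- move=> x y xy; rewrite lt_def (nsq_ge0 (semi_inner_ip2 P)) andbT.
  apply: contraNneq xy => /nsq2_eq0 h; apply/eqP/Z_separates.
  by move: h; apply: filterS => w /eqP; rewrite subr_eq0 => /eqP.
- by move=> x y; apply: EFin_inj; rewrite -gamE -Y_covE ip2E.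
Qed.
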